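(* Let $\boldsymbol\alpha=(\alpha_n)_{n\ge1}$ be a sequence compactly included in $\mathbb D$ (i.e. $\sup_n|\alpha_n|<1$), let $\boldsymbol a=(a_n)_{n\ge1}$ be a sequence in $\mathbb D$, and let $\lambda,\lambda_1,\lambda_2\in\mathbb T$. Then: 1. $\{\operatorname{supp}\mu(\boldsymbol a,\boldsymbol\alpha)\}'=\{\lambda\}$ if and only if $$\lim_n\tilde\zeta_n(-\overline{a_n}\,a_{n+1})=\lambda.$$ 2. $\{\operatorname{supp}\mu(\boldsymbol a,\boldsymbol\alpha)\}'\subset\{\lambda_1,\lambda_2\}$ if and only if $$\lim_n\rho_n\rho_{n+1}=0,$$ $$\lim_n\rho_n\left(\frac{\varpi_n(\lambda_1)}{\varpi_n(\alpha_n)}k_n(\lambda_2)-\frac{\varpi_{n-1}^*(\lambda_2)}{\varpi_{n-1}(\alpha_{n-1})}k_{n-1}(\lambda_1)\right)=0,$$ $$\lim_n\left(\overline{k_n(\lambda_1)}\,k_n(\lambda_2)+(\rho_n^-)^2\,\overline{\varpi_{n-1}^*(\lambda_1)}\,\varpi_{n-1}^*(\lambda_2)+(\rho_{n+1}^+)^2\,\overline{\varpi_{n+1}(\lambda_1)}\,\varpi_{n+1}(\lambda_2)\right)=0,$$ where $k_n(z)=a_n\varpi_n^*(z)+a_{n+1}\varpi_n(z)$.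
   Context: $\mathbb T$ is the unit circle, $\mathbb D$ the open unit disk. Measures on $\mathbb T$ are probability Borel measures with infinite support. $L^2_\mu$ carries the inner product $\langle f,g\rangle_\mu=\int\overline{f}\,g\,d\mu$. Let $\boldsymbol\alpha=(\alpha_n)_{n\ge1}$ be a sequence in $\mathbb D$ and set $\alpha_0=0$. For $n\ge0$ let $\varpi_n(z)=1-\overline{\alpha_n}z$, $\varpi_n^*(z)=z-\alpha_n$, $\zeta_n=\varpi_n^*/\varpi_n$, with inverse $\tilde\zeta_n(z)=\dfrac{z+\alpha_n}{1+\overline{\alpha_n}z}$. Let $B_0=1$, $B_n=\zeta_1\cdots\zeta_n$, and $f_*(z)=\overline{f(1/\overline z)}$. The orthogonal rational functions (ORF) $(\phi_n)_{n\ge0}$ of a measure $\mu$ associated with $\boldsymbol\alpha$ are the result of orthonormalizing $(B_n)_{n\ge0}$ in $L^2_\mu$, with unimodular factors chosen so that $\phi_0=1$ and, with $\phi_n^*=B_n\phi_{n*}$, $$\begin{pmatrix}\phi_n\\ \phi_n^*\end{pmatrix}=e_n\frac{\varpi_{n-1}}{\varpi_n}\begin{pmatrix}1&a_n\\ \overline{a_n}&1\end{pmatrix}\begin{pmatrix}\zeta_{n-1}\phi_{n-1}\\ \phi_{n-1}^*\end{pmatrix},\quad e_n=\sqrt{\frac{\varpi_n(\alpha_n)}{\varpi_{n-1}(\alpha_{n-1})}\frac1{1-|a_n|^2}},\quad n\ge1,$$ for some $a_n\in\mathbb D$; the sequence $\boldsymbol a=(a_n)_{n\ge1}$ is uniquely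 determined by $\mu$ and $\boldsymbol\alpha$, and one writes $\boldsymbol a=\mathcal S_{\boldsymbol\alpha}(\mu)$. When $\boldsymbol\alpha$ is compactly included in $\mathbb D$, $\mathcal S_{\boldsymbol\alpha}$ is a bijection between measures on $\mathbb T$ and sequences in $\mathbb D$, and $\mu(\boldsymbol a,\boldsymbol\alpha)$ denotes the unique measure $\mu$ with $\mathcal S_{\boldsymbol\alpha}(\mu)=\boldsymbol a$. Further, $\eta_n=\sqrt{1-|\alpha_n|^2}$, and $$\rho_n=\sqrt{1-|a_n|^2},\qquad \rho_n^+=\frac{\eta_{n-1}}{\eta_n}\rho_n,\qquad \rho_n^-=\frac{\eta_n}{\eta_{n-1}}\rho_n.$$ $\{E\}'$ denotes the set of limit (accumulation) points of a set $E$. *)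

(* Defs.v *)
From HB Require Import structures.
From mathcomp Require Import all_boot all_order all_algebra.
From mathcomp Require Import complex.
From mathcomp Require Import all_classical all_reals all_analysis.

Set Implicit Arguments.
Unset Strict Implicit.
Unset Printing Implicit Defensive.

Import Order.TTheory GRing.Theory Num.Theory.
Import numFieldNormedType.Exports.

Local Open Scope classical_set_scope.
Local Open Scope complex_scope.
Local Open Scope ring_scope.

(* The alias R[i]^o carries the norm topology of the complex numbers; R[i]
   itself has no topology in the library. *)
Definition unit_circle (R : realType) : set R[i]^o :=
  [set z | `|z : R[i]| = 1].

(* The unit circle as a type, with the topology induced from R[i]^o. *)
Definition circle (R : realType) : Type := set_type (@unit_circle R).

HB.instance Definition _ (R : realType) :=
  Topological.copy (circle R) (set_type (@unit_circle R)).

Lemma one_in_unit_circle (R : realType) :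
  (1 : R[i]^o) \in @unit_circle R.
Proof. by rewrite inE /unit_circle /= normr1. Qed.

(* Measurable types have to be pointed. *)
HB.instance Definition _ (R : realType) :=
  isPointed.Build (circle R) (exist _ (1 : R[i]^o) (one_in_unit_circle R)).

Definition circle_val (R : realType) (x : circle R) : R[i] := val x.

Definition borel_circle (R : realType) : Type :=
  g_sigma_algebraType (@open (circle R)).
HB.instance Definition _ (R : realType) :=
  Measurable.copy (borel_circle R) (g_sigma_algebraType (@open (circle R))).

Definition supp (R : realType) (mu : probability (borel_circle R) R) :
    set (circle R) :=
  [set x | forall U : set (circle R), open U -> U x -> (0 < mu U)%E].

Definition inner (R : realType) (mu : probability (borel_circle R) R)
    (f g : R[i] -> R[i]) : R[i] :=
  (\int[mu]_(x in setT) complex.Re ((f (circle_val x))^* * g (circle_val x))) +i*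
  (\int[mu]_(x in setT) complex.Im ((f (circle_val x))^* * g (circle_val x))).

Section RationalFunctions.
Variables (R : realType) (alpha : nat -> R[i]).
Implicit Types (n : nat) (z : R[i]) (f : R[i] -> R[i]).

(* alpha 0 is meant to be 0; this is a hypothesis where it matters. *)
Definition compactly_in_disk : Prop :=
  exists2 r : R, r < 1 & forall n, (0 < n)%N -> `|alpha n| <= r%:C.

Definition varpi n z : R[i] := 1 - (alpha n)^* * z.
Definition varpis n z : R[i] := z - alpha n.
Definition zeta n z : R[i] := varpis n z / varpi n z.
Definition zetat n z : R[i] := (z + alpha n) / (1 + (alpha n)^* * z).

Definition blaschke n z : R[i] := \prod_(1 <= k < n.+1) zeta k z.

Definition lower_star f z : R[i] := (f (1 / z^*))^*.

Definition upper_star n f z : R[i] := blaschke n z * lower_star f z.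

Definition eta n : R[i] := sqrtC (1 - `|alpha n| ^+ 2).

(* Rational functions are represented by total functions (division by 0 gives
   0), so identities between them are only meaningful away from the possible
   poles.  If z is good for n then neither z nor 1 / z^* is a pole of
   zeta 0, ..., zeta n; with alpha 0 = 0 this includes z != 0, and all the
   points of the unit circle are good as soon as |alpha k| < 1. *)
Definition good n z : Prop :=
  forall k, (k <= n)%N -> varpi k z != 0 /\ varpis k z != 0.

Variable a : nat -> R[i].

Definition rho n : R[i] := sqrtC (1 - `|a n| ^+ 2).
Definition rho_plus n : R[i] := eta n.-1 / eta n * rho n.
Definition rho_minus n : R[i] := eta n / eta n.-1 * rho n.

Definition orf_e n : R[i] :=
  sqrtC (varpi n (alpha n) / varpi n.-1 (alpha n.-1)
         * (1 / (1 - `|a n| ^+ 2))).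

Definition kfun n z : R[i] := a n * varpis n z + a n.+1 * varpi n z.

(* phi is the sequence of orthogonal rational functions of mu associated with
   alpha, normalized so that the recurrence with parameters a holds.  Membership
   of phi n in the span of B_0, ..., B_n together with orthonormality says that
   phi is an orthonormalization of (B_n)_n, up to unimodular factors. *)
Record orf_with (mu : probability (borel_circle R) R)
    (phi : nat -> R[i] -> R[i]) : Prop := OrfWith {
  orf_span : forall n, exists c : nat -> R[i], forall z,
    phi n z = \sum_(0 <= k < n.+1) c k * blaschke k z;
  orf_orthonormal : forall m n, inner mu (phi m) (phi n) = (m == n)%:R;
  orf_init : forall z, phi 0%N z = 1;
  orf_param : forall n, (0 < n)%N -> `|a n| < 1;
  orf_rec : forall n z, (0 < n)%N -> good n z ->
    phi n z = orf_e n * (varpi n.-1 z / varpi n z) *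
      (zeta n.-1 z * phi n.-1 z + a n * upper_star n.-1 (phi n.-1) z);
  orf_rec_star : forall n z, (0 < n)%N -> good n z ->
    upper_star n (phi n) z = orf_e n * (varpi n.-1 z / varpi n z) *
      ((a n)^* * (zeta n.-1 z * phi n.-1 z) + upper_star n.-1 (phi n.-1) z) }.

(* S_alpha (mu) = a.  Only the values a n with n >= 1 matter. *)
Definition schur_parameters (mu : probability (borel_circle R) R) : Prop :=
  exists phi, orf_with mu phi.

End RationalFunctions.

(* Main.v *)
Require Import Defs.
From mathcomp Require Import all_boot all_order all_algebra.
From mathcomp Require Import complex.
From mathcomp Require Import all_classical all_reals all_analysis.
From mathcomp Require Import measurable_realfun.
From mathcomp Require Import zify ring lra.
Set Implicit Arguments.
Unset Strict Implicit.
Unset Printing Implicit Defensive.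
Import Order.TTheory GRing.Theory Num.Theory.
Import numFieldNormedType.Exports.
Local Open Scope classical_set_scope.
Local Open Scope complex_scope.
Local Open Scope ring_scope.

(* The functions x_n obtained from phi_n (n even) and phi_n^* (n odd) by dividing
   by the odd-indexed Blaschke factors are orthonormal in L^2(mu) and satisfy a
   three-term recurrence.  Replacing z by lambda in its coefficients gives
   functions h_n(lambda) affine in lambda and zero at lambda = z, so that
   h_n(lambda) = (lambda - z) q_n, where q_n is a bounded combination of x_(n-1),
   x_n and x_(n+1).  The Gram entries <h_n(lambda1), h_k(lambda2)> vanish for
   |n - k| > 2; the remaining ones are, up to bounded factors, the three sequences
   of the theorem.

   If the support accumulates only at lambda1 and lambda2, then outside of finitely
   many atoms |lambda1 - z| |lambda2 - z| is small on the support, while the x_n tend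
   to 0 at each atom; hence the Gram entries tend to 0.

   Conversely, on rational functions f the form
   int (lambda2 - z) conj(lambda1 - z) |f|^2 dmu is represented by the Gram matrix in
   coordinates v_n(f) with sum |v_n(f)|^2 <= C |f|^2.  If the entries tend to 0, the
   form is small compared with |f|^2 as soon as sufficiently many first coordinates
   vanish.  At any other accumulation point of the support such an f can be
   concentrated by means of products of the factors
   (1 + conj(zeta_k(x0)) zeta_k) / 2, and the form is then comparable to |f|^2.

   The first equivalence is the case lambda1 = lambda2 of the second one. *)

(** In operator terms, [(lambda1 - z)^* (lambda2 - z)] acts as a compact operator on L^2(mu) exactly
    when the support accumulates at most at its two zeros, and a banded matrix is compact exactly
    when its entries tend to 0. The proof turns both facts into explicit estimates on finite sums.
    Two obstacles shape it. For varying alpha the matrix of multiplication by [z] is in general not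
    banded, even in the functions x_n, because multiplication by [z] leaves their finite spans. Only
    [lambda - z] applied to the combinations q_n is banded, and for this reason the Gram matrix of
    the h_n replaces the matrix of the operator. For the converse, the vanishing conditions on a
    test function depend on the number of peak factors used to concentrate it, so its coefficients
    cannot be fixed beforehand; the mass near the accumulation point has to be bounded below
    uniformly in the coefficients before that number is chosen. *)

(** * Complex numbers with a real-valued modulus *)

Section ComplexModulus.
Variable R : realType.
Implicit Types z w : R[i].

(** The norm of [R[i]] takes values in [R[i]]; a modulus in [R] gives access to [lra], [nra] and
    real integrals. *)
Definition cabs z : R := complex.Re `|z|.

Lemma cabsE z : `|z| = (cabs z)%:C.
Proof. by rewrite /cabs normc_def. Qed.

Lemma cabs_ge0 z : 0 <= cabs z.
Proof. by rewrite -lecR -cabsE normr_ge0. Qed.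

Lemma cabsM z w : cabs (z * w) = cabs z * cabs w.
Proof. by apply: complexI; rewrite -cabsE normrM !cabsE -rmorphM. Qed.

Lemma cabsD z w : cabs (z + w) <= cabs z + cabs w.
Proof. by rewrite -lecR rmorphD /= -!cabsE ler_normD. Qed.

Lemma cabsN z : cabs (- z) = cabs z.
Proof. by rewrite /cabs normrN. Qed.

Lemma cabs_distC z w : cabs (z - w) = cabs (w - z).
Proof. by rewrite /cabs distrC. Qed.

Lemma cabsJ z : cabs z^* = cabs z.
Proof. by rewrite /cabs norm_conjC. Qed.

Lemma cabs0 : cabs 0 = 0.
Proof. by rewrite /cabs normr0. Qed.

Lemma cabs1 : cabs 1 = 1.
Proof. by rewrite /cabs normr1. Qed.

Lemma cabs_eq0 z : (cabs z == 0) = (z == 0).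
Proof. by rewrite -(inj_eq (@complexI R)) -cabsE normr_eq0. Qed.

Lemma cabs_gt0 z : (0 < cabs z) = (z != 0).
Proof. by rewrite lt_def cabs_eq0 cabs_ge0 andbT. Qed.

Lemma cabsV z : cabs z^-1 = (cabs z)^-1.
Proof. by apply: complexI; rewrite -cabsE normfV cabsE fmorphV. Qed.

Lemma cabsX z n : cabs (z ^+ n) = cabs z ^+ n.
Proof. by elim: n => [|n IH]; rewrite ?expr0 ?cabs1 // !exprS cabsM IH. Qed.

Lemma cabsR (x : R) : cabs x%:C = `|x|.
Proof. by rewrite /cabs normc_def /= expr0n /= addr0 sqrtr_sqr. Qed.

Lemma cabs_sub z w : cabs z - cabs w <= cabs (z - w).
Proof. by have := cabsD (z - w) w; rewrite subrK; lra. Qed.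

Lemma cabs_sq z : cabs z ^+ 2 = complex.Re z ^+ 2 + complex.Im z ^+ 2.
Proof. by apply: complexI; rewrite add_Re2_Im2 cabsE rmorphXn. Qed.

Lemma mulJC z : z^* * z = (cabs z ^+ 2)%:C.
Proof. by rewrite mulrC -normCK cabsE rmorphXn. Qed.

Lemma Re_le_cabs z : `|complex.Re z| <= cabs z.
Proof. by rewrite -(@ler_pXn2r _ 2) ?nnegrE ?cabs_ge0 // cabs_sq real_normK ?num_real // lerDl sqr_ge0. Qed.

Lemma Im_le_cabs z : `|complex.Im z| <= cabs z.
Proof. by rewrite -(@ler_pXn2r _ 2) ?nnegrE ?cabs_ge0 // cabs_sq real_normK ?num_real // lerDr sqr_ge0. Qed.

Lemma cabs_le_ReIm z : cabs z <= `|complex.Re z| + `|complex.Im z|.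
Proof.
rewrite -(@ler_pXn2r _ 2) ?nnegrE ?cabs_ge0 ?addr_ge0 // cabs_sq sqrrD !real_normK ?num_real //.
by rewrite addrAC lerDl mulrn_wge0 // mulr_ge0.
Qed.

Lemma cjD z w : (z + w)^* = z^* + w^*. Proof. exact: rmorphD. Qed.
Lemma cjB z w : (z - w)^* = z^* - w^*. Proof. exact: rmorphB. Qed.
Lemma cjN z : (- z)^* = - z^*. Proof. exact: rmorphN. Qed.
Lemma cjM z w : (z * w)^* = z^* * w^*. Proof. exact: rmorphM. Qed.
Lemma cjV z : (z^-1)^* = (z^*)^-1. Proof. exact: fmorphV. Qed.
Lemma cj0 : (0 : R[i])^* = 0. Proof. exact: rmorph0. Qed.
Lemma cj1 : (1 : R[i])^* = 1. Proof. exact: rmorph1. Qed.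
Lemma cjR (x : R) : (x%:C)^* = x%:C. Proof. exact: conjc_real. Qed.

Lemma cabs_sum (I : Type) (r : seq I) (P : pred I) (F : I -> R[i]) :
  cabs (\sum_(i <- r | P i) F i) <= \sum_(i <- r | P i) cabs (F i).
Proof.
elim/big_ind2 : _ => [|x1 x2 y1 y2 h1 h2|//]; first by rewrite cabs0.
exact: le_trans (cabsD _ _) (lerD h1 h2).
Qed.

Lemma cabs_prod (I : Type) (r : seq I) (P : pred I) (F : I -> R[i]) :
  cabs (\prod_(i <- r | P i) F i) = \prod_(i <- r | P i) cabs (F i).
Proof.
by elim/big_ind2 : _ => [|x1 x2 y1 y2 <- <-|//]; rewrite ?cabs1 ?cabsM.
Qed.

(** The radii of the norm topology on [R[i]^o] are positive elements of [R[i]], hence real. *)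
Lemma cvgn_cabsP (u : nat -> R[i]) (l : R[i]) :
  ((u : nat -> R[i]^o) @ \oo --> (l : R[i]^o)) <->
  forall e : R, 0 < e -> exists N, forall n, (N <= n)%N -> cabs (u n - l) < e.
Proof.
split=> [/cvgrPdist_lt h e e0|h].
  have /h[N _ hN] : 0 < (e%:C : R[i]^o) by rewrite ltcR.
  by exists N => n /hN /=; rewrite distrC cabsE ltcR.
apply/cvgrPdist_lt => e e0; have eE : e = (complex.Re e)%:C.
  by rewrite RRe_real // ger0_real // ltW.
have [|N hN] := h (complex.Re e); first by move: e0; rewrite {1}eE ltcR.
by exists N => // n /= /hN; rewrite -ltcR -eE -cabsE distrC.
Qed.

End ComplexModulus.

(** * The circle as a compact metric space *)

Section CircleTopology.
Variable R : realType.
Implicit Types s t : circle R.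

Definition cdist s t : R := cabs (circle_val s - circle_val t).

Lemma cdistxx s : cdist s s = 0.
Proof. by rewrite /cdist subrr cabs0. Qed.

Lemma cdistC s t : cdist s t = cdist t s.
Proof. by rewrite /cdist cabs_distC. Qed.

Lemma cdistD t s u : cdist s u <= cdist s t + cdist t u.
Proof. by rewrite /cdist; apply: le_trans (cabsD _ _); rewrite addrA subrK. Qed.

Lemma cabs_circle s : cabs (circle_val s) = 1.
Proof.
apply: complexI; rewrite -cabsE.
by have := valP s; rewrite inE.
Qed.

Lemma cdist_eq0 s t : cdist s t = 0 -> s = t.
Proof.
move=> h; apply: val_inj; apply/eqP; rewrite -subr_eq0 -cabs_eq0; exact/eqP.
Qed.

Lemma cdist_neq0 s t : s != t -> 0 < cdist s t.
Proof.
rewrite lt_def cabs_ge0 andbT; apply: contraNN => /eqP h.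
by apply/eqP; apply: cdist_eq0.
Qed.

Lemma nbhs_circleP s (U : set (circle R)) :
  nbhs s U <-> exists2 e : R, 0 < e & forall t, cdist s t < e -> U t.
Proof.
split.
  case=> _ [[B Bop <-] Bs sBU].
  have /nbhs_ballP[e e0 he] : nbhs (val s : R[i]^o) B by apply: open_nbhs_nbhs.
  have eE : e = (complex.Re e)%:C by rewrite RRe_real // ger0_real // ltW.
  exists (complex.Re e) => [|t ht]; first by move: e0; rewrite {1}eE /= ltcR.
  by apply: sBU; apply: he; rewrite -ball_normE /= eE cabsE ltcR.
case=> e e0 h.
exists (circle_val (R := R) @^-1` [set z : R[i]^o | (cabs (circle_val s - z) < e)]); split => //=.
- exists [set z : R[i]^o | (cabs (circle_val s - z) < e)] => //.
  have -> : [set z : R[i]^o | cabs (circle_val s - z) < e]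
      = ball (circle_val s : R[i]^o) (e%:C : R[i]).
    by rewrite -ball_normE; apply/seteqP; split=> z /=; rewrite cabsE ltcR.
  by apply: ball_open; rewrite ltcR.
- by rewrite subrr cabs0.
Qed.

Lemma open_cball s (e : R) : open [set t | cdist s t < e].
Proof.
rewrite openE => t /= ht; apply/nbhs_circleP; exists (e - cdist s t); first by rewrite subr_gt0.
by move=> u hu /=; have := cdistD t s u; lra.
Qed.

Lemma open_circleP (U : set (circle R)) :
  open U <-> forall s, U s -> exists2 e : R, 0 < e & forall t, cdist s t < e -> U t.
Proof.
by rewrite openE; split=> h s /h /nbhs_circleP.
Qed.

Lemma continuous_circle (V : normedModType R) (f : circle R -> V) (C : R) :
  (forall s t, `|f s - f t| <= C * cdist s t) -> continuous f.
Proof.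
move=> h s; apply/(@cvgrPdist_lt _ V (circle R) (nbhs s)) => e e0.
apply/nbhs_circleP; exists (e / (`|C| + 1)).
  by rewrite divr_gt0 // ltr_wpDl.
move=> t; rewrite ltr_pdivlMr ?ltr_wpDl // => ht.
apply: le_lt_trans (h s t) _; apply: le_lt_trans ht.
rewrite mulrC ler_wpM2l ?cabs_ge0 //.
by have := ler_norm C; lra.
Qed.

(* With its opposite, the Cayley parametrization covers the circle by two images
   of [-1, 1]. *)
Let cay (t : R) : R[i] := ((1 - t ^+ 2) +i* (2 * t)) / (1 + t ^+ 2)%:C.

Let den_gt0 (t : R) : 0 < 1 + t ^+ 2.
Proof. by have := sqr_ge0 t; lra. Qed.

Let cay_cabs (t : R) : cabs (cay t) = 1.
Proof.
rewrite /cay cabsM cabsV cabsR gtr0_norm //.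
apply: (@mulIf _ (1 + t ^+ 2)); first by rewrite gt_eqF.
rewrite mulfVK ?gt_eqF // mul1r; apply/eqP.
rewrite -(@eqrXn2 _ 2) ?cabs_ge0 ?ltW // cabs_sq /=; apply/eqP; ring.
Qed.

Let cay_in (sg : R[i]) (h : cabs sg = 1) (t : R) : (sg * cay t : R[i]^o) \in @unit_circle R.
Proof. by rewrite inE /unit_circle /= cabsE cabsM h cay_cabs mul1r. Qed.

Let cayc sg h (t : R) : circle R := exist _ (sg * cay t : R[i]^o) (@cay_in sg h t).

Let cay_sub (t u : R) : cabs (cay t - cay u) <= 2 * `|t - u|.
Proof.
have -> : cay t - cay u = (2 * (t - u))%:C *
   ((- (t + u)) +i* (1 - t * u)) / ((1 + t ^+ 2) * (1 + u ^+ 2))%:C.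
  rewrite /cay; have h1 := gt_eqF (den_gt0 t); have h2 := gt_eqF (den_gt0 u).
  apply/eqP; rewrite -!fmorphV.
  rewrite eq_complex /= !mulr0 !mul0r !subr0 ?addr0 ?add0r.
  by apply/andP; split; apply/eqP; field; rewrite ?h1 ?h2.
rewrite !cabsM cabsV !cabsR normrM [`|2|]gtr0_norm // -!mulrA ler_wpM2l //.
rewrite -{2}[`|t - u|]mulr1 ler_wpM2l // gtr0_norm ?mulr_gt0 //.
rewrite ler_pdivrMr ?mulr_gt0 // mul1r.
have A0 := mulr_gt0 (den_gt0 t) (den_gt0 u).
rewrite -(@ler_pXn2r _ 2) ?nnegrE ?cabs_ge0 ?(ltW A0) // cabs_sq /=.
(* The squared modulus of the numerator is the denominator itself, which is at least 1. *)
have -> : (- (t + u)) ^+ 2 + (1 - t * u) ^+ 2 = (1 + t ^+ 2) * (1 + u ^+ 2) by ring.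
rewrite expr2 ler_peMl ?(ltW A0) // -{1}[1]mulr1 ler_pM ?ler01 //.
  by have := sqr_ge0 t; lra.
by have := sqr_ge0 u; lra.
Qed.

Let cayc_continuous sg h : continuous (cayc (sg := sg) h).
Proof.
move=> t U /nbhs_circleP[e e0 hU] /=.
apply/nbhs_ballP; exists (e / 2); first by rewrite /= divr_gt0.
move=> u; rewrite -ball_normE /= => hu; apply: hU.
rewrite /cdist /= -mulrBr cabsM h mul1r; apply: le_lt_trans (cay_sub _ _) _.
lra.
Qed.

Lemma circle_compact : compact [set: circle R].
Proof.
have cN1 : cabs (-1 : R[i]) = 1 by rewrite cabsN cabs1.
pose K sg h := [set cayc (sg := sg) h u | u in `[(-1 : R), 1]%classic].
have Kc sg h : compact (K sg h).
  apply: continuous_compact; last exact: segment_compact.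
  by apply: continuous_subspaceT; exact: cayc_continuous.
suff -> : [set: circle R] = K 1 (cabs1 R) `|` K (-1) cN1 by apply: compactU.
have key z : cabs z = 1 -> 0 <= complex.Re z -> exists2 t : R, `[-1, 1]%classic t & z = cay t.
  move=> hz; have := cabs_sq z; rewrite hz; case: z hz => x y hz /= hxy x0.
  have x1 : 0 < 1 + x by lra.
  (* The tangent of half the argument. *)
  exists (y / (1 + x)).
    rewrite /= in_itv /= ler_pdivlMr // ler_pdivrMr //; apply/andP; split; nra.
  have dn : 1 + (y / (1 + x)) ^+ 2 = 2 / (1 + x).
    have -> : (y / (1 + x)) ^+ 2 = y ^+ 2 / (1 + x) ^+ 2 by rewrite expr_div_n.
    have -> : y ^+ 2 = (1 + x) * (1 - x) by nra.
    by field; rewrite gt_eqF.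
  rewrite /cay dn -fmorphV; apply/eqP; rewrite eq_complex /= !mulr0 subr0 add0r.
  have -> : 1 - (y / (1 + x)) ^+ 2 = 2 * x / (1 + x).
    have -> : (y / (1 + x)) ^+ 2 = 2 / (1 + x) - 1 by rewrite -dn; ring.
    by field; rewrite gt_eqF.
  by apply/andP; split; apply/eqP; field; rewrite gt_eqF.
apply/seteqP; split => // s _; have hs := cabs_circle s.
have [h0|h0] := leP 0 (complex.Re (circle_val s)).
  by left; have [t ht hts] := key _ hs h0; exists t => //; apply: val_inj; rewrite /= mul1r -hts.
right; have [||t ht hts] := key (- circle_val s); first by rewrite cabsN.
  by case: (circle_val s) h0 => x y /=; lra.
by exists t => //; apply: val_inj; rewrite /= -hts mulN1r opprK.
Qed.

Lemma circle_finite_cover (e : circle R -> R) : (forall s, 0 < e s) ->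
  exists l : seq (circle R), forall t, exists2 s, s \in l & cdist s t < e s.
Proof.
move=> e0; have := circle_compact; rewrite compact_cover => /(_ _ setT (fun s => [set t | cdist s t < e s])).
case=> [s _|t _|D _ hD]; first exact: open_cball.
  by exists t => //=; rewrite cdistxx.
exists (finmap.enum_fset D) => t; have [s /= sD st] := hD t I.
by exists s.
Qed.

(** Every point of the circle has a ball in which [S] and [K] share at most the centre; by
    compactness finitely many such balls suffice. *)
Lemma not_limit_point_finite (S K : set (circle R)) : closed K ->
  (forall s, K s -> ~ limit_point S s) ->
  exists l : seq (circle R), forall s, S s -> K s -> s \in l.
Proof.
move=> Kcl h.
have : forall s, exists e : R, 0 < e /\ forall t, cdist s t < e -> S t -> K t -> t = s.
  move=> s; have [Ks|nKs] := pselect (K s).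
    have := h s Ks; rewrite not_limit_pointE => -[X /nbhs_circleP[e e0 he] hX].
    by exists e; split=> // t /he Xt St _; apply: hX.
  have /open_circleP/(_ s nKs)[e e0 he] : open (~` K) by rewrite openC.
  by exists e; split=> // t /he.
move=> /boolp.choice[e he]; have [l hl] := circle_finite_cover (fun s => (he s).1).
exists l => t St Kt; have [s sl hs] := hl t.
by rewrite ((he s).2 _ hs St Kt).
Qed.

End CircleTopology.

(** * Integration on the circle *)

Section CircleIntegral.
Variables (R : realType) (mu : probability (borel_circle R) R).

(** Bounded and measurable: stable under products and integrable for every probability. *)
Definition rnice (f : circle R -> R) : Prop :=
  measurable_fun [set: borel_circle R] f /\ exists C, forall s, `|f s| <= C.

Definition rint (f : circle R -> R) : R := \int[mu]_(x in setT) f x.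

Lemma rnice_cst (c : R) : rnice (fun=> c).
Proof. by split; [exact: measurable_cst | exists `|c|]. Qed.

Lemma rnice_add f g : rnice f -> rnice g -> rnice (fun s => f s + g s).
Proof.
move=> [mf [C hC]] [mg [D hD]]; split; first exact: measurable_funD.
by exists (C + D) => s; rewrite (le_trans (ler_normD _ _)) // lerD.
Qed.

Lemma rnice_mul f g : rnice f -> rnice g -> rnice (fun s => f s * g s).
Proof.
move=> [mf [C hC]] [mg [D hD]]; split; first exact: measurable_funM.
by exists (C * D) => s; rewrite normrM ler_pM.
Qed.

Lemma rnice_opp f : rnice f -> rnice (fun s => - f s).
Proof.
move=> hf; rewrite (_ : (fun _ => _) = (fun s => -1 * f s)); last first.
  by apply/funext => s; rewrite mulN1r.
by apply: rnice_mul => //; exact: rnice_cst.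
Qed.

Lemma rnice_sub f g : rnice f -> rnice g -> rnice (fun s => f s - g s).
Proof. by move=> hf hg; apply: rnice_add => //; exact: rnice_opp. Qed.

Lemma measurable_open (U : set (circle R)) :
  open U -> measurable (U : set (borel_circle R)).
Proof. by move=> oU; apply: sub_sigma_algebra. Qed.

Lemma rnice_indic (A : set (circle R)) :
  measurable (A : set (borel_circle R)) -> rnice (\1_A).
Proof.
move=> mA; split; first exact: measurable_indic.
by exists 1 => s; rewrite indicE; case: (_ \in _); rewrite ?normr1 ?normr0.
Qed.

Lemma rnice_sum (I : eqType) (r : seq I) (F : I -> circle R -> R) :
  (forall i, i \in r -> rnice (F i)) -> rnice (fun s => \sum_(i <- r) F i s).
Proof.
elim: r => [_|i r IH h].
  by under eq_fun do rewrite big_nil; exact: rnice_cst.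
under eq_fun do rewrite big_cons; apply: rnice_add; first by apply: h; rewrite mem_head.
by apply: IH => j jr; apply: h; rewrite in_cons jr orbT.
Qed.

Lemma rnice_integrable f : rnice f -> mu.-integrable setT (EFin \o f).
Proof.
move=> [mf [C hC]]; apply: measurable_bounded_integrable => //.
  exact: le_lt_trans (probability_le1 _ _) (ltry _).
exists C; split; first exact: num_real.
by move=> x Cx s _ /=; apply: le_trans (hC s) (ltW Cx).
Qed.

Lemma rintD f g : rnice f -> rnice g ->
  rint (fun s => f s + g s) = rint f + rint g.
Proof. by move=> hf hg; apply: RintegralD => //; exact: rnice_integrable. Qed.

Lemma rintZ c f : rnice f -> rint (fun s => c * f s) = c * rint f.
Proof. by move=> hf; apply: RintegralZl => //; exact: rnice_integrable. Qed.

Lemma rint_cst c : rint (fun=> c) = c.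
Proof. by rewrite /rint Rintegral_cst // [X in fine X](probability_setT mu) /= mulr1. Qed.

Lemma le_rint f g : rnice f -> rnice g -> (forall s, f s <= g s) -> rint f <= rint g.
Proof.
by move=> hf hg h; apply: le_Rintegral => //; exact: rnice_integrable.
Qed.

Lemma rint_ge0 f : (forall s, 0 <= f s) -> 0 <= rint f.
Proof. by move=> h; exact: Rintegral_ge0. Qed.

Lemma rint_indic (A : set (circle R)) :
  measurable (A : set (borel_circle R)) -> rint (\1_A) = fine (mu A).
Proof.
by move=> mA; rewrite /rint /Rintegral integral_indic // setIT.
Qed.

Lemma rint_sum (I : eqType) (r : seq I) (F : I -> circle R -> R) :
  (forall i, i \in r -> rnice (F i)) ->
  rint (fun s => \sum_(i <- r) F i s) = \sum_(i <- r) rint (F i).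
Proof.
elim: r => [_|i r IH h].
  by under eq_fun do rewrite big_nil; rewrite rint_cst big_nil.
rewrite big_cons -IH; last by move=> j jr; apply: h; rewrite in_cons jr orbT.
under eq_fun do rewrite big_cons; apply: rintD; first by apply: h; rewrite mem_head.
by apply: rnice_sum => j jr; apply: h; rewrite in_cons jr orbT.
Qed.

Lemma rnice_continuous (f : circle R -> R) : continuous f ->
  (exists C, forall s, `|f s| <= C) -> rnice f.
Proof.
move=> cf hC; split=> //.
apply: (measurability _ (RGenOpens.measurableE R)) => _ [_ [a [b ->] <-]].
rewrite setTI; apply: measurable_open; move/continuousP : cf; apply.
exact: interval_open.
Qed.

Definition cnice (f : circle R -> R[i]) : Prop :=
  rnice (fun s => complex.Re (f s)) /\ rnice (fun s => complex.Im (f s)).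

Lemma ReM (x y : R[i]) : complex.Re (x * y) =
  complex.Re x * complex.Re y - complex.Im x * complex.Im y.
Proof. by case: x y => [a b] [c d]. Qed.

Lemma ImM (x y : R[i]) : complex.Im (x * y) =
  complex.Re x * complex.Im y + complex.Im x * complex.Re y.
Proof. by case: x y => [a b] [c d]. Qed.

Lemma ReJ (x : R[i]) : complex.Re x^* = complex.Re x.
Proof. by case: x. Qed.

Lemma ImJ (x : R[i]) : complex.Im x^* = - complex.Im x.
Proof. by case: x. Qed.

Lemma ReD (x y : R[i]) : complex.Re (x + y) = complex.Re x + complex.Re y.
Proof. by case: x y => [a b] [c d]. Qed.

Lemma ImD (x y : R[i]) : complex.Im (x + y) = complex.Im x + complex.Im y.
Proof. by case: x y => [a b] [c d]. Qed.

Lemma cnice_cst c : cnice (fun=> c).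
Proof. by split; exact: rnice_cst. Qed.

Lemma cnice_real f : rnice f -> cnice (fun s => (f s)%:C).
Proof. by move=> hf; split => //=; exact: rnice_cst. Qed.

Lemma cnice_add f g : cnice f -> cnice g -> cnice (fun s => f s + g s).
Proof.
move=> [f1 f2] [g1 g2]; split.
  by under eq_fun do rewrite ReD; exact: rnice_add.
by under eq_fun do rewrite ImD; exact: rnice_add.
Qed.

Lemma cnice_mul f g : cnice f -> cnice g -> cnice (fun s => f s * g s).
Proof.
move=> [f1 f2] [g1 g2]; split.
  by under eq_fun do rewrite ReM; apply: rnice_sub; exact: rnice_mul.
by under eq_fun do rewrite ImM; apply: rnice_add; exact: rnice_mul.
Qed.

Lemma cnice_conj f : cnice f -> cnice (fun s => (f s)^*).
Proof.
move=> [f1 f2]; split.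
  by under eq_fun do rewrite ReJ.
by under eq_fun do rewrite ImJ; exact: rnice_opp.
Qed.

Lemma cnice_scale c f : cnice f -> cnice (fun s => c * f s).
Proof. by move=> hf; apply: cnice_mul => //; exact: cnice_cst. Qed.

Lemma cnice_sub f g : cnice f -> cnice g -> cnice (fun s => f s - g s).
Proof.
move=> hf hg; apply: cnice_add => //.
by under eq_fun do rewrite -mulN1r; exact: cnice_scale.
Qed.

Lemma cnice_sum (I : eqType) (r : seq I) (F : I -> circle R -> R[i]) :
  (forall i, i \in r -> cnice (F i)) -> cnice (fun s => \sum_(i <- r) F i s).
Proof.
elim: r => [_|i r IH h].
  by under eq_fun do rewrite big_nil; exact: cnice_cst.
under eq_fun do rewrite big_cons; apply: cnice_add; first by apply: h; rewrite mem_head.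
by apply: IH => j jr; apply: h; rewrite in_cons jr orbT.
Qed.

Lemma rnice_cabs_sq f : cnice f -> rnice (fun s => cabs (f s) ^+ 2).
Proof.
move=> [f1 f2]; under eq_fun do rewrite cabs_sq !expr2.
by apply: rnice_add; exact: rnice_mul.
Qed.

Definition cint (f : circle R -> R[i]) : R[i] :=
  rint (fun s => complex.Re (f s)) +i* rint (fun s => complex.Im (f s)).

Lemma cintD f g : cnice f -> cnice g ->
  cint (fun s => f s + g s) = cint f + cint g.
Proof.
move=> [f1 f2] [g1 g2]; apply/eqP; rewrite eq_complex /=.
under eq_fun do rewrite ReD; under [X in _ && (rint X == _)]eq_fun do rewrite ImD.
by rewrite !rintD ?eqxx.
Qed.

Lemma cintZ c f : cnice f -> cint (fun s => c * f s) = c * cint f.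
Proof.
move=> [f1 f2]; case: c => a b; apply/eqP; rewrite eq_complex /=.
under eq_fun do rewrite ReM /= -mulNr.
under [X in _ && (rint X == _)]eq_fun do rewrite ImM /=.
have h c g : rnice g -> rnice (fun s => c * g s).
  by move=> ?; apply: rnice_mul => //; exact: rnice_cst.
by rewrite !rintD ?rintZ ?mulNr ?eqxx //; exact: h.
Qed.

Lemma cint_conj f : cnice f -> cint (fun s => (f s)^*) = (cint f)^*.
Proof.
move=> [f1 f2]; apply/eqP; rewrite eq_complex /=.
under eq_fun do rewrite ReJ; under [X in _ && (rint X == _)]eq_fun do rewrite ImJ -mulN1r.
by rewrite rintZ // mulN1r !eqxx.
Qed.

Lemma cint_real f : cint (fun s => (f s)%:C) = (rint f)%:C.
Proof. by rewrite /cint /= rint_cst. Qed.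

(** The factor 2 comes from bounding real and imaginary parts separately; all later constants leave
    room for it. *)
Lemma cabs_cint f g : cnice f -> rnice g -> (forall s, cabs (f s) <= g s) ->
  cabs (cint f) <= 2 * rint g.
Proof.
move=> [f1 f2] hg h; apply: le_trans (cabs_le_ReIm _) _ => /=.
have key u : rnice u -> (forall s, `|u s| <= g s) -> `|rint u| <= rint g.
  move=> hu hug; rewrite ler_norml; apply/andP; split; last first.
    by apply: le_rint => // s; apply: le_trans (ler_norm _) (hug s).
  rewrite lerNl -mulN1r -rintZ //; apply: le_rint => //.
    by under eq_fun do rewrite mulN1r; exact: rnice_opp.
  by move=> s; rewrite mulN1r; apply: le_trans (hug s); rewrite -normrN ler_norm.
have := key _ f1 (fun s => le_trans (Re_le_cabs _) (h s)).
have := key _ f2 (fun s => le_trans (Im_le_cabs _) (h s)).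
lra.
Qed.

(** Lipschitz for the chord distance. The class is stable under the operations that build rational
    functions, and by [lip_nice] it yields boundedness and measurability at once. *)
Definition lip (f : circle R -> R[i]) : Prop :=
  exists2 C, 0 <= C & forall s t, cabs (f s - f t) <= C * cdist s t.

Lemma cdist_le2 (s t : circle R) : cdist s t <= 2.
Proof.
by apply: le_trans (cabsD _ _) _; rewrite cabsN !cabs_circle; lra.
Qed.

Lemma lip_bounded f : lip f -> exists2 C, 0 <= C & forall s, cabs (f s) <= C.
Proof.
move=> [C C0 h]; exists (cabs (f point) + C * 2) => [|s].
  by rewrite addr_ge0 ?cabs_ge0 ?mulr_ge0.
have := h s point; have := cabs_sub (f s) (f point).
have := ler_wpM2l C0 (cdist_le2 s point); lra.
Qed.

Lemma lip_cst c : lip (fun=> c).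
Proof. by exists 0 => // s t; rewrite subrr cabs0 mul0r. Qed.

Lemma lip_val : lip (@circle_val R).
Proof. by exists 1 => // s t; rewrite mul1r. Qed.

Lemma lip_add f g : lip f -> lip g -> lip (fun s => f s + g s).
Proof.
move=> [C C0 hC] [D D0 hD]; exists (C + D); first exact: addr_ge0.
move=> s t; rewrite opprD addrACA mulrDl.
exact: le_trans (cabsD _ _) (lerD (hC s t) (hD s t)).
Qed.

Lemma lip_mul f g : lip f -> lip g -> lip (fun s => f s * g s).
Proof.
move=> hf hg; have [A A0 hA] := lip_bounded hf; have [B B0 hB] := lip_bounded hg.
case: hf hg => [C C0 hC] [D D0 hD]; exists (A * D + C * B).
  by rewrite addr_ge0 ?mulr_ge0.
move=> s t; rewrite (_ : _ - _ = f s * (g s - g t) + (f s - f t) * g t); last by ring.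
apply: le_trans (cabsD _ _) _; rewrite !cabsM mulrDl -mulrA.
by rewrite (mulrAC C) lerD // ler_pM ?cabs_ge0.
Qed.

Lemma lip_scale c f : lip f -> lip (fun s => c * f s).
Proof. by move=> hf; apply: lip_mul => //; exact: lip_cst. Qed.

Lemma lip_conj f : lip f -> lip (fun s => (f s)^*).
Proof.
by move=> [C C0 h]; exists C => // s t; rewrite -rmorphB cabsJ.
Qed.

Lemma lip_sum (I : Type) (r : seq I) (F : I -> circle R -> R[i]) :
  (forall i, lip (F i)) -> lip (fun s => \sum_(i <- r) F i s).
Proof.
move=> h; elim: r => [|i r IH].
  by under eq_fun do rewrite big_nil; exact: lip_cst.
by under eq_fun do rewrite big_cons; exact: lip_add.
Qed.

Lemma lip_prod (I : Type) (r : seq I) (F : I -> circle R -> R[i]) :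
  (forall i, lip (F i)) -> lip (fun s => \prod_(i <- r) F i s).
Proof.
move=> h; elim: r => [|i r IH].
  by under eq_fun do rewrite big_nil; exact: lip_cst.
by under eq_fun do rewrite big_cons; exact: lip_mul.
Qed.

Lemma lip_inv f c : lip f -> 0 < c -> (forall s, c <= cabs (f s)) ->
  lip (fun s => (f s)^-1).
Proof.
move=> [C C0 h] c0 hc; exists (C / c ^+ 2); first by rewrite mulr_ge0 // invr_ge0 sqr_ge0.
have f0 s : f s != 0 by rewrite -cabs_gt0; apply: lt_le_trans (hc s).
move=> s t; rewrite (_ : _ - _ = (f t - f s) / (f s * f t)); last first.
  by field; rewrite !f0.
rewrite cabsM cabsV cabsM mulrAC ler_pM ?invr_ge0 ?mulr_ge0 ?cabs_ge0 //.
  by rewrite cabs_distC.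
by rewrite lef_pV2 ?posrE ?mulr_gt0 ?cabs_gt0 // expr2 ler_pM ?(ltW c0).
Qed.

Lemma lip_nice f : lip f -> cnice f.
Proof.
move=> hf; have [B B0 hB] := lip_bounded hf; case: hf => [C C0 h].
split; apply: rnice_continuous.
- apply: (@continuous_circle _ _ _ C) => s t; apply: le_trans (h s t).
  by apply: le_trans (Re_le_cabs _); rewrite ReD; case: (f t).
- by exists B => s; apply: le_trans (Re_le_cabs _) (hB s).
- apply: (@continuous_circle _ _ _ C) => s t; apply: le_trans (h s t).
  by apply: le_trans (Im_le_cabs _); rewrite ImD; case: (f t).
- by exists B => s; apply: le_trans (Im_le_cabs _) (hB s).
Qed.

(** Convertible to [inner] when both functions are restrictions from the plane; [orp_orth] relies on
    this. *)
Definition ip (f g : circle R -> R[i]) : R[i] := cint (fun s => (f s)^* * g s).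

Lemma cnice_ip f g : cnice f -> cnice g -> cnice (fun s => (f s)^* * g s).
Proof. by move=> hf hg; apply: cnice_mul => //; exact: cnice_conj. Qed.

Lemma ipDr f g h : cnice f -> cnice g -> cnice h ->
  ip f (fun s => g s + h s) = ip f g + ip f h.
Proof.
move=> hf hg hh; rewrite /ip -cintD; try exact: cnice_ip.
by under eq_fun do rewrite mulrDr.
Qed.

Lemma ipZr c f g : cnice f -> cnice g -> ip f (fun s => c * g s) = c * ip f g.
Proof.
move=> hf hg; rewrite /ip -cintZ; last exact: cnice_ip.
by under eq_fun do rewrite mulrCA.
Qed.

Lemma ipC f g : cnice f -> cnice g -> (ip f g)^* = ip g f.
Proof.
move=> hf hg; rewrite /ip -cint_conj; last exact: cnice_ip.
by congr (cint _); apply/funext => s; rewrite cjM conjCK mulrC.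
Qed.

Lemma ipDl f g h : cnice f -> cnice g -> cnice h ->
  ip (fun s => g s + h s) f = ip g f + ip h f.
Proof.
move=> hf hg hh; rewrite -ipC //; last exact: cnice_add.
by rewrite ipDr // cjD !ipC.
Qed.

Lemma ipZl c f g : cnice f -> cnice g -> ip (fun s => c * g s) f = c^* * ip g f.
Proof.
move=> hf hg; rewrite -ipC //; last exact: cnice_scale.
by rewrite ipZr // cjM ipC.
Qed.

Lemma ip_sumr (I : eqType) (r : seq I) (c : I -> R[i]) (F : I -> circle R -> R[i]) f :
  cnice f -> (forall i, i \in r -> cnice (F i)) ->
  ip f (fun s => \sum_(i <- r) c i * F i s) = \sum_(i <- r) c i * ip f (F i).
Proof.
move=> hf; elim: r => [_|i r IH h].
  rewrite big_nil -[RHS](mul0r (ip f f)) -ipZr //; congr (ip _ _).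
  by apply/funext => s; rewrite big_nil mul0r.
have hi : cnice (F i) by apply: h; rewrite mem_head.
have hr j : j \in r -> cnice (F j) by move=> jr; apply: h; rewrite in_cons jr orbT.
rewrite big_cons -IH // -ipZr // -ipDr //.
- by congr (ip _ _); apply/funext => s; rewrite big_cons.
- exact: cnice_scale.
- by apply: cnice_sum => j jr; apply: cnice_scale; exact: hr.
Qed.

Lemma ip_suml (I : eqType) (r : seq I) (c : I -> R[i]) (F : I -> circle R -> R[i]) f :
  cnice f -> (forall i, i \in r -> cnice (F i)) ->
  ip (fun s => \sum_(i <- r) c i * F i s) f = \sum_(i <- r) (c i)^* * ip (F i) f.
Proof.
move=> hf h; rewrite -ipC //; last first.
  by apply: cnice_sum => i ir; apply: cnice_scale; exact: h.
rewrite ip_sumr // rmorph_sum /= !big_seq; apply: eq_bigr => i ir.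
by rewrite cjM ipC //; exact: h.
Qed.

Lemma ip_norm f : ip f f = (rint (fun s => cabs (f s) ^+ 2))%:C.
Proof. by rewrite -cint_real /ip; under eq_fun do rewrite mulJC. Qed.

Lemma bessel (n : nat) (x : nat -> circle R -> R[i]) f :
  (forall i, cnice (x i)) -> cnice f ->
  (forall i j, ip (x i) (x j) = (i == j)%:R) ->
  \sum_(0 <= i < n) cabs (ip (x i) f) ^+ 2 <= rint (fun s => cabs (f s) ^+ 2).
Proof.
move=> hx hf ortho.
pose g s := \sum_(0 <= i < n) ip (x i) f * x i s.
have hg : cnice g by apply: cnice_sum => i _; exact: cnice_scale.
pose S := \sum_(0 <= i < n) cabs (ip (x i) f) ^+ 2.
have xg i : (i < n)%N -> ip (x i) g = ip (x i) f.
  move=> ilt; rewrite /g ip_sumr //.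
  rewrite (bigD1_seq i) ?mem_index_iota ?iota_uniq //= ortho eqxx mulr1 big1 ?addr0 // => j ji.
  by rewrite ortho eq_sym (negbTE ji) mulr0.
have gf : ip g f = S%:C.
  rewrite /g ip_suml // rmorph_sum /=; apply: eq_bigr => i _.
  by rewrite mulJC.
have gg : ip g g = S%:C.
  rewrite {1}/g ip_suml // rmorph_sum /= !big_nat; apply: eq_bigr => i /andP[_ ilt].
  by rewrite xg // mulJC.
have : 0 <= ip (fun s => f s - g s) (fun s => f s - g s).
  by rewrite ip_norm ler0c; apply: rint_ge0 => s; exact: sqr_ge0.
have hN : cnice (fun s => -1 * g s) by exact: cnice_scale.
rewrite (_ : (fun s => f s - g s) = (fun s => f s + -1 * g s)); last first.
  by apply/funext => s; rewrite mulN1r.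
have hfN := cnice_add hf hN.
rewrite ipDr // ipZr // !ipDl // !ipZl // gg gf -(ipC hg hf) gf ip_norm.
rewrite cjN cj1 cjR.
set I := rint _; rewrite -/S.
have -> : I%:C + -1 * S%:C + -1 * (S%:C + -1 * S%:C) = (I - S)%:C.
  by rewrite rmorphB /=; ring.
by rewrite ler0c subr_ge0.
Qed.

End CircleIntegral.

(** * Spaces spanned by Blaschke products *)

Section UnitDiskFactors.
Variables (R : realType) (alpha : nat -> R[i]) (r : R).
Hypotheses (r1 : r < 1) (alpha_r : forall n, cabs (alpha n) <= r).
Implicit Types (z l : R[i]) (s : circle R) (b : bool) (k n : nat).

Lemma r_ge0 : 0 <= r.
Proof. exact: le_trans (cabs_ge0 _) (alpha_r 0). Qed.

(* [pfac true] is varpi^* and [pfac false] is varpi: on the circle, conjugation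
   exchanges them up to the factor [z^-1]. *)
Definition pfac b k z : R[i] := if b then varpis alpha k z else varpi alpha k z.

Lemma unit_neq0 z : cabs z = 1 -> z != 0.
Proof. by move=> h; rewrite -cabs_gt0 h ltr01. Qed.

Lemma cj_unit z : cabs z = 1 -> z^* = z^-1.
Proof.
move=> h; apply: (mulIf (unit_neq0 h)); rewrite mulVf ?unit_neq0 //.
by rewrite mulJC h expr1n.
Qed.

Lemma cj_pfac b k z : cabs z = 1 -> (pfac b k z)^* = z^-1 * pfac (~~ b) k z.
Proof.
move=> h; have z0 := unit_neq0 h; rewrite /pfac /varpi /varpis; case: b => /=.
  by rewrite cjB cj_unit // mulrBr mulr1 mulrCA mulVf // mulr1.
by rewrite cjB cjM conjCK cj1 cj_unit // mulrBr mulVf // mulrC.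
Qed.

Lemma cabs_pfac_neg b k z : cabs z = 1 -> cabs (pfac (~~ b) k z) = cabs (pfac b k z).
Proof. by move=> h; rewrite -[RHS]cabsJ cj_pfac // cabsM cabsV h invr1 mul1r. Qed.

Lemma pfac_lower b k z : cabs z = 1 -> 1 - r <= cabs (pfac b k z).
Proof.
move=> h; have e : 1 - r <= cabs (varpis alpha k z).
  by apply: le_trans (cabs_sub _ _); rewrite h lerD2l lerN2.
by case: b => //; rewrite -(cabs_pfac_neg false).
Qed.

Lemma pfac_upper b k z : cabs z = 1 -> cabs (pfac b k z) <= 2.
Proof.
move=> h; have e : cabs (varpis alpha k z) <= 2.
  apply: le_trans (cabsD _ _) _; rewrite h cabsN.
  by have := alpha_r k; move: r1; lra.
by case: b => //; rewrite -(cabs_pfac_neg false).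
Qed.

Lemma pfac_neq0 b k z : cabs z = 1 -> pfac b k z != 0.
Proof.
by move=> h; rewrite -cabs_gt0; apply: lt_le_trans (pfac_lower b k h); rewrite subr_gt0.
Qed.

Lemma varpi_neq0 k z : cabs z <= 1 -> varpi alpha k z != 0.
Proof.
move=> h; rewrite -cabs_gt0; apply: lt_le_trans (cabs_sub _ _).
rewrite cabs1 cabsM cabsJ subr_gt0; apply: le_lt_trans r1.
rewrite -[r]mulr1; apply: ler_pM; rewrite ?cabs_ge0 //.
Qed.

Lemma alpha_lt1 k : cabs (alpha k) < 1.
Proof. exact: le_lt_trans (alpha_r k) r1. Qed.

Lemma zeta_neq0 k z : cabs z = 1 -> zeta alpha k z != 0.
Proof.
by move=> h; rewrite mulf_neq0 ?invr_eq0 // ?(pfac_neq0 true) // (pfac_neq0 false).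
Qed.

Lemma cabs_zeta k z : cabs z = 1 -> cabs (zeta alpha k z) = 1.
Proof.
move=> h; rewrite cabsM cabsV -[varpis _ _ _]/(pfac (~~ false) k z) cabs_pfac_neg //.
by rewrite divff // cabs_eq0 (pfac_neq0 false).
Qed.

Lemma lip_zeta k : lip (fun s => zeta alpha k (circle_val s)).
Proof.
apply: lip_mul.
  by apply: lip_add (lip_val R) (lip_cst _).
apply: (@lip_inv _ _ (1 - r)); last 2 first.
- by rewrite subr_gt0.
- by move=> s; apply: (pfac_lower false); exact: cabs_circle.
apply: lip_add (lip_cst _) _; under eq_fun do rewrite -mulNr.
exact: lip_scale (lip_val R).
Qed.

Lemma lip_invvarpi k : lip (fun s => (varpi alpha k (circle_val s))^-1).
Proof.
apply: (@lip_inv _ _ (1 - r)); last 2 first.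
- by rewrite subr_gt0.
- by move=> s; apply: (pfac_lower false); exact: cabs_circle.
apply: lip_add (lip_cst _) _; under eq_fun do rewrite -mulNr.
exact: lip_scale (lip_val R).
Qed.

Definition cbl n s : R[i] := blaschke alpha n (circle_val s).

Lemma cblS n s : cbl n.+1 s = cbl n s * zeta alpha n.+1 (circle_val s).
Proof. by rewrite /cbl /blaschke big_nat_recr. Qed.

Lemma cbl0 s : cbl 0 s = 1.
Proof. by rewrite /cbl /blaschke big_geq. Qed.

Lemma lip_cbl n : lip (cbl n).
Proof.
elim: n => [|n IH].
  by rewrite (_ : cbl 0 = fun=> 1) ?funeqE //; [exact: lip_cst | exact: cbl0].
rewrite (_ : cbl n.+1 = fun s => cbl n s * zeta alpha n.+1 (circle_val s)).
  by apply: lip_mul => //; exact: lip_zeta.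
by rewrite funeqE => s; rewrite cblS.
Qed.

Lemma cabs_cbl n s : cabs (cbl n s) = 1.
Proof.
elim: n => [|n IH]; first by rewrite cbl0 cabs1.
by rewrite cblS cabsM IH cabs_zeta ?mul1r // cabs_circle.
Qed.

(** On the circle, these are the polynomials of degree at most [n] divided by
    [varpi 1 ... varpi n]. *)
Definition inW n (f : circle R -> R[i]) : Prop :=
  exists c : nat -> R[i], forall s, f s = \sum_(0 <= k < n.+1) c k * cbl k s.

Lemma inW_ext n f g : f =1 g -> inW n f -> inW n g.
Proof. by move=> fg [c hc]; exists c => s; rewrite -fg. Qed.

Lemma inW_add n f g : inW n f -> inW n g -> inW n (fun s => f s + g s).
Proof.
move=> [c hc] [d hd]; exists (fun k => c k + d k) => s.
by rewrite hc hd -big_split; apply: eq_bigr => k _; rewrite mulrDl.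
Qed.

Lemma inW_scale n c f : inW n f -> inW n (fun s => c * f s).
Proof.
move=> [d hd]; exists (fun k => c * d k) => s.
by rewrite hd mulr_sumr; apply: eq_bigr => k _; rewrite mulrA.
Qed.

Lemma inW_cbl n k : (k <= n)%N -> inW n (cbl k).
Proof.
move=> kn; exists (fun j => (j == k)%:R) => s.
rewrite (bigD1_seq k) ?mem_index_iota ?iota_uniq //= eqxx mul1r big1 ?addr0 // => j jk.
by rewrite (negbTE jk) mul0r.
Qed.

Lemma inW_sum n (I : eqType) (l : seq I) (c : I -> R[i]) F :
  (forall i, i \in l -> inW n (F i)) -> inW n (fun s => \sum_(i <- l) c i * F i s).
Proof.
elim: l => [_|i l IH h].
  exists (fun=> 0) => s; rewrite big_nil big1 // => k _; exact: mul0r.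
apply: (@inW_ext _ (fun s => c i * F i s + \sum_(j <- l) c j * F j s)).
  by move=> s; rewrite big_cons.
apply: inW_add; first by apply: inW_scale; apply: h; rewrite mem_head.
by apply: IH => j jl; apply: h; rewrite in_cons jl orbT.
Qed.

Lemma inW_mono n m f : (n <= m)%N -> inW n f -> inW m f.
Proof.
move=> nm [c hc]; apply: (@inW_ext _ (fun s => \sum_(0 <= k < n.+1) c k * cbl k s)).
  by move=> s; rewrite hc.
apply: inW_sum => k; rewrite mem_index_iota ltnS => /andP[_ kn]; apply: inW_cbl.
exact: leq_trans kn nm.
Qed.

Lemma inW_lip n f : inW n f -> lip f.
Proof.
move=> [c hc]; rewrite (_ : f = fun s => \sum_(0 <= k < n.+1) c k * cbl k s) ?funeqE //.
by apply: lip_sum => k; apply: lip_scale; exact: lip_cbl.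
Qed.

(* The four functions below become quadratic polynomials after clearing the
   common denominator, hence are linearly dependent. *)
Lemma zeta_exchange k n :
  exists A B C : R[i], forall z, cabs z = 1 -> zeta alpha n z =
    A + B * zeta alpha k z + C * (zeta alpha n z * zeta alpha k z).
Proof.
set u := alpha k; set v := alpha n.
have d0 : 1 - v^* * u != 0 by apply: (varpi_neq0 n); exact: ltW (alpha_lt1 k).
exists ((u - v) / (1 - v^* * u)), ((1 - u^* * v) / (1 - v^* * u)),
  ((1 - u^* * v) / (1 - v^* * u) * v^* - u^* - (u - v) / (1 - v^* * u) * u^* * v^*) => y hy.
have := pfac_neq0 false k hy; have := pfac_neq0 false n hy.
rewrite /pfac /zeta /varpis /varpi -/u -/v => h1 h2.
by field; rewrite h1 h2 d0.
Qed.

(** Induction on [n - k]: [zeta_exchange] reduces [zeta n.+1 * cbl k] to [cbl k], [cbl k.+1] and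
    [zeta n.+1 * cbl k.+1]; for [k = n] the product is [cbl n.+1] itself. *)
Lemma inW_zeta n f : inW n f ->
  inW n.+1 (fun s => zeta alpha n.+1 (circle_val s) * f s).
Proof.
move=> [c hc].
apply: (@inW_ext _ (fun s => \sum_(0 <= k < n.+1) c k *
    (zeta alpha n.+1 (circle_val s) * cbl k s))).
  by move=> s; rewrite hc mulr_sumr; apply: eq_bigr => k _; rewrite mulrCA.
apply: inW_sum => k; rewrite mem_index_iota ltnS => /andP[_].
move: {2}(n - k)%N (erefl (n - k)%N) => j; elim: j k => [|j IH] k nk kn.
  have -> : k = n by apply/eqP; rewrite eqn_leq kn -subn_eq0 nk eqxx.
  apply: (@inW_ext _ (cbl n.+1)); last exact: inW_cbl.
  by move=> s; rewrite cblS mulrC.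
have kn' : (k < n)%N by rewrite -subn_gt0 nk.
have [A [B [C h]]] := zeta_exchange k.+1 n.+1.
apply: (@inW_ext _ (fun s => A * cbl k s + (B * cbl k.+1 s +
    C * (zeta alpha n.+1 (circle_val s) * cbl k.+1 s)))).
  by move=> s; rewrite [in RHS]h ?cabs_circle // cblS; ring.
apply: inW_add; first by apply/inW_scale/inW_cbl; exact: leqW.
apply: inW_add; first by apply/inW_scale/inW_cbl; exact: leqW.
by apply/inW_scale/IH => //; rewrite subnS nk.
Qed.

(** On the circle [cbl k] has its conjugate as inverse, so for a basis function [cbl k] the result
    is the product of [zeta k.+1, ..., zeta n]. *)
Lemma inW_conj n f : inW n f -> inW n (fun s => cbl n s * (f s)^*).
Proof.
move=> [c hc].
apply: (@inW_ext _ (fun s => \sum_(0 <= k < n.+1) (c k)^* * (cbl n s * (cbl k s)^*))).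
  move=> s; rewrite hc rmorph_sum mulr_sumr; apply: eq_bigr => k _.
  by rewrite /= cjM mulrCA.
apply: inW_sum => k; rewrite mem_index_iota ltnS => /andP[_ kn].
elim: n {hc} kn => [|n IH].
  rewrite leqn0 => /eqP ->; apply: (@inW_ext _ (cbl 0)); last exact: inW_cbl.
  by move=> s; rewrite cbl0 cj1 mulr1.
rewrite leq_eqVlt => /orP[/eqP ->|kn].
  apply: (@inW_ext _ (cbl 0)); last exact: inW_cbl.
  by move=> s; rewrite cbl0 mulrC mulJC cabs_cbl expr1n.
apply: (@inW_ext _ _ _ _ (inW_zeta (IH kn))) => s.
by rewrite cblS; ring.
Qed.

Lemma eta_sq n : eta alpha n ^+ 2 = (1 - cabs (alpha n) ^+ 2)%:C.
Proof. by rewrite /eta sqrtCK cabsE rmorphB rmorph1 rmorphXn. Qed.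

Lemma eta_ge0 n : 0 <= eta alpha n.
Proof.
rewrite /eta sqrtC_ge0 cabsE -rmorphXn -[1](rmorph1 (real_complex R)) -rmorphB.
have := alpha_lt1 n; have := cabs_ge0 (alpha n).
by move=> h1 h2; rewrite ler0c subr_ge0 expr_le1 // ltW.
Qed.

Lemma eta_real n : eta alpha n = (cabs (eta alpha n))%:C.
Proof. by rewrite -cabsE ger0_norm // eta_ge0. Qed.

Lemma cj_eta n : (eta alpha n)^* = eta alpha n.
Proof. by rewrite eta_real cjR. Qed.

Lemma cabs_eta_sq n : cabs (eta alpha n) ^+ 2 = 1 - cabs (alpha n) ^+ 2.
Proof. by apply: complexI; rewrite rmorphXn /= -eta_real eta_sq. Qed.

Lemma eta_sq_lower n : 1 - r <= cabs (eta alpha n) ^+ 2.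
Proof.
rewrite cabs_eta_sq lerD2l lerN2; apply: le_trans (alpha_r n).
by rewrite expr2 ler_piMl ?cabs_ge0 // ltW // alpha_lt1.
Qed.

Lemma eta_neq0 n : eta alpha n != 0.
Proof.
apply/eqP => h; have := eta_sq_lower n; rewrite h cabs0 expr0n /=.
by move: r1; lra.
Qed.

Lemma eta_sqE n : eta alpha n ^+ 2 = varpi alpha n (alpha n).
Proof. by rewrite eta_sq /varpi mulJC rmorphB. Qed.

Lemma pfac_wronskian b m z l :
  pfac (~~ b) m l * pfac b m z - pfac b m l * pfac (~~ b) m z
  = (-1) ^+ b * (eta alpha m ^+ 2 * (l - z)).
Proof.
rewrite eta_sqE /pfac /varpis /varpi; case: b => /=; rewrite ?expr0 ?expr1; ring.
Qed.

Definition pslope b k : R[i] := if b then 1 else - (alpha k)^*.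

Lemma pfac_affine b k z l : pfac b k l = pfac b k z + pslope b k * (l - z).
Proof. rewrite /pfac /pslope /varpis /varpi; case: b; ring. Qed.

Lemma cabs_pslope b k : cabs (pslope b k) <= 1.
Proof.
rewrite /pslope; case: b; rewrite ?cabs1 // cabsN cabsJ; exact: ltW (alpha_lt1 k).
Qed.

End UnitDiskFactors.
Arguments pfac : simpl never.

(** * Orthonormal bases of the rational spaces *)

Section Orthonormal.
Variables (R : realType) (mu : probability (borel_circle R) R).
Notation ip := (ip mu).

(** Orthonormality reads [Cj *m Gm *m Cm^T = 1]; the matrices being square, [Cj *m Gm] is a
    two-sided inverse of [Cm^T]. *)
Lemma span_inverse M (b f : nat -> circle R -> R[i]) (C : nat -> nat -> R[i]) :
  (forall k, cnice (b k)) ->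
  (forall i s, (i <= M)%N -> f i s = \sum_(0 <= k < M.+1) C i k * b k s) ->
  (forall i j, (i <= M)%N -> (j <= M)%N -> ip (f i) (f j) = (i == j)%:R) ->
  exists D : nat -> nat -> R[i], forall k s, (k <= M)%N ->
    b k s = \sum_(0 <= i < M.+1) D k i * f i s.
Proof.
move=> hb hf ortho.
pose Cm := \matrix_(i < M.+1, k < M.+1) C i k.
pose Cj := \matrix_(i < M.+1, k < M.+1) (C i k)^*.
pose Gm := \matrix_(k < M.+1, l < M.+1) ip (b k) (b l).
have fE i : (i <= M)%N -> f i = fun s => \sum_(0 <= k < M.+1) C i k * b k s.
  by move=> iM; apply/funext => s; exact: hf.
have lo (i : 'I_M.+1) : (i <= M)%N by rewrite -ltnS.
have E : (Cj *m Gm) *m Cm^T = 1%:M.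
  apply/matrixP => i j; rewrite !mxE.
  have -> : (i == j)%:R = ip (f i) (f j) by rewrite ortho ?lo.
  rewrite (fE i (lo i)) (fE j (lo j)).
  rewrite ip_sumr //; last first.
    by apply: cnice_sum => k _; exact: cnice_scale.
  rewrite big_mkord; apply: eq_bigr => l _.
  rewrite ip_suml // big_mkord !mxE mulrC; congr (_ * _).
  by apply: eq_bigr => k _; rewrite !mxE.
have {}E := mulmx1C E.
pose D k i := (Cj *m Gm)^T (inord k) (inord i).
exists D => k s kM.
transitivity (\sum_(i < M.+1) \sum_(l < M.+1) (D k i * C i l) * b l s).
  rewrite exchange_big /=.
  have -> : \sum_(j < M.+1) \sum_(i < M.+1) D k i * C i j * b j s =
      \sum_(j < M.+1) (inord k == j :> 'I_M.+1)%:R * b j s.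
    apply: eq_bigr => j _; rewrite -mulr_suml; congr (_ * _).
    have /matrixP/(_ j (inord k)) := E; rewrite !mxE eq_sym => <-.
    apply: eq_bigr => i _; rewrite /D inord_val [in LHS]mxE mulrC; congr (_ * _).
    by rewrite !mxE.
  rewrite (bigD1 (inord k)) //= eqxx mul1r big1 ?addr0 ?inordK // => j.
  by rewrite eq_sym => /negbTE ->; rewrite mul0r.
rewrite big_mkord; apply: eq_bigr => i _.
rewrite hf ?lo // big_mkord mulr_sumr; apply: eq_bigr => l _.
by rewrite mulrA.
Qed.

End Orthonormal.

Section RationalBasis.
Variables (R : realType) (mu : probability (borel_circle R) R).
Variables (alpha : nat -> R[i]) (r : R).
Hypotheses (r1 : r < 1) (alpha_r : forall n, cabs (alpha n) <= r).
Notation ip := (ip mu).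
Notation inW := (inW alpha).
Notation cbl := (cbl alpha).

Lemma inW_nice n f : inW n f -> cnice f.
Proof. by move/(inW_lip r1 alpha_r)/lip_nice. Qed.

(** A space spanned by [M.+1] functions has any [M.+1] orthonormal elements as a basis. *)
Lemma inW_expand M (e : nat -> circle R -> R[i]) :
  (forall i, (i <= M)%N -> inW M (e i)) ->
  (forall i j, (i <= M)%N -> (j <= M)%N -> ip (e i) (e j) = (i == j)%:R) ->
  forall f, inW M f -> forall s,
    f s = \sum_(0 <= i < M.+1) ip (e i) f * e i s.
Proof.
move=> he ortho f [c hc].
have nb k : cnice (cbl k) by apply: lip_nice; exact: (lip_cbl r1 alpha_r).
have ne i : (i <= M)%N -> cnice (e i) by move/he/inW_nice.
have /boolp.choice[C hC] : forall i, exists C : nat -> R[i], (i <= M)%N ->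
    forall s, e i s = \sum_(0 <= k < M.+1) C k * cbl k s.
  move=> i; have [/he[C hC]|_] := boolP (i <= M)%N; last by exists (fun=> 0).
  by exists C.
have [D hD] := span_inverse nb (fun i s iM => hC i iM s) ortho.
pose d i := \sum_(0 <= k < M.+1) c k * D k i.
have fE s : f s = \sum_(0 <= i < M.+1) d i * e i s.
  rewrite hc (@eq_big_nat _ _ _ _ _ _ (fun k => \sum_(0 <= i < M.+1) c k * D k i * e i s)).
    by rewrite exchange_big; apply: eq_bigr => i _; rewrite mulr_suml.
  move=> k /andP[_ kM]; rewrite (hD k s kM) mulr_sumr.
  by apply: eq_bigr => i _; rewrite mulrA.
move=> s; rewrite {1}fE; apply: eq_big_nat => i /andP[_ iM]; congr (_ * _).
have -> : f = fun s => \sum_(0 <= i < M.+1) d i * e i s by apply/funext.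
rewrite ip_sumr; [|exact: ne|]; last first.
  by move=> j; rewrite mem_index_iota => /andP[_ jM]; exact: ne.
rewrite (bigD1_seq i) ?mem_index_iota ?iota_uniq //= ortho // eqxx mulr1 big1_seq ?addr0 //.
by move=> j /andP[ji]; rewrite mem_index_iota => /andP[_ jM]; rewrite ortho // eq_sym (negbTE ji) mulr0.
Qed.

Variables (a : nat -> R[i]) (phi : nat -> R[i] -> R[i]).
Hypothesis (orf : orf_with alpha a mu phi).

Definition orp n (s : circle R) : R[i] := phi n (circle_val s).
Definition orq n (s : circle R) : R[i] := cbl n s * (orp n s)^*.

Lemma inW_orp n : inW n (orp n).
Proof. by have [c hc] := orf_span orf n; exists c => s; exact: hc. Qed.

Lemma inW_orq n : inW n (orq n).
Proof. by apply: (inW_conj r1 alpha_r); exact: inW_orp. Qed.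

Lemma nice_orp n : cnice (orp n).
Proof. exact: inW_nice (inW_orp n). Qed.

Lemma orp_orth m n : ip (orp m) (orp n) = (m == n)%:R.
Proof. exact: orf_orthonormal orf m n. Qed.

Lemma orp0 s : orp 0 s = 1.
Proof. exact: orf_init orf _. Qed.

Lemma orp_inW n f : inW n f -> ip f (orp n.+1) = 0.
Proof.
move=> hf.
have E := inW_expand (fun i (h : (i <= n)%N) => inW_mono h (inW_orp i))
  (fun i j _ _ => orp_orth i j) hf.
have -> : f = fun s => \sum_(0 <= i < n.+1) ip (orp i) f * orp i s by apply/funext.
rewrite ip_suml; [|exact: nice_orp|by move=> *; exact: nice_orp].
rewrite big1_seq // => i; rewrite mem_index_iota => /andP[_ /andP[_ ilt]].
by rewrite orp_orth (ltn_eqF ilt) mulr0.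
Qed.

Definition zt n (s : circle R) := zeta alpha n (circle_val s).

Definition bodd n (s : circle R) : R[i] := \prod_(1 <= k < n.+1 | odd k) zt k s.

Lemma bodd0 s : bodd 0 s = 1.
Proof. by rewrite /bodd big_geq. Qed.

Lemma boddS n s : bodd n.+1 s = bodd n s * (if odd n.+1 then zt n.+1 s else 1).
Proof. by rewrite /bodd big_mkcond big_nat_recr //= -big_mkcond. Qed.

Lemma zt_neq0 n s : zt n s != 0.
Proof. exact: (zeta_neq0 r1 alpha_r) (cabs_circle s). Qed.

Lemma bodd_neq0 n s : bodd n s != 0.
Proof.
elim: n => [|n IH]; first by rewrite bodd0 oner_eq0.
by rewrite boddS mulf_neq0 //; case: ifP => _; rewrite ?oner_eq0 ?zt_neq0.
Qed.

Lemma cabs_bodd n s : cabs (bodd n s) = 1.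
Proof.
rewrite /bodd cabs_prod big1 // => k _; exact: (cabs_zeta r1 alpha_r) (cabs_circle s).
Qed.

Lemma cj_bodd n s : (bodd n s)^* = (bodd n s)^-1.
Proof. exact: cj_unit (cabs_bodd n s). Qed.

(* The poles at the odd points are reflected into the disk, as the negative
   powers of z in the CMV basis of the polynomial case. *)
Definition cmv n s : R[i] := (if odd n then orq n s else orp n s) / bodd n s.

(** If [n.+1] is odd, [bodd] gains the factor [zeta n.+1], which [inW_zeta] absorbs; otherwise only
    the space grows. *)
Lemma inW_bodd_cmv m n : (m <= n)%N -> inW n (fun s => bodd n s * cmv m s).
Proof.
elim: n => [|n IH].
  rewrite leqn0 => /eqP ->; apply: (inW_ext _ (inW_orp 0)) => s.
  by rewrite /cmv /= bodd0 divr1 mul1r.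
rewrite leq_eqVlt => /orP[/eqP ->|/IH h].
  have e (f : circle R -> R[i]) : f =1 (fun s => bodd n.+1 s * (f s / bodd n.+1 s)).
    by move=> s; rewrite mulrC divfK ?bodd_neq0.
  rewrite /cmv; case: (odd n.+1).
    exact: (inW_ext (e _) (inW_orq n.+1)).
  exact: (inW_ext (e _) (inW_orp n.+1)).
case: (boolP (odd n.+1)) => on.
  apply: (inW_ext _ (inW_zeta r1 alpha_r h)) => s.
  by rewrite boddS on /zt; ring.
apply: (inW_ext _ (inW_mono (leqnSn n) h)) => s.
by rewrite boddS (negbTE on) mulr1.
Qed.

Lemma lip_bodd_inv n : lip (fun s => (bodd n s)^-1).
Proof.
have -> : (fun s => (bodd n s)^-1) = (fun s => (bodd n s)^*).
  by apply/funext => s; rewrite cj_bodd.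
apply: lip_conj.
have -> : bodd n = fun s => \prod_(1 <= k < n.+1) (if odd k then zt k s else 1).
  by apply/funext => s; rewrite /bodd big_mkcond.
apply: lip_prod => k; case: (odd k); last exact: lip_cst.
exact: (lip_zeta r1 alpha_r).
Qed.

Lemma lip_cmv n : lip (cmv n).
Proof.
apply: lip_mul (lip_bodd_inv n).
by case: (odd n); apply: (inW_lip r1 alpha_r); [exact: inW_orq|exact: inW_orp].
Qed.

Lemma nice_cmv n : cnice (cmv n).
Proof. exact: lip_nice (lip_cmv n). Qed.

Lemma cabs_cmv n s : cabs (cmv n s) = cabs (orp n s).
Proof.
rewrite /cmv cabsM cabsV cabs_bodd invr1 mulr1; case: (odd n) => //.
by rewrite /orq cabsM cabsJ (cabs_cbl r1 alpha_r) mul1r.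
Qed.

(** The unimodular [bodd] moves to the other argument and leaves an element of [inW n] against
    [orp n.+1]. For odd [n.+1] that element is first reflected by [inW_conj]. *)
Lemma cmv_orth_lt m n : (m < n)%N -> ip (cmv m) (cmv n) = 0.
Proof.
case: n => // n; rewrite ltnS => mn; have hW := inW_bodd_cmv mn.
case: (boolP (odd n.+1)) => on; last first.
  transitivity (ip (fun s => bodd n s * cmv m s) (orp n.+1)); last exact: orp_inW.
  rewrite /ip; congr (cint _ _); apply/funext => s.
  rewrite [cmv n.+1 s]/cmv (negbTE on) boddS (negbTE on) mulr1 cjM cj_bodd.
  by field; rewrite bodd_neq0.
transitivity (ip (orp n.+1) (fun s => cbl n s * (bodd n s * cmv m s)^*)).
  rewrite /ip; congr (cint _ _); apply/funext => s.
  rewrite [cmv n.+1 s]/cmv on boddS on /orq cblS -/(zt n.+1 s) cjM cj_bodd.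
  by field; rewrite bodd_neq0 zt_neq0.
rewrite -ipC; last 2 first.
- by apply: inW_nice; apply: (inW_conj r1 alpha_r) hW.
- exact: nice_orp.
by rewrite orp_inW ?cj0 //; apply: (inW_conj r1 alpha_r) hW.
Qed.

Lemma cmv_orth m n : ip (cmv m) (cmv n) = (m == n)%:R.
Proof.
have [mn|mn|->] := ltngtP m n.
- exact: cmv_orth_lt.
- by rewrite -ipC ?cmv_orth_lt ?cj0 //; exact: nice_cmv.
- transitivity (ip (orp n) (orp n)); last by rewrite orp_orth eqxx.
  rewrite !ip_norm; by congr (rint _ _)%:C; apply/funext => s; rewrite cabs_cmv.
Qed.

Lemma cmv_expand M f : inW M (fun s => bodd M s * f s) ->
  forall s, f s = \sum_(0 <= i < M.+1) ip (cmv i) f * cmv i s.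
Proof.
move=> hf s.
have key (g h : circle R -> R[i]) :
    ip (fun s => bodd M s * g s) (fun s => bodd M s * h s) = ip g h.
  rewrite /ip; congr (cint _ _); apply/funext => t.
  by rewrite cjM cj_bodd; field; rewrite bodd_neq0.
have := inW_expand (e := fun i s => bodd M s * cmv i s)
  (fun i (h : (i <= M)%N) => inW_bodd_cmv h) _ hf s.
move=> /(_ (fun i j _ _ => etrans (key _ _) (cmv_orth i j))) E.
apply: (mulfI (bodd_neq0 M s)); rewrite E mulr_sumr; apply: eq_bigr => i _.
by rewrite key mulrCA.
Qed.

End RationalBasis.

(** * The orthonormal basis and its recurrence *)

Section Recurrences.
Variables (R : realType) (mu : probability (borel_circle R) R).
Variables (alpha : nat -> R[i]) (r : R).
Hypotheses (r1 : r < 1) (alpha_r : forall n, cabs (alpha n) <= r).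
Variables (a : nat -> R[i]) (phi : nat -> R[i] -> R[i]).
Hypothesis (orf : orf_with alpha a mu phi).
Notation ip := (ip mu).
Notation eta := (eta alpha).
Notation rho := (rho a).
Notation pfac := (pfac alpha).
Notation orp := (orp phi).
Notation orq := (orq alpha phi).
Notation bodd := (bodd alpha).
Notation cmv := (cmv alpha phi).
Notation z_ := (@circle_val R).

Lemma a_lt1 n : (0 < n)%N -> cabs (a n) < 1.
Proof. by move=> n0; rewrite -ltcR -cabsE; exact: orf_param orf n n0. Qed.

Lemma rho_sq n : rho n ^+ 2 = (1 - cabs (a n) ^+ 2)%:C.
Proof. by rewrite /Defs.rho sqrtCK cabsE rmorphB rmorph1 rmorphXn. Qed.

Lemma rho_ge0 n : (0 < n)%N -> 0 <= rho n.
Proof.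
move=> n0; rewrite /Defs.rho sqrtC_ge0 cabsE -rmorphXn -[1](rmorph1 (real_complex R)) -rmorphB.
have := a_lt1 n0; have := cabs_ge0 (a n).
by move=> h1 h2; rewrite ler0c subr_ge0 expr_le1 // ltW.
Qed.

Lemma rho_real n : (0 < n)%N -> rho n = (cabs (rho n))%:C.
Proof. by move=> n0; rewrite -cabsE ger0_norm // rho_ge0. Qed.

Lemma cabs_rho_sq n : (0 < n)%N -> cabs (rho n) ^+ 2 = 1 - cabs (a n) ^+ 2.
Proof. by move=> n0; apply: complexI; rewrite rmorphXn /= -rho_real // rho_sq. Qed.

Lemma rho_neq0 n : (0 < n)%N -> rho n != 0.
Proof.
move=> n0; rewrite -sqrf_eq0 rho_sq -(rmorph0 (real_complex R)) (inj_eq (@complexI R)).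
by rewrite subr_eq0 eq_sym lt_eqF // expr_lt1 ?cabs_ge0 ?a_lt1.
Qed.

(* The conventions a_0 = 1 and rho_0 = 0 make the relations below valid at
   n = 0, where [n.-1] is again 0. *)
Definition rr n : R[i] := if n is 0 then 0 else rho n.
Definition aa n : R[i] := if n is 0 then 1 else if odd n then (a n)^* else a n.

Lemma cj_rr n : (rr n)^* = rr n.
Proof. by case: n => [|n]; rewrite /rr ?cj0 // rho_real // cjR. Qed.

Lemma aa_rr n : (aa n)^* * aa n + rr n ^+ 2 = 1.
Proof.
case: n => [|n]; first by rewrite /aa /rr cj1 mulr1 expr0n addr0.
rewrite /rr rho_sq /aa mulJC -rmorphD /=.
by case: (odd _); rewrite ?cabsJ addrCA subrr addr0.
Qed.

Lemma cabs_aa n : cabs (aa n) <= 1.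
Proof.
case: n => [|n]; first by rewrite cabs1.
by rewrite /aa; case: (odd _); rewrite ?cabsJ ltW // a_lt1.
Qed.

Lemma cabs_rr n : cabs (rr n) <= 1.
Proof.
case: n => [|n]; first by rewrite cabs0.
rewrite /rr -(@expr_le1 _ 2) ?cabs_ge0 // cabs_rho_sq // gerDl oppr_le0 sqr_ge0 //.
Qed.

Lemma orf_eE n : (0 < n)%N -> orf_e alpha a n = eta n / (eta n.-1 * rho n).
Proof.
move=> n0; rewrite /orf_e -!eta_sqE // sqrtCM; last 2 first.
- by rewrite nnegrE mulr_ge0 ?invr_ge0 ?exprn_ge0 //; exact: (eta_ge0 r1 alpha_r).
- by rewrite nnegrE mul1r invr_ge0 (_ : 1 - _ = rho n ^+ 2) ?exprn_ge0 ?rho_ge0 // rho_sq cabsE rmorphB rmorphXn.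
rewrite -expr_div_n sqrCK; last first.
  by rewrite mulr_ge0 ?invr_ge0 //; exact: (eta_ge0 r1 alpha_r).
rewrite (_ : 1 - _ = rho n ^+ 2) ?mul1r -?exprVn ?sqrCK ?invr_ge0 ?rho_ge0 //.
  by rewrite invfM mulrA.
by rewrite rho_sq cabsE rmorphB rmorphXn.
Qed.

Lemma good_circle n s : good alpha n (z_ s).
Proof.
move=> k _; have h := cabs_circle s.
by split; [exact: (pfac_neq0 r1 alpha_r false) | exact: (pfac_neq0 r1 alpha_r true)].
Qed.

Lemma upper_star_circle n s : upper_star alpha n (phi n) (z_ s) = orq n s.
Proof.
rewrite /upper_star /lower_star /orq /orp; congr (_ * (phi n _)^*).
by rewrite cj_unit ?cabs_circle // invrK mul1r.
Qed.

Lemma orf_recurrence n s : (0 < n)%N ->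
  rho n * (pfac false n (z_ s) * orp n s / eta n) =
  pfac true n.-1 (z_ s) * orp n.-1 s / eta n.-1 +
  a n * (pfac false n.-1 (z_ s) * orq n.-1 s / eta n.-1).
Proof.
move=> n0; have := orf_rec orf n0 (@good_circle n s).
rewrite upper_star_circle orf_eE // -/(orp n s) -/(orp n.-1 s) => ->.
have := pfac_neq0 r1 alpha_r false n (cabs_circle s).
have := pfac_neq0 r1 alpha_r false n.-1 (cabs_circle s).
have := eta_neq0 r1 alpha_r n; have := eta_neq0 r1 alpha_r n.-1; have := rho_neq0 n0.
rewrite /pfac /zeta => h1 h2 h3 h4 h5.
by field; rewrite h1 h2 h3 h4 h5.
Qed.

Lemma orf_recurrence_star n s : (0 < n)%N ->
  rho n * (pfac false n (z_ s) * orq n s / eta n) =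
  (a n)^* * (pfac true n.-1 (z_ s) * orp n.-1 s / eta n.-1) +
  pfac false n.-1 (z_ s) * orq n.-1 s / eta n.-1.
Proof.
move=> n0; have := orf_rec_star orf n0 (@good_circle n s).
rewrite !upper_star_circle orf_eE // -/(orp n.-1 s) => ->.
have := pfac_neq0 r1 alpha_r false n (cabs_circle s).
have := pfac_neq0 r1 alpha_r false n.-1 (cabs_circle s).
have := eta_neq0 r1 alpha_r n; have := eta_neq0 r1 alpha_r n.-1; have := rho_neq0 n0.
rewrite /pfac /zeta => h1 h2 h3 h4 h5.
by field; rewrite h1 h2 h3 h4 h5.
Qed.

(** Division by [eta] absorbs the ratio [eta n / eta n.-1] in [orf_e], so that one step of the
    recurrence becomes a unitary 2 by 2 matrix. *)
Definition cmvt n s : R[i] := cmv n s / eta n.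

(** The opposite choice between [orp] and [orq] at each index, with a factor [pfac] built in; for
    alpha = 0 this is the alternate CMV basis. *)
Definition dualt n s : R[i] :=
  pfac (odd n) n (z_ s) * (if odd n then orp n s else orq n s) / bodd n s / eta n.

(** Passage from the transfer matrix, which takes level [n.-1] to level [n], to the scattering
    matrix, which is unitary and mixes the levels. *)
Let rec_solve (A rh U V U' V' : R[i]) : rh != 0 -> A^* * A + rh ^+ 2 = 1 ->
  rh * U = U' + A * V' -> rh * V = A^* * U' + V' ->
  [/\ U = A * V + rh * U', V' = rh * V - A^* * U',
      V = A^* * U + rh * V' & U' = rh * U - A * V'].
Proof.
move=> rh0 e h1 h2.
have e2 : 1 - A^* * A = rh * rh by rewrite -expr2 -e addrC addKr.
split; last 1 first.
- by rewrite h1; ring.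
- apply: (mulfI rh0); rewrite h1 mulrDr mulrCA h2.
  by rewrite mulrA -e2; ring.
- by rewrite h2; ring.
- apply: (mulfI rh0); rewrite h2 mulrDr mulrCA h1.
  by rewrite [in RHS]mulrA -e2; ring.
Qed.

(** The parity of [n] selects two of the four identities of [rec_solve]; the conjugation in [aa]
    gives both cases the same form. *)
Lemma cmv_pair n s : (0 < n)%N ->
  pfac (odd n) n (z_ s) * cmvt n s = aa n * dualt n s + rr n * dualt n.-1 s /\
  pfac (odd n) n.-1 (z_ s) * cmvt n.-1 s
    = rr n * dualt n s - (aa n)^* * dualt n.-1 s.
Proof.
case: n => // n _.
have [e1 e2] := (orf_recurrence s (ltn0Sn n), orf_recurrence_star s (ltn0Sn n)).
have e3 : (a n.+1)^* * a n.+1 + rho n.+1 ^+ 2 = 1.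
  by rewrite rho_sq mulJC -rmorphD /= addrCA subrr addr0.
have [h1 h2 h3 h4] := rec_solve (rho_neq0 (ltn0Sn n)) e3 e1 e2.
have b0 := bodd_neq0 r1 alpha_r n s.
have f0 := pfac_neq0 r1 alpha_r false n.+1 (cabs_circle s).
have f1 := pfac_neq0 r1 alpha_r true n.+1 (cabs_circle s).
rewrite /cmvt /dualt /cmv /rr /aa [odd n.+1]/= [n.+1.-1]/= boddS.
case: (boolP (odd n)) => on /=; rewrite on /=.
  move: h1 h2; rewrite [n.+1.-1]/= => h1 h2; split.
    transitivity ((pfac false n.+1 (z_ s) * orp n.+1 s / eta n.+1) / bodd n s).
      by rewrite mulr1; ring.
    by rewrite h1 mulr1; ring.
  transitivity ((pfac false n (z_ s) * orq n s / eta n) / bodd n s); first by ring.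
  by rewrite h2 mulr1; ring.
move: h3 h4; rewrite [n.+1.-1]/= conjCK => h3 h4.
have zE : zt alpha n.+1 s = pfac true n.+1 (z_ s) / pfac false n.+1 (z_ s) by [].
have m1 X : pfac true n.+1 (z_ s) * (X / (bodd n s * zt alpha n.+1 s) / eta n.+1)
    = (pfac false n.+1 (z_ s) * X / eta n.+1) / bodd n s.
  by rewrite zE; field; rewrite b0 f0 f1 (eta_neq0 r1 alpha_r).
have m2 X : pfac true n.+1 (z_ s) * X / (bodd n s * zt alpha n.+1 s) / eta n.+1
    = (pfac false n.+1 (z_ s) * X / eta n.+1) / bodd n s.
  by rewrite -m1 !mulrA.
split; first by rewrite m1 m2 h3; ring.
transitivity ((pfac true n (z_ s) * orp n s / eta n) / bodd n s); first by ring.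
by rewrite h4 m2; ring.
Qed.

Lemma cmvt0 s : pfac false 0 (z_ s) * cmvt 0 s = dualt 0 s.
Proof.
by rewrite /cmvt /dualt /cmv /= /orq cbl0 (orp0 orf) cj1 !mulr1 !mulrA mulr1.
Qed.

Lemma cmv_pair1 n s :
  pfac (odd n) n (z_ s) * cmvt n s = aa n * dualt n s + rr n * dualt n.-1 s.
Proof.
case: n => [|n]; last by have [] := cmv_pair s (ltn0Sn n).
by rewrite cmvt0 /aa /rr mul1r mul0r addr0.
Qed.

(** Inverts the unitary pair at [n], while [dualt_cmv_next] inverts the pair at [n.+1]: the same
    function is written with the indices [n.-1, n] and with [n, n.+1]. *)
Lemma dualt_cmv n s : dualt n s =
  (aa n)^* * (pfac (odd n) n (z_ s) * cmvt n s) +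
  rr n * (pfac (odd n) n.-1 (z_ s) * cmvt n.-1 s).
Proof.
case: n => [|n]; first by rewrite cmvt0 /aa /rr cj1 mul1r mul0r addr0.
have [-> ->] := cmv_pair s (ltn0Sn n).
rewrite -{1}[dualt _ s]mul1r -(aa_rr n.+1); ring.
Qed.

Lemma dualt_cmv_next n s : dualt n s =
  rr n.+1 * (pfac (~~ odd n) n.+1 (z_ s) * cmvt n.+1 s) -
  aa n.+1 * (pfac (~~ odd n) n (z_ s) * cmvt n s).
Proof.
have := cmv_pair s (ltn0Sn n); rewrite [odd n.+1]/= [n.+1.-1]/= => -[-> ->].
rewrite -{1}[dualt _ s]mul1r -(aa_rr n.+1); ring.
Qed.

(** For [n > 0] and [l] on the circle this is [kfun] or, at even [n], its conjugate times [l]. *)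
Definition kfac n l : R[i] :=
  (aa n)^* * pfac (odd n) n l + aa n.+1 * pfac (~~ odd n) n l.

(* Up to conjugation and scaling, the n-th column of the matrix of multiplication by
   [l - z] from [cmvt] to [dualt]. *)
Definition hrow l n s : R[i] :=
  kfac n l * cmvt n s + rr n * pfac (odd n) n.-1 l * cmvt n.-1 s -
  rr n.+1 * pfac (~~ odd n) n.+1 l * cmvt n.+1 s.

(** The slope of [hrow l n s] as an affine function of [l]. *)
Definition qrow n s : R[i] :=
  ((aa n)^* * pslope alpha (odd n) n + aa n.+1 * pslope alpha (~~ odd n) n) * cmvt n s
  + rr n * pslope alpha (odd n) n.-1 * cmvt n.-1 s -
  rr n.+1 * pslope alpha (~~ odd n) n.+1 * cmvt n.+1 s.

(* [hrow l n s] is affine in [l] and vanishes at [l = circle_val s], by the two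
   expressions of [dualt n]. *)
Lemma hrow_qrow l n s : hrow l n s = (l - z_ s) * qrow n s.
Proof.
have h : hrow (z_ s) n s = 0.
  have := dualt_cmv n s; rewrite dualt_cmv_next => /eqP; rewrite -subr_eq0 => /eqP e.
  by rewrite -[RHS](oppr0) -[in RHS]e /hrow /kfac; ring.
rewrite -[LHS]subr0 -{}h /hrow /qrow /kfac.
rewrite !(pfac_affine _ _ _ (z_ s) l); ring.
Qed.

(** [pfac_wronskian] writes [l - z] through the two factors at [m], and each factor times [cmvt m]
    is given by the pair at [m] or at [m.+1]. *)
Lemma cmvt_expr l m s : eta m ^+ 2 * ((l - z_ s) * cmvt m s) =
  (-1) ^+ odd m * (
    (aa m * pfac (~~ odd m) m l + (aa m.+1)^* * pfac (odd m) m l) * dualt m s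
    + rr m * pfac (~~ odd m) m l * dualt m.-1 s
    - rr m.+1 * pfac (odd m) m l * dualt m.+1 s).
Proof.
have e1 := cmv_pair1 m s; have := cmv_pair s (ltn0Sn m).
rewrite [odd m.+1]/= [m.+1.-1]/= => -[_ e2].
have w := pfac_wronskian alpha (odd m) m (z_ s) l.
have sg : (-1) ^+ odd m * (-1) ^+ odd m = 1 :> R[i] by rewrite -expr2 sqrr_sign.
transitivity ((-1) ^+ odd m * (((-1) ^+ odd m * (eta m ^+ 2 * (l - z_ s))) * cmvt m s)).
  by rewrite !mulrA sg mul1r.
rewrite -w mulrBl -!mulrA e1 e2; ring.
Qed.

End Recurrences.

(** * Gram entries and the three sequences of the theorem *)

Section Gram.
Variables (R : realType) (mu : probability (borel_circle R) R).
Variables (alpha : nat -> R[i]) (r : R).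
Hypotheses (r1 : r < 1) (alpha_r : forall n, cabs (alpha n) <= r).
Variables (a : nat -> R[i]) (phi : nat -> R[i] -> R[i]).
Hypothesis (orf : orf_with alpha a mu phi).
Notation ip := (ip mu).
Notation eta := (eta alpha).
Notation rho := (rho a).
Notation pfac := (pfac alpha).
Notation cmv := (cmv alpha phi).
Notation cmvt := (cmvt alpha phi).
Notation hrow := (hrow alpha a phi).
Notation kfac := (kfac alpha a).
Notation rr := (rr a).
Notation aa := (aa a).
Notation kfun := (kfun alpha a).
Notation z_ := (@circle_val R).

Lemma lip_cmvt n : lip (cmvt n).
Proof.
apply: lip_mul; last exact: lip_cst.
exact: (lip_cmv r1 alpha_r orf).
Qed.

Lemma nice_cmvt n : cnice (cmvt n).
Proof. exact: lip_nice (lip_cmvt n). Qed.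

Lemma cmvt_orth m n : ip (cmvt m) (cmvt n) = (m == n)%:R / eta n ^+ 2.
Proof.
have nc k := nice_cmv r1 alpha_r orf k.
have e k : cmvt k = fun s => (eta k)^-1 * cmv k s.
  by apply/funext => s; rewrite /cmvt mulrC.
rewrite !e ipZr // ?ipZl // ?(cmv_orth r1 alpha_r orf) //; last exact: cnice_scale.
rewrite cjV (cj_eta r1 alpha_r) expr2 invfM.
by have [->|_] := eqVneq m n; rewrite ?mul0r ?mulr0 // mulr1 mul1r.
Qed.

Lemma hrowE l n : hrow l n = fun s => kfac n l * cmvt n s +
  ((rr n * pfac (odd n) n.-1 l) * cmvt n.-1 s +
   (- (rr n.+1 * pfac (~~ odd n) n.+1 l)) * cmvt n.+1 s).
Proof. by apply/funext => s; rewrite /hrow mulNr addrA. Qed.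

Lemma nice_hrow l n : cnice (hrow l n).
Proof.
rewrite hrowE; apply: cnice_add; last apply: cnice_add;
  by apply: cnice_scale; exact: nice_cmvt.
Qed.

Lemma gramE l1 l2 n k : ip (hrow l1 n) (hrow l2 k) =
  (kfac n l1)^* * (kfac k l2 * ip (cmvt n) (cmvt k)
     + (rr k * pfac (odd k) k.-1 l2 * ip (cmvt n) (cmvt k.-1)
     - rr k.+1 * pfac (~~ odd k) k.+1 l2 * ip (cmvt n) (cmvt k.+1)))
  + ((rr n * pfac (odd n) n.-1 l1)^* * (kfac k l2 * ip (cmvt n.-1) (cmvt k)
     + (rr k * pfac (odd k) k.-1 l2 * ip (cmvt n.-1) (cmvt k.-1)
     - rr k.+1 * pfac (~~ odd k) k.+1 l2 * ip (cmvt n.-1) (cmvt k.+1)))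
  - (rr n.+1 * pfac (~~ odd n) n.+1 l1)^* * (kfac k l2 * ip (cmvt n.+1) (cmvt k)
     + (rr k * pfac (odd k) k.-1 l2 * ip (cmvt n.+1) (cmvt k.-1)
     - rr k.+1 * pfac (~~ odd k) k.+1 l2 * ip (cmvt n.+1) (cmvt k.+1)))).
Proof.
have nc := nice_cmvt; have nh := nice_hrow l2 k.
have ns c j : cnice (fun s => c * cmvt j s) by exact: cnice_scale (nc j).
have e m : ip (cmvt m) (hrow l2 k) = kfac k l2 * ip (cmvt m) (cmvt k)
     + (rr k * pfac (odd k) k.-1 l2 * ip (cmvt m) (cmvt k.-1)
     - rr k.+1 * pfac (~~ odd k) k.+1 l2 * ip (cmvt m) (cmvt k.+1)).
  rewrite hrowE (ipDr _ (nc m) (ns _ k) (cnice_add (ns _ k.-1) (ns _ k.+1))).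
  rewrite (ipDr _ (nc m) (ns _ k.-1) (ns _ k.+1)).
  by rewrite !(ipZr _ _ (nc m) (nc _)) mulNr.
rewrite -!e hrowE (ipDl _ nh (ns _ n) (cnice_add (ns _ n.-1) (ns _ n.+1))).
rewrite (ipDl _ nh (ns _ n.-1) (ns _ n.+1)).
by rewrite !(ipZl _ _ nh (nc _)) cjN mulNr.
Qed.

Lemma gram_diag l1 l2 n : ip (hrow l1 n.+1) (hrow l2 n.+1) =
  (kfac n.+1 l1)^* * kfac n.+1 l2 / eta n.+1 ^+ 2
  + rr n.+1 ^+ 2 * (pfac (~~ odd n) n l1)^* * pfac (~~ odd n) n l2 / eta n ^+ 2
  + rr n.+2 ^+ 2 * (pfac (odd n) n.+2 l1)^* * pfac (odd n) n.+2 l2 / eta n.+2 ^+ 2.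
Proof.
rewrite gramE !cmvt_orth [odd n.+1]/= [n.+1.-1]/= negbK !eqxx.
have -> : (n.+1 == n) = false by apply/eqP; lia.
have -> : (n == n.+1) = false by apply/eqP; lia.
have -> : (n.+2 == n) = false by apply/eqP; lia.
have -> : (n == n.+2) = false by apply/eqP; lia.
have -> : (n.+1 == n.+2) = false by apply/eqP; lia.
have -> : (n.+2 == n.+1) = false by apply/eqP; lia.
have t1 : true%:R = 1 :> R[i] by [].
have f0 : false%:R = 0 :> R[i] by [].
rewrite !cjM !(cj_rr orf) t1 f0; ring.
Qed.

Lemma gram_next l1 l2 n : ip (hrow l1 n.+1) (hrow l2 n.+2) = rr n.+2 *
  ((kfac n.+1 l1)^* * pfac (odd n) n.+1 l2 / eta n.+1 ^+ 2
   - (pfac (odd n) n.+2 l1)^* * kfac n.+2 l2 / eta n.+2 ^+ 2).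
Proof.
rewrite gramE !cmvt_orth [odd n.+1]/= [odd n.+2]/= [n.+1.-1]/= [n.+2.-1]/= !negbK !eqxx.
have -> : (n.+1 == n.+2) = false by apply/eqP; lia.
have -> : (n.+1 == n.+3) = false by apply/eqP; lia.
have -> : (n == n.+1) = false by apply/eqP; lia.
have -> : (n == n.+2) = false by apply/eqP; lia.
have -> : (n == n.+3) = false by apply/eqP; lia.
have -> : (n.+2 == n.+1) = false by apply/eqP; lia.
have -> : (n.+2 == n.+3) = false by apply/eqP; lia.
have t1 : true%:R = 1 :> R[i] by [].
have f0 : false%:R = 0 :> R[i] by [].
rewrite !cjM !(cj_rr orf) t1 f0; ring.
Qed.

Lemma gram_next2 l1 l2 n : ip (hrow l1 n.+1) (hrow l2 n.+3) =
  - (rr n.+2 * rr n.+3 * (pfac (odd n) n.+2 l1)^* * pfac (~~ odd n) n.+2 l2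
     / eta n.+2 ^+ 2).
Proof.
rewrite gramE !cmvt_orth [odd n.+1]/= [odd n.+3]/= [n.+1.-1]/= [n.+3.-1]/= !negbK !eqxx.
have -> : (n.+1 == n.+3) = false by apply/eqP; lia.
have -> : (n.+1 == n.+2) = false by apply/eqP; lia.
have -> : (n.+1 == n.+4) = false by apply/eqP; lia.
have -> : (n == n.+2) = false by apply/eqP; lia.
have -> : (n == n.+3) = false by apply/eqP; lia.
have -> : (n == n.+4) = false by apply/eqP; lia.
have -> : (n.+2 == n.+3) = false by apply/eqP; lia.
have -> : (n.+2 == n.+4) = false by apply/eqP; lia.
have t1 : true%:R = 1 :> R[i] by [].
have f0 : false%:R = 0 :> R[i] by [].
rewrite !cjM !(cj_rr orf) t1 f0; ring.
Qed.

Lemma gram_far l1 l2 n k : (n.+2 < k)%N -> ip (hrow l1 n) (hrow l2 k) = 0.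
Proof.
move=> nk; rewrite gramE !cmvt_orth.
have -> : (n == k) = false by apply/eqP; lia.
have -> : (n == k.-1) = false by apply/eqP; lia.
have -> : (n == k.+1) = false by apply/eqP; lia.
have -> : (n.-1 == k) = false by apply/eqP; lia.
have -> : (n.-1 == k.-1) = false by apply/eqP; lia.
have -> : (n.-1 == k.+1) = false by apply/eqP; lia.
have -> : (n.+1 == k) = false by apply/eqP; lia.
have -> : (n.+1 == k.-1) = false by apply/eqP; lia.
have -> : (n.+1 == k.+1) = false by apply/eqP; lia.
have -> : false%:R = 0 :> R[i] by [].
ring.
Qed.

Lemma kfac_odd n l : odd n -> kfac n l = kfun n l.
Proof.
case: n => // n on; rewrite /kfac /aa /rr -[odd n.+2]/(~~ odd n.+1) on /=.
by rewrite conjCK.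
Qed.

Lemma kfac_even n l : cabs l = 1 -> (0 < n)%N -> ~~ odd n ->
  kfac n l = l * (kfun n l)^*.
Proof.
case: n => // n hl _ on; rewrite /kfac /aa -[odd n.+2]/(~~ odd n.+1) (negbTE on) /=.
rewrite /Defs.kfun cjD !cjM -[varpis _ _ _]/(pfac true n.+1 l).
rewrite -[varpi _ _ _]/(pfac false n.+1 l) !cj_pfac //=.
by field; rewrite unit_neq0.
Qed.

Definition cond1 n : R[i] := rho n * rho n.+1.

Definition cond2 l1 l2 n : R[i] := rho n *
  (varpi alpha n l1 / varpi alpha n (alpha n) * kfun n l2
   - varpis alpha n.-1 l2 / varpi alpha n.-1 (alpha n.-1) * kfun n.-1 l1).

Definition cond3 l1 l2 n : R[i] :=
  (kfun n l1)^* * kfun n l2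
  + rho_minus alpha a n ^+ 2 * (varpis alpha n.-1 l1)^* * varpis alpha n.-1 l2
  + rho_plus alpha a n.+1 ^+ 2 * (varpi alpha n.+1 l1)^* * varpi alpha n.+1 l2.

Let eta0 n : eta n != 0. Proof. exact: (eta_neq0 r1 alpha_r). Qed.

Lemma cond2E l1 l2 n : cond2 l1 l2 n = rho n *
  (pfac false n l1 * kfun n l2 / eta n ^+ 2
   - pfac true n.-1 l2 * kfun n.-1 l1 / eta n.-1 ^+ 2).
Proof.
rewrite /cond2 -!eta_sqE.
rewrite /pfac; ring.
Qed.

Lemma cond3E l1 l2 n : cond3 l1 l2 n =
  (kfun n l1)^* * kfun n l2
  + (eta n * rho n / eta n.-1) ^+ 2 * (pfac true n.-1 l1)^* * pfac true n.-1 l2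
  + (eta n * rho n.+1 / eta n.+1) ^+ 2 * (pfac false n.+1 l1)^* * pfac false n.+1 l2.
Proof.
rewrite /cond3 /rho_minus /rho_plus /pfac /=.
by rewrite (mulrAC (eta n)) (mulrAC (eta n) (eta n.+1)^-1).
Qed.

(** Exchanging [l1] and [l2] changes both terms of the bracket by the same multiple of [a n],
    because [varpi m l1 * varpis m l2 - varpi m l2 * varpis m l1] equals
    [eta m ^+ 2 * (l2 - l1)]. *)
Lemma cond2_sym l1 l2 n : (0 < n)%N -> cond2 l1 l2 n = cond2 l2 l1 n.
Proof.
move=> n0; rewrite /cond2; congr (_ * _); apply/eqP; rewrite -subr_eq0; apply/eqP.
have e m := eta_sqE alpha m.
have h m : varpi alpha m (alpha m) != 0.
  by rewrite -eta_sqE expf_neq0.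
have := h n; have := h n.-1.
case: n n0 => // n _; rewrite /Defs.kfun /varpi /varpis /= => h1 h2;
  by field; rewrite h1 h2.
Qed.

(** At even indices the entry is the conjugate of the expression found at odd ones, up to the
    unimodular factor [l1^-1 * l2]; hence only moduli are compared. *)
Lemma cabs_gram_diag l1 l2 n : cabs l1 = 1 -> cabs l2 = 1 ->
  cabs (ip (hrow l1 n.+1) (hrow l2 n.+1)) = cabs (cond3 l1 l2 n.+1) / cabs (eta n.+1) ^+ 2.
Proof.
move=> h1 h2; rewrite -cabsX -cabsV -cabsM gram_diag cond3E [n.+1.-1]/=.
have [n1 n2] := (unit_neq0 h1, unit_neq0 h2).
case: (boolP (odd n)) => on.
  have ev : ~~ odd n.+1 by rewrite /= on.
  rewrite (kfac_even h1 (ltn0Sn n) ev) (kfac_even h2 (ltn0Sn n) ev).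
  have u1 : cabs (l1^-1 * l2) = 1 by rewrite cabsM cabsV h1 h2 invr1 mulr1.
  have mu1 w : cabs w = cabs (l1^-1 * l2 * w) by rewrite cabsM u1 mul1r.
  rewrite -[RHS]cabsJ [RHS]mu1.
  have e n' : (rho n'.+1)^* = rho n'.+1 by exact: (cj_rr orf n'.+1).
  congr cabs; rewrite /pfac /Defs.kfun /varpis /varpi /= !expr2.
  rewrite !(cjV, cjM, cjD, cjN, cj1, conjCK) !(cj_eta r1 alpha_r) !e.
  by rewrite !(cj_unit h1) !(cj_unit h2); field; rewrite !eta0 n1 n2.
have od : odd n.+1 by rewrite /= on.
rewrite !(kfac_odd _ od) /=.
by congr cabs; field; rewrite !eta0.
Qed.

Lemma cabs_gram_next l1 l2 n : cabs l1 = 1 -> cabs l2 = 1 ->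
  cabs (ip (hrow l1 n.+1) (hrow l2 n.+2)) = cabs (cond2 l1 l2 n.+2).
Proof.
move=> h1 h2; rewrite gram_next cond2E [n.+2.-1]/= !cabsM; congr (_ * _).
have [n1 n2] := (unit_neq0 h1, unit_neq0 h2).
case: (boolP (odd n)) => on.
  have ev : ~~ odd n.+1 by rewrite /= on.
  have od : odd n.+2 by rewrite /= on.
  rewrite (kfac_even h1 (ltn0Sn n) ev) (kfac_odd _ od).
  have mu1 w : cabs w = cabs (l1^-1 * w) by rewrite cabsM cabsV h1 invr1 mul1r.
  rewrite -[RHS]cabsN [RHS]mu1; congr cabs.
  rewrite /pfac /Defs.kfun /varpis /varpi /=.
  rewrite !(cjV, cjM, cjD, cjN, cj1, conjCK) !(cj_unit h1).
  by field; rewrite !eta0 n1.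
have ev : ~~ odd n.+2 by rewrite /= on.
have od : odd n.+1 by rewrite /= on.
rewrite (kfac_odd _ od) (kfac_even h2 (ltn0Sn n.+1) ev).
have mu1 w : cabs w = cabs (l2 * w) by rewrite cabsM h2 mul1r.
rewrite -[RHS]cabsN -[RHS]cabsJ [RHS]mu1; congr cabs.
rewrite /pfac /Defs.kfun /varpis /varpi /= !expr2.
rewrite !(cjV, cjM, cjD, cjN, cj1, conjCK) !(cj_eta r1 alpha_r).
by rewrite !(cj_unit h1) !(cj_unit h2); field; rewrite !eta0 n2 n1.
Qed.

Lemma cabs_gram_next2 l1 l2 n : cabs l1 = 1 -> cabs l2 = 1 ->
  cabs (ip (hrow l1 n.+1) (hrow l2 n.+3)) = cabs (cond1 n.+2) *
   (cabs (pfac (odd n) n.+2 l1) * cabs (pfac (~~ odd n) n.+2 l2) / cabs (eta n.+2) ^+ 2).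
Proof.
move=> h1 h2; rewrite gram_next2 cabsN !cabsM cabsV cabsX cabsJ /rr; ring.
Qed.

End Gram.

(** * Accumulation points in {lambda1, lambda2} imply decay *)

Section Support.
Variables (R : realType) (mu : probability (borel_circle R) R).

Lemma closed_supp : closed (supp mu).
Proof.
rewrite -openC; apply/open_circleP => s /=.
move=> /existsNP[U /not_implyP[oU /not_implyP[Us /negP]]]; rewrite -leNgt => mU.
move: (oU) => /open_circleP /(_ s Us)[e e0 he].
by exists e => // t /he Ut /(_ U oU Ut); rewrite ltNge mU.
Qed.

(* Finitely many null balls cover the points at distance at least 1/n from the
   support. *)
Lemma supp_compl_null : mu (~` supp mu) = 0%E.
Proof.
have mC : measurable (~` supp mu : set (borel_circle R)).
  by apply: measurable_open; rewrite openC; exact: closed_supp.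
have h s : exists e : R, 0 < e /\ (~ supp mu s -> mu [set t | cdist s t < e] = 0%E).
  have [ss|ns] := pselect (supp mu s); first by exists 1.
  move: ns => /existsNP[U /not_implyP[oU /not_implyP[Us /negP]]]; rewrite -leNgt => mU.
  move: (oU) => /open_circleP /(_ s Us)[e e0 he]; exists e; split => // _.
  apply/eqP; rewrite eq_le measure_ge0 andbT; apply: le_trans mU.
  by apply: le_measure; rewrite ?inE; [exact: measurable_open (open_cball _ _)|exact: measurable_open|].
move/boolp.choice : h => [e he].
have h n : exists l : seq (circle R), forall t, exists2 s, s \in l &
    cdist s t < (if `[< supp mu s >] then n.+1%:R^-1 else e s).
  apply: circle_finite_cover => s; case: asboolP => _ //; exact: (he s).1.
move/boolp.choice : h => [l hl].
have : mu.-negligible (\bigcup_n \big[setU/set0]_(s <- l n | ~~ `[< supp mu s >])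
    ([set t | cdist s t < e s] : set (borel_circle R))).
  apply: negligible_bigcup => n.
  apply: (big_ind (fun A : set (borel_circle R) => mu.-negligible A)).
  - exact: negligible_set0.
  - exact: negligibleU.
  - move=> s /asboolPn ns; apply/negligibleP; last exact: (he s).2 ns.
    exact: measurable_open (open_cball _ _).
move=> neg; apply/(negligibleP mu mC); apply: negligibleS neg => t nt.
have := closed_supp; rewrite -openC => /open_circleP /(_ t nt)[d d0 hd].
pose n := Num.truncn d^-1; exists n => //.
have [s sl] := hl n t; case: asboolP => ss.
  move=> st; exfalso; apply: (hd s _ ss); rewrite cdistC; apply: lt_trans st _.
  rewrite invf_plt ?posrE // ?ltr0n //; exact: truncnS_gt.
by move=> st; rewrite -bigcup_seq_cond; exists s => //=; rewrite sl; apply/asboolPn.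
Qed.

End Support.

Section Necessity.
Variables (R : realType) (mu : probability (borel_circle R) R).
Variables (alpha : nat -> R[i]) (r : R).
Hypotheses (r1 : r < 1) (alpha_r : forall n, cabs (alpha n) <= r).
Variables (a : nat -> R[i]) (phi : nat -> R[i] -> R[i]).
Hypothesis (orf : orf_with alpha a mu phi).
Notation ip := (ip mu).
Notation eta := (eta alpha).
Notation cmv := (cmv alpha phi).
Notation cmvt := (cmvt alpha phi).
Notation hrow := (hrow alpha a phi).
Notation qrow := (qrow alpha a phi).
Notation rint := (rint mu).
Notation z_ := (@circle_val R).

Definition mass (s : circle R) : R := fine (mu [set s]).

Lemma measurable_point (s : circle R) : measurable ([set s] : set (borel_circle R)).
Proof.
have -> : [set s] = ~` [set t | t != s].
  by apply/seteqP; split => t /=; [move=> ->; rewrite eqxx | move/negP; rewrite negbK => /eqP].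
apply: measurableC; apply: measurable_open; apply/open_circleP => t /= ts.
exists (cdist t s); first exact: cdist_neq0.
by move=> u hu; apply/eqP => us; move: hu; rewrite us ltxx.
Qed.

Lemma mass_ge0 s : 0 <= mass s.
Proof. exact: fine_ge0. Qed.

(* Bessel's inequality for the indicator function of the atom. *)
Lemma atom_decay (s : circle R) (e : R) : 0 < e ->
  exists N, forall i, (N <= i)%N -> mass s * cabs (cmv i s) ^+ 2 < e.
Proof.
move=> e0.
have [->|m0] := eqVneq (mass s) 0; first by exists 0%N => i _; rewrite mul0r.
have mp : 0 < mass s by rewrite lt_def m0 mass_ge0.
pose f t : R[i] := ((\1_[set s] : circle R -> R) t)%:C.
have nf : cnice f by exact: cnice_real (rnice_indic (measurable_point s)).
have fE t : f t = (t == s)%:R.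
  rewrite /f indicE; have [->|ts] := eqVneq t s; first by rewrite mem_set.
  by rewrite memNset //= => tS; rewrite tS eqxx in ts.
have ipf i : ip (cmv i) f = (cmv i s)^* * (mass s)%:C.
  rewrite /ip /mass -rint_indic //; last exact: measurable_point.
  rewrite -cint_real -(cintZ mu _ nf); congr (cint _ _); apply/funext => t.
  by rewrite -/(f t) fE; have [->|_] := eqVneq t s; rewrite ?mulr0.
have fsq : rint (fun t => cabs (f t) ^+ 2) = mass s.
  rewrite /mass -rint_indic //; last exact: measurable_point.
  congr (rint _); apply/funext => t; rewrite /f cabsR indicE.
  by case: (_ \in _); rewrite ?normr1 ?normr0 ?expr1n ?expr0n.
pose u i : R := cabs (ip (cmv i) f) ^+ 2.
have u0 i : 0 <= u i by exact: sqr_ge0.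
have ub n : series u n <= mass s.
  rewrite -fsq; apply: bessel nf _; first exact: (nice_cmv r1 alpha_r orf).
  exact: (cmv_orth r1 alpha_r orf).
have : cvgn (series u).
  apply: nondecreasing_is_cvgn.
    apply/nondecreasing_seqP => n; rewrite /series /= big_nat_recr //= lerDl.
    exact: u0.
  by exists (mass s); move=> _ [n _ <-]; exact: ub.
move/cvg_series_cvg_0 => /cvgrPdist_lt /(_ (e * mass s) (mulr_gt0 e0 mp))[N _ hN].
exists N => i /hN /=; rewrite sub0r normrN ger0_norm // /u ipf.
rewrite cabsM cabsJ cabsR ger0_norm ?mass_ge0 // exprMn => h.
have : (mass s * cabs (cmv i s) ^+ 2) * mass s < e * mass s.
  by apply: le_lt_trans h; rewrite le_eqVlt; apply/orP; left; apply/eqP; ring.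
by rewrite ltr_pM2r.
Qed.

(** Dominates the square of [qrow n], which combines these three functions. *)
Definition tri n (s : circle R) : R :=
  cabs (cmv n s) ^+ 2 + cabs (cmv n.-1 s) ^+ 2 + cabs (cmv n.+1 s) ^+ 2.

Lemma tri_decay (l : seq (circle R)) (e : R) : 0 < e ->
  exists N, forall i, (N <= i)%N -> \sum_(t <- l) mass t * tri i t < e.
Proof.
elim: l e => [|t l IH] e e0; first by exists 0%N => i _; rewrite big_nil.
have e8 : 0 < e / 8 by rewrite divr_gt0.
have [N hN] := IH _ e8; have [M hM] := atom_decay t e8.
exists (maxn N M.+1) => i; rewrite geq_max => /andP[iN iM]; rewrite big_cons.
have h1 := hN _ iN; have h2 := hM _ (ltnW iM).
have h3 := hM _ (leqW (ltnW iM)); have h4 : (M <= i.-1)%N by lia.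
have {}h4 := hM _ h4; rewrite /tri !mulrDr; lra.
Qed.

Lemma rnice_tri n : rnice (tri n).
Proof.
have h k := rnice_cabs_sq (nice_cmv r1 alpha_r orf k).
exact: rnice_add (rnice_add (h _) (h _)) (h _).
Qed.

Lemma rint_cmv n : rint (fun s => cabs (cmv n s) ^+ 2) = 1.
Proof.
apply: complexI; rewrite -ip_norm (cmv_orth r1 alpha_r orf) eqxx //.
Qed.

Lemma rint_tri n : rint (tri n) = 3.
Proof.
have h k := rnice_cabs_sq (nice_cmv r1 alpha_r orf k).
by rewrite /tri (rintD _ (rnice_add (h _) (h _)) (h _)) rintD // !rint_cmv; ring.
Qed.

(** The coefficients of [qrow] have moduli at most 2, 1, 1, with sum of squares 6, so 12 is ample;
    [1 - r] bounds [eta ^+ 2] from below. *)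
Let K : R := 12 / (1 - r).

Let K_gt0 : 0 < K.
Proof. by rewrite divr_gt0 // subr_gt0. Qed.

Lemma cabs_cmvt n s : cabs (cmvt n s) ^+ 2 <= cabs (cmv n s) ^+ 2 / (1 - r).
Proof.
rewrite /cmvt cabsM cabsV expr_div_n ler_wpM2l ?sqr_ge0 //.
have h := eta_sq_lower r1 alpha_r n; have : 0 < 1 - r by rewrite subr_gt0.
by move=> h0; rewrite lef_pV2 // posrE // (lt_le_trans h0).
Qed.

Lemma qrow_bound n s : cabs (qrow n s) ^+ 2 <= K * tri n s.
Proof.
have hc (x c : R[i]) (y : R) : 0 <= y -> cabs c <= y -> cabs (c * x) <= y * cabs x.
  by move=> y0 h; rewrite cabsM ler_wpM2r ?cabs_ge0.
have ps b k := cabs_pslope r1 alpha_r b k.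
have ha := cabs_aa orf; have hr := cabs_rr orf.
have m1 (x y : R[i]) : cabs x <= 1 -> cabs y <= 1 -> cabs (x * y) <= 1.
  by move=> hx hy; rewrite cabsM -[1]mulr1 ler_pM ?cabs_ge0.
have : cabs (qrow n s) <= 2 * cabs (cmvt n s) + 1 * cabs (cmvt n.-1 s) + 1 * cabs (cmvt n.+1 s).
  rewrite /qrow; apply: le_trans (cabsD _ _) _; rewrite cabsN.
  apply: lerD; last by apply: hc => //; exact: m1.
  apply: le_trans (cabsD _ _) _; apply: lerD; last by apply: hc => //; exact: m1.
  apply: hc => //; apply: le_trans (cabsD _ _) _.
  have := m1 _ _ _ (ps (odd n) n) => /(_ (aa a n)^*); rewrite cabsJ => /(_ (ha n)).
  have := m1 _ _ (ha n.+1) (ps (~~ odd n) n); lra.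
have := cabs_cmvt n s; have := cabs_cmvt n.-1 s; have := cabs_cmvt n.+1 s.
rewrite /tri /K; have := cabs_ge0 (qrow n s).
have := cabs_ge0 (cmvt n s); have := cabs_ge0 (cmvt n.-1 s); have := cabs_ge0 (cmvt n.+1 s).
set q := cabs (qrow n s); set x := cabs (cmvt n s); set y := cabs (cmvt n.-1 s).
set w := cabs (cmvt n.+1 s) => w0 y0 x0 q0 hw hy hx hq.
have -> : 12 / (1 - r) * (cabs (cmv n s) ^+ 2 + cabs (cmv n.-1 s) ^+ 2 + cabs (cmv n.+1 s) ^+ 2)
  = 12 * (cabs (cmv n s) ^+ 2 / (1 - r) + cabs (cmv n.-1 s) ^+ 2 / (1 - r) + cabs (cmv n.+1 s) ^+ 2 / (1 - r)) by ring.
have : q ^+ 2 <= 12 * (x ^+ 2 + y ^+ 2 + w ^+ 2); last by lra.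
have : q ^+ 2 <= (2 * x + y + w) ^+ 2 by rewrite ler_pXn2r ?nnegrE //; lra.
have := sqr_ge0 (x - y); have := sqr_ge0 (x - w); have := sqr_ge0 (y - w).
have := sqr_ge0 x; have := sqr_ge0 y; have := sqr_ge0 w.
rewrite !expr2; nra.
Qed.

Lemma gram_vanish (l1 l2 : circle R) (e : R) :
  limit_point (supp mu) `<=` [set l1; l2] -> 0 < e ->
  exists N, forall n k, (N <= n)%N -> (N <= k)%N ->
    cabs (ip (hrow (z_ l1) n) (hrow (z_ l2) k)) < e.
Proof.
move=> hsupp e0.
pose g s := cdist l1 s * cdist l2 s.
(* The region [g < d] then contributes [3 * d * K = e / 4]. The threshold [e / (16 * K)] used below
   yields less than another [e / 4] for the remaining points, and [cabs_cint] doubles the sum. *)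
pose d := e / (12 * K).
have d0 : 0 < d by rewrite divr_gt0 // mulr_gt0.
have g4 s : g s <= 4.
  have h1 := cdist_le2 l1 s; have h2 := cdist_le2 l2 s.
  have h3 := cabs_ge0 (z_ l1 - z_ s); rewrite /g (_ : 4 = 2 * 2); last by ring.
  by apply: ler_pM => //; exact: cabs_ge0.
have g0 s : 0 <= g s by apply: mulr_ge0; exact: cabs_ge0.
(* The set [d <= g] is closed and avoids [l1] and [l2], so it contains no accumulation point of the
   support. *)
have [l0 hl0] : exists l : seq (circle R), forall s, supp mu s -> d <= g s -> s \in l.
  have : closed [set s | d <= g s].
    rewrite -openC; apply/open_circleP => s /= /negP; rewrite -ltNge => gs.
    exists ((d - g s) / 4); first by rewrite divr_gt0 // subr_gt0.
    move=> t st /=; apply/negP; rewrite -ltNge.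
    have h1 := cdistD s l1 t; have h2 := cdistD s l2 t.
    have h3 := cdist_le2 l1 s; have h4 := cdist_le2 l2 t.
    have h5 := cabs_ge0 (z_ l1 - z_ s); have h6 := cabs_ge0 (z_ l2 - z_ t).
    have h7 := cabs_ge0 (z_ s - z_ t).
    rewrite -![cabs _]/(cdist _ _) in h5 h6 h7.
    have : g t <= (cdist l1 s + cdist s t) * cdist l2 t by rewrite ler_wpM2r.
    rewrite mulrDl => h8.
    have : cdist l1 s * cdist l2 t <= cdist l1 s * (cdist l2 s + cdist s t).
      by rewrite ler_wpM2l.
    rewrite mulrDr -/(g s) => h9.
    have : cdist l1 s * cdist s t <= 2 * cdist s t by rewrite ler_wpM2r.
    have : cdist s t * cdist l2 t <= cdist s t * 2 by rewrite ler_wpM2l.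
    move: st; rewrite ltr_pdivlMr //; lra.
  move=> cl; apply: (not_limit_point_finite (S := supp mu) cl).
  move=> s /= ds /hsupp hs; move: ds; apply/negP; rewrite -ltNge /g; case: hs => ->.
    by rewrite cdistxx mul0r.
  by rewrite cdistxx mulr0.
pose l := undup l0.
have e8K : 0 < e / (16 * K) by rewrite divr_gt0 // mulr_gt0.
have [N hN] := tri_decay l e8K.
exists N => n k nN kN.
pose F s := (hrow (z_ l1) n s)^* * hrow (z_ l2) k s.
have Flip : lip F.
  have hl w m : lip (hrow w m).
    rewrite hrowE; have x j := lip_cmvt r1 alpha_r orf j.
    by apply: lip_add; last apply: lip_add; exact: lip_scale.
  by apply: lip_mul => //; exact: lip_conj.
have [B B0 hB] := lip_bounded Flip.
have FE s : cabs (F s) = g s * (cabs (qrow n s) * cabs (qrow k s)).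
  rewrite /F !(hrow_qrow r1 alpha_r orf).
  rewrite !cabsM cabsJ cabsM /g /cdist; ring.
have Fb s : cabs (F s) <= g s * (K / 2 * (tri n s + tri k s)).
  rewrite FE ler_wpM2l //.
  have := qrow_bound n s; have := qrow_bound k s.
  have := sqr_ge0 (cabs (qrow n s) - cabs (qrow k s)).
  rewrite !expr2; nra.
have tri0 m s : 0 <= tri m s by rewrite /tri !addr_ge0 ?sqr_ge0.
pose m1 (t : circle R) : circle R -> R := \1_[set t].
have m1n t : rnice (m1 t) by exact: rnice_indic (measurable_point t).
have mC : measurable (~` supp mu : set (borel_circle R)).
  by apply: measurable_open; rewrite openC; exact: closed_supp.
pose cN : circle R -> R := \1_(~` supp mu).
have cNn : rnice cN by exact: rnice_indic.
(* One dominating function for each region: the support where [g < d], the finitely many points of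
   [l], and the null complement of the support. *)
pose G1 s := d * (K / 2) * (tri n s + tri k s).
pose G2 s := \sum_(t <- l) (2 * K * (tri n t + tri k t)) * m1 t s.
pose G3 s := B * cN s.
have nG1 : rnice G1 by apply: rnice_mul (rnice_cst _) (rnice_add (rnice_tri _) (rnice_tri _)).
have nG2 : rnice G2 by apply: rnice_sum => t _; exact: rnice_mul (rnice_cst _) (m1n t).
have nG3 : rnice G3 by apply: rnice_mul (rnice_cst _) cNn.
have Kp := ltW K_gt0; have dp := ltW d0.
have tt0 s : 0 <= tri n s + tri k s by rewrite addr_ge0.
have G10 s : 0 <= G1 s by rewrite mulr_ge0 // mulr_ge0 // divr_ge0.
have G2t s t : t \in l -> 0 <= (2 * K * (tri n t + tri k t)) * m1 t s.
  move=> _; apply: mulr_ge0; last by rewrite /m1 indicE ler0n.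
  by apply: mulr_ge0 => //; apply: mulr_ge0.
have G20 s : 0 <= G2 s by rewrite /G2 big_seq; apply: sumr_ge0 => t; exact: G2t.
have G30 s : 0 <= G3 s by rewrite mulr_ge0 // /cN indicE ler0n.
have bound s : cabs (F s) <= G1 s + G2 s + G3 s.
  have [ss|ns] := pselect (supp mu s); last first.
    have -> : G3 s = B by rewrite /G3 /cN indicE mem_set // mulr1.
    by have := hB s; have := G10 s; have := G20 s; lra.
  have h := Fb s; have [gd|gd] := ltP (g s) d.
    have : g s * (K / 2 * (tri n s + tri k s)) <= G1 s.
      have -> : G1 s = d * (K / 2 * (tri n s + tri k s)) by rewrite /G1; ring.
      by rewrite ler_wpM2r ?(ltW gd) // mulr_ge0 // divr_ge0.
    by have := G20 s; have := G30 s; lra.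
  have sl : s \in l by rewrite mem_undup hl0.
  have : g s * (K / 2 * (tri n s + tri k s)) <= G2 s.
    apply: (@le_trans _ _ (4 * (K / 2 * (tri n s + tri k s)))).
      by rewrite ler_wpM2r // mulr_ge0 // divr_ge0.
    rewrite /G2 (bigD1_seq s) ?undup_uniq //= {1}/m1 indicE mem_set // mulr1.
    apply: (@le_trans _ _ (2 * K * (tri n s + tri k s))); first by rewrite le_eqVlt; apply/orP; left; apply/eqP; field.
    by rewrite lerDl big_seq_cond sumr_ge0 // => t /andP[tl _]; exact: G2t.
  by have := G10 s; have := G30 s; lra.
have := cabs_cint mu (lip_nice Flip) (rnice_add (rnice_add nG1 nG2) nG3) bound.
rewrite (rintD _ (rnice_add nG1 nG2) nG3) (rintD _ nG1 nG2).
have -> : rint G3 = 0.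
  rewrite /G3 (rintZ mu B cNn) rint_indic //.
  by rewrite [X in fine X]supp_compl_null mulr0.
have -> : rint G1 = d * (K / 2) * 6.
  rewrite /G1 (rintZ mu _ (rnice_add (rnice_tri n) (rnice_tri k))).
  by rewrite (rintD _ (rnice_tri n) (rnice_tri k)) !rint_tri; congr (_ * _); ring.
have -> : rint G2 = 2 * K * (\sum_(t <- l) mass t * tri n t + \sum_(t <- l) mass t * tri k t).
  rewrite /G2 rint_sum; last by move=> t _; exact: rnice_mul (rnice_cst _) (m1n t).
  rewrite -big_split mulr_sumr; apply: eq_bigr => t _ /=.
  rewrite (rintZ mu _ (m1n t)) rint_indic; last exact: measurable_point.
  by rewrite -/(mass t); ring.
have h1 := hN n nN; have h2 := hN k kN.
have dK : d * (K / 2) * 6 = e / 4 by rewrite /d; field; rewrite gt_eqF.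
have : 2 * K * (\sum_(t <- l) mass t * tri n t + \sum_(t <- l) mass t * tri k t) < 2 * K * (e / (16 * K) + e / (16 * K)).
  by rewrite (ltr_pM2l (mulr_gt0 (ltr0n R 2) K_gt0)) ltrD.
have -> : 2 * K * (e / (16 * K) + e / (16 * K)) = e / 4 by field; rewrite gt_eqF.
rewrite dK -/(ip _ _); rewrite /ip -/F; move: e0; lra.
Qed.

End Necessity.

(** * Decay implies accumulation points in {lambda1, lambda2} *)

Section FormBound.
Variables (R : realType) (mu : probability (borel_circle R) R).
Variables (alpha : nat -> R[i]) (r : R).
Hypotheses (r1 : r < 1) (alpha_r : forall n, cabs (alpha n) <= r).
Variables (a : nat -> R[i]) (phi : nat -> R[i] -> R[i]).
Hypothesis (orf : orf_with alpha a mu phi).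
Notation ip := (ip mu).
Notation eta := (eta alpha).
Notation pfac := (pfac alpha).
Notation cmv := (cmv alpha phi).
Notation cmvt := (cmvt alpha phi).
Notation dualt := (dualt alpha phi).
Notation hrow := (hrow alpha a phi).
Notation kfac := (kfac alpha a).
Notation bodd := (bodd alpha).
Notation inW := (inW alpha).
Notation rr := (rr a).
Notation aa := (aa a).
Notation rint := (rint mu).
Notation z_ := (@circle_val R).

Lemma tridiagonal_exchange (l : R[i]) (v : nat -> R[i]) s L :
  \sum_(0 <= m < L.+1) (-1) ^+ odd m * (kfac m l * v m + rr m * pfac (odd m) m l * v m.-1
     - rr m.+1 * pfac (~~ odd m) m l * v m.+1) * cmvt m s
  + (-1) ^+ odd L * rr L.+1 * pfac (~~ odd L) L l * v L.+1 * cmvt L s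
  = \sum_(0 <= n < L.+1) (-1) ^+ odd n * v n * hrow l n s
  + (-1) ^+ odd L * rr L.+1 * pfac (~~ odd L) L.+1 l * v L * cmvt L.+1 s.
Proof.
elim: L => [|L IH].
  by rewrite !big_nat1 /hrow; have -> : rr 0 = 0 by []; rewrite /=; ring.
rewrite big_nat_recr //= [in RHS]big_nat_recr //=.
move: IH; set S1 := \sum_(_ <= _ < _) _; set S2 := \sum_(_ <= _ < _) _ => IH.
have -> : S1 = S2 + (-1) ^+ odd L * rr L.+1 * pfac (~~ odd L) L.+1 l * v L * cmvt L.+1 s
   - (-1) ^+ odd L * rr L.+1 * pfac (~~ odd L) L l * v L.+1 * cmvt L s.
  by rewrite -IH addrK.
have -> : (-1) ^+ (~~ odd L) = - (-1) ^+ odd L :> R[i].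
  by case: (odd L); rewrite ?expr0 ?expr1 ?opprK.
rewrite /hrow /=; ring.
Qed.

Variables (M : nat) (f : circle R -> R[i]).
(** Moving [z] across the inner product turns the [z * cmv j] inside [dualt] into [cmv j] against
    [fz]. Both memberships together make the expansion of [(l - z)^* f] finite. *)
Let fz s := (z_ s)^* * f s.
Hypotheses (Wf : inW M (fun s => bodd M s * f s))
           (Wfz : inW M (fun s => bodd M s * fz s)).
Let v n := ip (dualt n) f.
Let I := rint (fun s => cabs (f s) ^+ 2).

Lemma nice_of_inW g : inW M (fun s => bodd M s * g s) -> cnice g.
Proof.
move=> h; have -> : g = fun s => (bodd M s)^-1 * (bodd M s * g s).
  by apply/funext => s; rewrite mulKf // (bodd_neq0 r1 alpha_r).
apply: cnice_mul; first exact: lip_nice (lip_bodd_inv r1 alpha_r M).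
exact: (inW_nice r1 alpha_r h).
Qed.

Let nf : cnice f. Proof. exact: nice_of_inW Wf. Qed.
Let nfz : cnice fz. Proof. exact: nice_of_inW Wfz. Qed.
Let ncm k : cnice (cmv k). Proof. exact: (nice_cmv r1 alpha_r orf k). Qed.
Let ncmt k : cnice (cmvt k). Proof. exact: (nice_cmvt r1 alpha_r orf). Qed.

Lemma cmv_tail g m : inW M (fun s => bodd M s * g s) -> (M < m)%N -> ip (cmv m) g = 0.
Proof.
move=> h Mm; have := cmv_expand r1 alpha_r orf h.
set c := fun i => ip (cmv i) g => E.
have -> : g = fun s => \sum_(0 <= i < M.+1) c i * cmv i s by apply/funext.
rewrite ip_sumr // big1_seq // => i /andP[_]; rewrite mem_index_iota => /andP[_ iM].
by rewrite (cmv_orth r1 alpha_r orf) gtn_eqF ?mulr0 // (leq_ltn_trans _ Mm).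
Qed.

Let w j := cabs (ip (cmv j) f) ^+ 2 + cabs (ip (cmv j) fz) ^+ 2.

Lemma sqrD_le2 (x y : R) : (x + y) ^+ 2 <= 2 * (x ^+ 2 + y ^+ 2).
Proof. by have := sqr_ge0 (x - y); rewrite !expr2; nra. Qed.

Lemma lip_pfac b k : lip (fun s => pfac b k (z_ s)).
Proof.
have e : (fun s => pfac b k (z_ s)) = (fun s => pfac b k 0 + pslope alpha b k * z_ s).
  by apply/funext => s; rewrite (pfac_affine _ _ _ 0 (z_ s)) subr0.
by rewrite e; apply: lip_add (lip_cst _) (lip_scale _ (lip_val R)).
Qed.

Lemma pfac_cmvt_bound b j :
  cabs (ip (fun s => pfac b j (z_ s) * cmvt j s) f) ^+ 2 <= 2 / (1 - r) * w j.
Proof.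
have A1 : cabs (pfac b j 0) <= 1.
  rewrite /pfac /varpi /varpis; case: b; last by rewrite mulr0 subr0 cabs1.
  by rewrite sub0r cabsN; exact: ltW (alpha_lt1 r1 alpha_r j).
have B1 := cabs_pslope r1 alpha_r b j.
have E : ip (fun s => pfac b j (z_ s) * cmvt j s) f =
    (pfac b j 0 / eta j)^* * ip (cmv j) f + (pslope alpha b j / eta j)^* * ip (cmv j) fz.
  rewrite -(ipZl mu _ nf (ncm j)) -(ipZl mu _ nfz (ncm j)).
  transitivity (cint mu (fun s => (pfac b j 0 / eta j * cmv j s)^* * f s +
      (pslope alpha b j / eta j * cmv j s)^* * fz s)).
    rewrite /ip; congr (cint _ _); apply/funext => s.
    rewrite /fz (pfac_affine _ _ _ 0 (z_ s)) subr0 /cmvt.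
    by rewrite !(cjM, cjD); ring.
  by rewrite (cintD mu (cnice_ip (cnice_scale _ (ncm j)) nf) (cnice_ip (cnice_scale _ (ncm j)) nfz)).
rewrite E.
have e0 : 0 < cabs (eta j) ^+ 2.
  by apply: lt_le_trans (eta_sq_lower r1 alpha_r j); rewrite subr_gt0.
have h (c x : R[i]) : cabs c <= 1 -> cabs ((c / eta j)^* * x) ^+ 2 <= cabs x ^+ 2 / (1 - r).
  move=> hc; rewrite cabsM cabsJ cabsM cabsV exprMn expr_div_n mulrC.
  apply: ler_pM; rewrite ?sqr_ge0 ?divr_ge0 ?sqr_ge0 //.
  rewrite -[(1 - r)^-1]mul1r; apply: ler_pM; rewrite ?sqr_ge0 ?invr_ge0 ?sqr_ge0 //.
    by rewrite expr_le1 ?cabs_ge0.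
  rewrite lef_pV2 ?posrE ?subr_gt0 //; exact: (eta_sq_lower r1 alpha_r).
apply: le_trans (_ : _ <= 2 * (cabs (ip (cmv j) f) ^+ 2 / (1 - r) + cabs (ip (cmv j) fz) ^+ 2 / (1 - r))) _.
  set X := _ * ip (cmv j) f; set Y := _ * ip (cmv j) fz.
  apply: (@le_trans _ _ ((cabs X + cabs Y) ^+ 2)).
    by rewrite ler_pXn2r ?nnegrE ?addr_ge0 ?cabs_ge0 // cabsD.
  apply: le_trans (sqrD_le2 _ _) _; rewrite ler_wpM2l // lerD // h //.
by rewrite le_eqVlt; apply/orP; left; apply/eqP; rewrite /w; ring.
Qed.

Lemma dual_coef_bound n : cabs (v n) ^+ 2 <= 4 / (1 - r) * (w n + w n.-1).
Proof.
have na b k j : cnice (fun s => pfac b k (z_ s) * cmvt j s).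
  by apply: cnice_mul => //; exact: lip_nice (lip_pfac _ _).
have E : v n = aa n * ip (fun s => pfac (odd n) n (z_ s) * cmvt n s) f +
   (rr n)^* * ip (fun s => pfac (odd n) n.-1 (z_ s) * cmvt n.-1 s) f.
  rewrite /v; have -> : dualt n = fun s => (aa n)^* * (pfac (odd n) n (z_ s) * cmvt n s) +
      rr n * (pfac (odd n) n.-1 (z_ s) * cmvt n.-1 s).
    by apply/funext => s; exact: (dualt_cmv r1 alpha_r orf).
  rewrite (ipDl _ nf (cnice_scale _ (na _ _ _)) (cnice_scale _ (na _ _ _))).
  by rewrite (ipZl _ _ nf (na _ _ _)) (ipZl _ _ nf (na _ _ _)) conjCK.
have h1 := pfac_cmvt_bound (odd n) n; have h2 := pfac_cmvt_bound (odd n) n.-1.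
have ha := cabs_aa orf n; have hr := cabs_rr orf n.
rewrite E; set X := ip _ _ in h1 *; set Y := ip _ _ in h2 *.
have h3 : cabs (aa n * X + (rr n)^* * Y) <= cabs X + cabs Y.
  apply: le_trans (cabsD _ _) _; rewrite !cabsM cabsJ.
  by apply: lerD; rewrite -[leRHS]mul1r ler_wpM2r ?cabs_ge0.
have : cabs (aa n * X + (rr n)^* * Y) ^+ 2 <= (cabs X + cabs Y) ^+ 2.
  by rewrite ler_pXn2r ?nnegrE ?addr_ge0 ?cabs_ge0.
have h4 := sqrD_le2 (cabs X) (cabs Y).
have -> : 4 / (1 - r) * (w n + w n.-1) = 2 * (2 / (1 - r) * w n + 2 / (1 - r) * w n.-1) by ring.
move=> h5; apply: le_trans h5 (le_trans h4 _).
by rewrite ler_wpM2l // lerD.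
Qed.

(** Since [v n] also involves the index [n.-1], vanishing starts one index later than for the [cmv]
    coefficients. *)
Lemma dual_coef_tail n : (M.+1 < n)%N -> v n = 0.
Proof.
move=> Mn; apply/eqP; rewrite -cabs_eq0 -sqrf_eq0 eq_le sqr_ge0 andbT.
apply: le_trans (dual_coef_bound n) _.
have h j : (M < j)%N -> w j = 0.
  by move=> Mj; rewrite /w !cmv_tail // cabs0 expr0n addr0.
rewrite !h ?addr0 ?mulr0 //; lia.
Qed.

Lemma dual_coef_sum L : \sum_(0 <= n < L) cabs (v n) ^+ 2 <= 24 / (1 - r) * I.
Proof.
have r0 : 0 < 1 - r by rewrite subr_gt0.
have b g : cnice g -> forall L, \sum_(0 <= n < L) cabs (ip (cmv n) g) ^+ 2 <= rint (fun s => cabs (g s) ^+ 2).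
  by move=> ng K; apply: bessel => //; exact: (cmv_orth r1 alpha_r orf).
have Iz : rint (fun s => cabs (fz s) ^+ 2) = I.
  by congr (rint _); apply/funext => s; rewrite /fz cabsM cabsJ cabs_circle mul1r.
have hw K : \sum_(0 <= n < K) w n <= 2 * I.
  by rewrite big_split /=; have := b _ nf K; have := b _ nfz K; rewrite Iz -/I; lra.
have w0 j : 0 <= w j by rewrite addr_ge0 ?sqr_ge0.
(* As [0.-1 = 0], the term [w 0] occurs twice; a second copy of [2 * I] pays for it. *)
have hw' : \sum_(0 <= n < L) w n.-1 <= 4 * I.
  case: L => [|L]; first by rewrite big_geq // mulr_ge0 // rint_ge0 // => s; exact: sqr_ge0.
  rewrite big_nat_recl //=; have := hw L; have := hw 1%N; rewrite big_nat1; lra.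
apply: le_trans (_ : _ <= \sum_(0 <= n < L) 4 / (1 - r) * (w n + w n.-1)) _.
  by apply: ler_sum => n _; exact: dual_coef_bound.
rewrite -mulr_sumr big_split /=.
have -> : 24 / (1 - r) * I = 4 / (1 - r) * (2 * I + 4 * I) by ring.
by rewrite ler_wpM2l ?divr_ge0 ?(ltW r0) // lerD.
Qed.

(** By [cmvt_expr] the [cmv] coefficients of [(l - z)^* f] are tridiagonal in the [v n];
    [tridiagonal_exchange] regroups the sum by [hrow]. With [M.+3] terms both boundary terms contain
    a vanishing [v]. *)
Lemma dual_expansion l s : cabs l = 1 ->
  (l - z_ s)^* * f s = l^-1 * \sum_(0 <= n < M.+3) (-1) ^+ odd n * v n * hrow l n s.
Proof.
move=> hl; pose g s := l^* * f s - fz s.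
have ng : cnice g by exact: cnice_sub (cnice_scale _ nf) nfz.
have Wg : inW M (fun s => bodd M s * g s).
  apply: (inW_ext _ (inW_add (inW_scale l^* Wf) (inW_scale (-1) Wfz))) => t.
  by rewrite /g; ring.
have -> : (l - z_ s)^* * f s = g s by rewrite /g /fz cjB; ring.
have gE : g s = \sum_(0 <= m < M.+3) ip (cmv m) g * cmv m s.
  rewrite (cmv_expand r1 alpha_r orf Wg s).
  rewrite [in RHS](big_cat_nat (n := M.+1)) //=; last by lia.
  rewrite [X in _ + X]big1_seq ?addr0 // => m /andP[_]; rewrite mem_index_iota => /andP[Mm _].
  by rewrite (cmv_tail Wg) ?mul0r.
have nd m : cnice (dualt m).
  have -> : dualt m = fun s => (aa m)^* * (pfac (odd m) m (z_ s) * cmvt m s) +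
      rr m * (pfac (odd m) m.-1 (z_ s) * cmvt m.-1 s).
    by apply/funext => t; exact: (dualt_cmv r1 alpha_r orf).
  by apply: cnice_add; apply: cnice_scale; apply: cnice_mul => //; exact: lip_nice (lip_pfac _ _).
have key m : ip (cmv m) g * cmv m s = l^-1 * ((-1) ^+ odd m *
     (kfac m l * v m + rr m * pfac (odd m) m l * v m.-1
     - rr m.+1 * pfac (~~ odd m) m l * v m.+1) * cmvt m s).
  have e0 := eta_neq0 r1 alpha_r m.
  transitivity (ip (fun s => eta m ^+ 2 * ((l - z_ s) * cmvt m s)) f * cmvt m s).
    have -> : ip (fun s => eta m ^+ 2 * ((l - z_ s) * cmvt m s)) f = eta m * ip (cmv m) g.
      rewrite -(ipZr mu _ (ncm m) ng) /ip; congr (cint _ _); apply/funext => t.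
      rewrite /cmvt /g /fz expr2 !(cjM, cjB, cjV) !(cj_eta r1 alpha_r).
      by field; rewrite e0 conjC_eq0 (bodd_neq0 r1 alpha_r).
    by rewrite /cmvt; field; exact: e0.
  have -> : (fun s => eta m ^+ 2 * ((l - z_ s) * cmvt m s)) = (fun s =>
      ((-1) ^+ odd m * (aa m * pfac (~~ odd m) m l + (aa m.+1)^* * pfac (odd m) m l)) * dualt m s +
      (((-1) ^+ odd m * (rr m * pfac (~~ odd m) m l)) * dualt m.-1 s +
      (- ((-1) ^+ odd m * (rr m.+1 * pfac (odd m) m l))) * dualt m.+1 s)).
    by apply/funext => t; rewrite (cmvt_expr r1 alpha_r orf); ring.
  have ns c j : cnice (fun s => c * dualt j s) by exact: cnice_scale (nd j).
  rewrite (ipDl _ nf (ns _ m) (cnice_add (ns _ m.-1) (ns _ m.+1))).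
  rewrite (ipDl _ nf (ns _ m.-1) (ns _ m.+1)).
  rewrite !(ipZl _ _ nf (nd _)) -!/(v _).
  have sg : ((-1) ^+ odd m)^* = (-1) ^+ odd m :> R[i].
    by case: (odd m); rewrite ?expr0 ?expr1 ?cjN ?cj1.
  rewrite /kfac !(cjN, cjM, cjD, conjCK) sg !(cj_rr orf) !cj_pfac // negbK.
  ring.
rewrite gE (eq_bigr _ (fun m _ => key m)) -mulr_sumr; congr (_ * _).
have := tridiagonal_exchange l v s M.+2.
by rewrite (dual_coef_tail (n := M.+3)) ?(dual_coef_tail (n := M.+2)) ?mulr0 ?mul0r ?addr0 //; lia.
Qed.

Lemma band_sum (x : nat -> R) n L : 0 <= x n ->
  \sum_(0 <= k < L | (n <= k.+2)%N && (k <= n.+2)%N) x n <= 5 * x n.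
Proof.
move=> x0; rewrite big_const_seq iter_addr_0 -[leLHS]mulr_natl ler_wpM2r // ler_nat.
rewrite -size_filter.
apply: (@leq_trans (size (iota (n - 2) 5))); last by rewrite size_iota.
apply: uniq_leq_size; first by rewrite filter_uniq // iota_uniq.
move=> k; rewrite mem_filter !mem_iota => /andP[/andP[h1 h2] _].
by apply/andP; split; lia.
Qed.

(** A Schur test: the Gram matrix has five nonzero diagonals, its entries are at most [e] wherever
    [v] can be nonzero, and [2 |v n| |v k|] is at most [|v n|^2 + |v k|^2]. *)
Lemma form_bound (l1 l2 : R[i]) (e : R) (N : nat) :
  cabs l1 = 1 -> cabs l2 = 1 -> 0 <= e ->
  (forall n k, (N <= n)%N -> (N <= k)%N -> cabs (ip (hrow l2 n) (hrow l1 k)) <= e) ->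
  (forall n, (n < N)%N -> v n = 0) ->
  cabs (cint mu (fun s => ((l2 - z_ s) * (l1 - z_ s)^*) * (cabs (f s) ^+ 2)%:C))
    <= 5 * e * (24 / (1 - r) * I).
Proof.
move=> h1 h2 e0 hgram hv.
pose L := M.+3.
have nh l m : cnice (hrow l m) by exact: (nice_hrow r1 alpha_r orf).
have -> : cint mu (fun s => ((l2 - z_ s) * (l1 - z_ s)^*) * (cabs (f s) ^+ 2)%:C) =
    \sum_(0 <= n < L) (l2^-1 * ((-1) ^+ odd n * v n))^* * \sum_(0 <= k < L) (l1^-1 * ((-1) ^+ odd k * v k)) *
      ip (hrow l2 n) (hrow l1 k).
  transitivity (ip (fun s => \sum_(0 <= n < L) (l2^-1 * ((-1) ^+ odd n * v n)) * hrow l2 n s)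
     (fun s => \sum_(0 <= k < L) (l1^-1 * ((-1) ^+ odd k * v k)) * hrow l1 k s)).
    rewrite /ip; congr (cint _ _); apply/funext => s.
    have E l : cabs l = 1 -> \sum_(0 <= n < L) (l^-1 * ((-1) ^+ odd n * v n)) * hrow l n s = (l - z_ s)^* * f s.
      by move=> hl; rewrite dual_expansion // mulr_sumr; apply: eq_bigr => n _; rewrite -!mulrA.
    by rewrite !E // cjM conjCK -mulJC; ring.
  rewrite ip_suml; last by move=> i _; exact: nh.
    by apply: eq_bigr => n _; rewrite ip_sumr //.
  by apply: cnice_sum => k _; exact: cnice_scale.
apply: le_trans (cabs_sum _ _ _) _.
pose x n := cabs (v n) ^+ 2.
have x0 n : 0 <= x n by exact: sqr_ge0.
apply: le_trans (_ : _ <= \sum_(0 <= n < L) \sum_(0 <= k < L | (n <= k.+2)%N && (k <= n.+2)%N) e / 2 * (x n + x k)) _.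
  apply: ler_sum => n _.
  rewrite cabsM cabsJ cabsM cabsV h2 invr1 mul1r cabsM cabsX cabsN cabs1 expr1n mul1r.
  apply: le_trans (ler_wpM2l (cabs_ge0 _) (cabs_sum _ _ _)) _.
  rewrite mulr_sumr [leRHS]big_mkcond; apply: ler_sum => k _.
  rewrite !cabsM cabsV h1 invr1 mul1r cabsX cabsN cabs1 expr1n mul1r.
  have [nN|Nn] := ltnP n N.
    rewrite (hv n nN) cabs0 mul0r; case: ifP => // _.
    by rewrite mulr_ge0 ?addr_ge0 // divr_ge0.
  have [kN|Nk] := ltnP k N.
    rewrite (hv k kN) cabs0 mul0r mulr0; case: ifP => // _.
    by rewrite mulr_ge0 ?addr_ge0 // divr_ge0.
  case: ifP => [_|/negbT]; last first.
    rewrite negb_and -!ltnNge => /orP[hf|hf].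
      by rewrite -(ipC mu (nh _ _) (nh _ _)) (gram_far r1 alpha_r orf) // cj0 cabs0 !mulr0.
    by rewrite (gram_far r1 alpha_r orf) // cabs0 !mulr0.
  have h := hgram n k Nn Nk.
  have : cabs (v n) * (cabs (v k) * cabs (ip (hrow l2 n) (hrow l1 k))) <= cabs (v n) * (cabs (v k) * e).
    by rewrite !ler_wpM2l ?cabs_ge0.
  move=> /le_trans; apply; rewrite /x.
  have -> : e / 2 * (cabs (v n) ^+ 2 + cabs (v k) ^+ 2) =
    cabs (v n) * (cabs (v k) * e) + e * (cabs (v n) - cabs (v k)) ^+ 2 / 2 by field.
  by rewrite lerDl divr_ge0 // mulr_ge0 // sqr_ge0.
have sumle (y : nat -> R) : (forall n, 0 <= y n) -> \sum_(0 <= n < L) \sum_(0 <= k < L | (n <= k.+2)%N && (k <= n.+2)%N) y n <= 5 * \sum_(0 <= n < L) y n.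
  by move=> y0; rewrite mulr_sumr; apply: ler_sum => n _; exact: band_sum.
have -> : \sum_(0 <= n < L) \sum_(0 <= k < L | (n <= k.+2)%N && (k <= n.+2)%N) e / 2 * (x n + x k) =
   e / 2 * (\sum_(0 <= n < L) \sum_(0 <= k < L | (n <= k.+2)%N && (k <= n.+2)%N) x n +
     \sum_(0 <= n < L) \sum_(0 <= k < L | (n <= k.+2)%N && (k <= n.+2)%N) x n).
  under eq_bigr do rewrite -mulr_sumr big_split /=.
  rewrite -mulr_sumr big_split /=; congr (_ * (_ + _)).
  rewrite (exchange_big_dep xpredT) //=; apply: eq_bigr => n _.
  by apply: eq_bigl => k; rewrite andbC.
have := sumle x x0; have := dual_coef_sum L; rewrite -/x => hs hx.
have e5 : 0 <= 5 * e by rewrite mulr_ge0.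
have := ler_wpM2l e5 hs; have := ler_wpM2l e0 hx; rewrite /x; lra.
Qed.

End FormBound.

(** * Test functions concentrated at an accumulation point *)

Lemma limit_point_seq (R : realType) (S : set (circle R)) (x0 : circle R) (d : R) (n : nat) :
  limit_point S x0 -> 0 < d ->
  exists l : seq (circle R), [/\ size l = n, uniq l &
    forall t, t \in l -> S t /\ cdist x0 t < d].
Proof.
move=> hx d0.
(* With a lower bound [e] for the distances so far, the next point can be taken closer to [x0] and
   is therefore new. *)
suff [l [e [e0 sl ul hl]]] : exists (l : seq (circle R)) (e : R),
    [/\ 0 < e, size l = n, uniq l & forall t, t \in l -> [/\ S t, cdist x0 t < d & e <= cdist x0 t]].
  by exists l; split=> // t /hl[].
elim: n => [|n [l [e [e0 sl ul hl]]]]; first by exists [::], 1; split.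
have de0 : 0 < Num.min d e by rewrite lt_min d0 e0.
have /hx[t [tx St]] : nbhs x0 [set t | cdist x0 t < Num.min d e].
  by apply/nbhs_circleP; exists (Num.min d e).
rewrite /= lt_min => /andP[td te].
exists (t :: l), (Num.min e (cdist x0 t)); split.
- by rewrite lt_min e0 /= cdist_neq0 // eq_sym.
- by rewrite /= sl.
- by rewrite /= ul andbT; apply/negP => /hl[_ _]; rewrite leNgt te.
- move=> u; rewrite in_cons => /orP[/eqP ->|/hl[Su ud eu]].
    by split; rewrite // ge_min lexx orbT.
  by split; rewrite // ge_min eu.
Qed.

(** [N] linear equations in [N.+1] unknowns; the solution is scaled to the normalization of
    [independent_lower_bound]. *)
Lemma kernel_vector (R : realType) (N : nat) (V : nat -> nat -> R[i]) :
  exists t : nat -> R[i], \sum_(0 <= i < N.+1) cabs (t i) = 1 /\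
    forall k, (k < N)%N -> \sum_(0 <= i < N.+1) t i * V k i = 0.
Proof.
pose A := \matrix_(i < N.+1, k < N) V k i.
have : kermx A != 0.
  by rewrite -mxrank_eq0 mxrank_ker -lt0n subn_gt0 ltnS rank_leq_col.
case/rowV0Pn => u /sub_kermxP uA u0.
pose S := \sum_(i < N.+1) cabs (u 0 i).
have S0 : 0 < S.
  have [i ui] : exists i, u 0 i != 0 by apply/rV0Pn.
  rewrite /S (bigD1 i) //= ltr_wpDr ?cabs_gt0 // sumr_ge0 // => j _; exact: cabs_ge0.
exists (fun i => u 0 (inord i) / S%:C); split.
  rewrite big_mkord (eq_bigr (fun i : 'I_N.+1 => cabs (u 0 i) / S)); last first.
    by move=> i _; rewrite inord_val cabsM cabsV cabsR gtr0_norm.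
  by rewrite -mulr_suml divff // gt_eqF.
move=> k kN; rewrite big_mkord.
have /matrixP/(_ 0 (Ordinal kN)) := uA; rewrite !mxE => e.
transitivity ((\sum_j u 0 j * A j (Ordinal kN)) / S%:C); last by rewrite e mul0r.
rewrite mulr_suml; apply: eq_bigr => i _; rewrite !mxE inord_val /=; ring.
Qed.

Section Zeros.
Variables (R : realType) (alpha : nat -> R[i]) (r : R).
Hypotheses (r1 : r < 1) (alpha_r : forall n, cabs (alpha n) <= r).
Notation inW := (inW alpha).
Notation z_ := (@circle_val R).

Lemma inW_poly N f : inW N f -> exists p : {poly R[i]}, forall s,
  f s * \prod_(1 <= k < N.+1) varpi alpha k (z_ s) = p.[z_ s].
Proof.
move=> [c hc].
pose q k : {poly R[i]} := \prod_(1 <= j < N.+1)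
  (if (j <= k)%N then 'X - (alpha j)%:P else 1 - (alpha j)^* *: 'X).
exists (\sum_(0 <= k < N.+1) c k *: q k) => s.
rewrite hc mulr_suml horner_sum; apply: eq_big_nat => k /andP[_ kN].
rewrite hornerZ -mulrA; congr (_ * _).
have -> : cbl alpha k s = \prod_(1 <= j < N.+1) (if (j <= k)%N then zeta alpha j (z_ s) else 1).
  rewrite -big_mkcond /= /cbl /blaschke [RHS](big_cat_nat (n := k.+1)) //=.
  rewrite [X in _ * X]big_nat_cond [X in _ * X]big_pred0 ?mulr1; last first.
    by move=> j; apply/negP => /andP[/andP[h1 _] h2]; lia.
  rewrite [RHS]big_nat_cond [LHS]big_nat_cond; apply: eq_bigl => j.
  by apply/idP/idP; lia.
rewrite -big_split /= horner_prod; apply: eq_bigr => j _.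
have h := pfac_neq0 r1 alpha_r false j (cabs_circle s).
case: ifP => _; first by rewrite /zeta divfK // hornerXsubC.
by rewrite mul1r !hornerE.
Qed.

Lemma inW_zero N f : inW N f ->
  (forall n, exists l : seq (circle R), [/\ size l = n, uniq l & forall t, t \in l -> f t = 0]) ->
  forall s, f s = 0.
Proof.
move=> /inW_poly[p hp] hl s.
have p0 : p = 0.
  apply/eqP/negPn/negP => pn0; have [l [sl ul h]] := hl (size p).
  have := @max_poly_roots _ p (map (@circle_val R) l) pn0.
  rewrite size_map sl ltnn => H; suff : false by []. apply: H.
    apply/allP => _ /mapP[t tl ->]; rewrite rootE -hp h ?mul0r //.
  by rewrite map_inj_uniq //; exact: val_inj.
have := hp s; rewrite p0 horner0 => /eqP; rewrite mulf_eq0 => /orP[/eqP //|].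
suff /negbTE -> : \prod_(1 <= k < N.+1) varpi alpha k (z_ s) != 0 by [].
apply: (big_ind (fun x => x != 0)) => [|x y|k _].
- exact: oner_neq0.
- exact: mulf_neq0.
- exact: (pfac_neq0 r1 alpha_r false) (cabs_circle s).
Qed.

End Zeros.

(** The Gram matrix is invertible, so [t] is recovered from the inner products of the combination
    with the [e i]; a small combination would force small coefficients. This makes [c] explicit. *)
Lemma independent_lower_bound (R : realType) (mu : probability (borel_circle R) R)
    (N : nat) (e : nat -> circle R -> R[i]) :
  (forall i, cnice (e i)) ->
  (forall t : nat -> R[i],
    rint mu (fun s => cabs (\sum_(0 <= i < N.+1) t i * e i s) ^+ 2) = 0 ->
    forall i, (i <= N)%N -> t i = 0) ->
  exists2 c : R, 0 < c & forall t : nat -> R[i], \sum_(0 <= i < N.+1) cabs (t i) = 1 ->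
    c <= rint mu (fun s => cabs (\sum_(0 <= i < N.+1) t i * e i s) ^+ 2).
Proof.
move=> ne indep; have lo (i : 'I_N.+1) : (i <= N)%N by rewrite -ltnS.
pose g t s := \sum_(0 <= i < N.+1) t i * e i s.
have ng t : cnice (g t) by apply: cnice_sum => i _; exact: cnice_scale.
pose G := \matrix_(k < N.+1, i < N.+1) ip mu (e i) (e k).
have yE t i : (i <= N)%N -> ip mu (e i) (g t) = \sum_(k < N.+1) t k * G k (inord i).
  move=> iN; rewrite ip_sumr // big_mkord; apply: eq_bigr => k _.
  by rewrite mxE inordK.
have Gu : G \in unitmx.
  rewrite -row_free_unit -kermx_eq0; apply/negPn/negP => /rowV0Pn[u /sub_kermxP uG].
  apply/negP; rewrite negbK; apply/eqP/rowP => j; rewrite mxE.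
  pose t i := u 0 (inord i).
  have -> : u 0 j = t j by rewrite /t inord_val.
  apply: (indep t); last by rewrite -ltnS.
  apply: complexI; rewrite -ip_norm -/(g t).
  rewrite {1}/g ip_suml // big1_seq // => i; rewrite mem_index_iota => /andP[_ /andP[_ iN]].
  rewrite yE //; have /matrixP/(_ 0 (inord i)) := uG; rewrite !mxE => E.
  transitivity ((t i)^* * 0); last by rewrite mulr0.
  by congr (_ * _); rewrite -[RHS]E; apply: eq_bigr => k _; rewrite /t inord_val.
pose H := invmx G.
have tE t k : (k <= N)%N -> t k = \sum_(i < N.+1) ip mu (e i) (g t) * H i (inord k).
  move=> kN; pose u : 'rV_N.+1 := \row_i t i.
  have : u *m G *m H = u by rewrite mulmxK.
  move=> /rowP /(_ (inord k)); rewrite !mxE inordK // => {1}<-.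
  apply: eq_bigr => i _; rewrite mxE (yE t i (lo i)); congr (_ * _).
  by apply: eq_bigr => j _; rewrite !mxE inordK.
pose D : R := 1 + \sum_(k < N.+1) \sum_(i < N.+1) cabs (H i k).
have HD : 0 <= \sum_(k < N.+1) \sum_(i < N.+1) cabs (H i k).
  by apply: sumr_ge0 => k _; apply: sumr_ge0 => i _; exact: cabs_ge0.
have D0 : 0 < D by rewrite /D; lra.
pose P := \sum_(i < N.+1) rint mu (fun s => cabs (e i s) ^+ 2).
have r0 i : 0 <= rint mu (fun s => cabs (e i s) ^+ 2) by apply: rint_ge0 => s; exact: sqr_ge0.
have P0 : 0 <= P by exact: sumr_ge0.
(* The weight in [x y <= lam x^2 + y^2 / (4 lam)], small enough that the norms of the [e i] account
   for at most half of the total 1. *)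
pose lam : R := (4 * D * (P + 1))^-1.
have lam0 : 0 < lam by rewrite invr_gt0 !mulr_gt0 //; lra.
exists (lam / D) => [|t t1]; first exact: divr_gt0.
rewrite -/(g t); set X := rint _ _.
have y_bound i : (i <= N)%N -> cabs (ip mu (e i) (g t)) <= 2 * (lam * P + X / (4 * lam)).
  move=> iN; have nn := rnice_cabs_sq (ne i); have ngg := rnice_cabs_sq (ng t).
  have nb1 : rnice (fun s => lam * cabs (e i s) ^+ 2) by exact: rnice_mul (rnice_cst _) nn.
  have nb2 : rnice (fun s => (4 * lam)^-1 * cabs (g t s) ^+ 2) by exact: rnice_mul (rnice_cst _) ngg.
  apply: le_trans (cabs_cint mu (cnice_ip (ne i) (ng t)) (rnice_add nb1 nb2) _) _.
    move=> s; rewrite cabsM cabsJ.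
    have -> : lam * cabs (e i s) ^+ 2 + (4 * lam)^-1 * cabs (g t s) ^+ 2 =
      cabs (e i s) * cabs (g t s) + (4 * lam)^-1 * (2 * lam * cabs (e i s) - cabs (g t s)) ^+ 2.
      by field; rewrite gt_eqF.
    by rewrite lerDl mulr_ge0 ?sqr_ge0 // invr_ge0 mulr_ge0 // ltW.
  rewrite (rintD mu nb1 nb2) (rintZ mu _ nn) (rintZ mu _ ngg) -/X.
  rewrite ler_wpM2l // lerD //; last by rewrite mulrC.
  rewrite ler_wpM2l ?(ltW lam0) // /P (bigD1 (inord i)) //= inordK // lerDl.
  by apply: sumr_ge0 => k _.
set Y := 2 * _ in y_bound.
have Y0 : 0 <= Y by apply: le_trans (y_bound 0%N _); rewrite ?cabs_ge0.
have : 1 <= (D - 1) * Y.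
  rewrite -[leLHS]t1 big_mkord /D addrAC subrr add0r mulr_suml; apply: ler_sum => k _.
  rewrite {1}(tE t k (lo k)); apply: le_trans (cabs_sum _ _ _) _.
  rewrite mulr_suml; apply: ler_sum => i _; rewrite cabsM inord_val mulrC.
  by apply: ler_wpM2l; rewrite ?cabs_ge0 // y_bound.
have h1 : D * (2 * (lam * P)) <= 1 / 2.
  have -> : D * (2 * (lam * P)) = (P / (P + 1)) / 2.
    by rewrite /lam; field; rewrite (gt_eqF D0) gt_eqF //; lra.
  by rewrite ler_pM2r ?invr_gt0 // ler_pdivrMr; lra.
have h2 : (D - 1) * Y <= D * Y by rewrite ler_wpM2r //; lra.
have -> : X = (D * (2 * (X / (4 * lam)))) * (2 * lam / D).
  by field; rewrite !gt_eqF.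
move=> h3; have : 1 / 2 <= D * (2 * (X / (4 * lam))) by move: h1 h2 h3; rewrite /Y; lra.
move=> h4; have -> : lam / D = 1 / 2 * (2 * lam / D) by field; rewrite gt_eqF.
by rewrite ler_wpM2r // divr_ge0 ?mulr_ge0 ?(ltW lam0) ?(ltW D0).
Qed.

Section Peaks.
Variables (R : realType) (alpha : nat -> R[i]) (r : R).
Hypotheses (r1 : r < 1) (alpha_r : forall n, cabs (alpha n) <= r).
Notation inW := (inW alpha).
Notation zt := (zt alpha).
Notation z_ := (@circle_val R).
Variable x0 : circle R.

(* Of modulus at most 1, with equality only at [x0]. *)
Definition peak k (s : circle R) : R[i] := (1 + (zt k x0)^* * zt k s) / 2.

(** The parallelogram law for 1 and the unimodular number [w]. *)
Lemma cabs_peak k s : cabs (peak k s) ^+ 2 = 1 - cabs (zt k s - zt k x0) ^+ 2 / 4.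
Proof.
have h0 : cabs (zt k x0) = 1 by exact: (cabs_zeta r1 alpha_r) (cabs_circle x0).
have hs : cabs (zt k s) = 1 by exact: (cabs_zeta r1 alpha_r) (cabs_circle s).
set w := (zt k x0)^* * zt k s.
have hw : cabs w = 1 by rewrite cabsM cabsJ h0 hs mul1r.
have -> : cabs (zt k s - zt k x0) = cabs (1 - w).
  rewrite -[LHS]mul1r -h0 -(cabsJ (zt k x0)) -cabsM mulrBr mulJC h0 expr1n -/w.
  by rewrite cabs_distC.
have par : cabs (1 + w) ^+ 2 + cabs (1 - w) ^+ 2 = 2 + 2 * cabs w ^+ 2.
  rewrite !cabs_sq; case: (w) => x y /=; ring.
have -> : cabs (peak k s) ^+ 2 = cabs (1 + w) ^+ 2 / 4.
  rewrite /peak cabsM cabsV -/w exprMn.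
  have -> : cabs (2 : R[i]) = 2 by rewrite -[2](rmorph_nat (real_complex R)) cabsR normr_nat.
  by field.
by move: par; rewrite hw expr1n mulr1; lra.
Qed.

Lemma zeta_sub k s t : zt k s - zt k t =
  eta alpha k ^+ 2 * (z_ s - z_ t) / (varpi alpha k (z_ s) * varpi alpha k (z_ t)).
Proof.
have := pfac_neq0 r1 alpha_r false k (cabs_circle s).
have := pfac_neq0 r1 alpha_r false k (cabs_circle t).
rewrite eta_sqE /zt /zeta /pfac /varpi /varpis => h1 h2.
by field; rewrite h1 h2.
Qed.

Lemma cabs_zeta_sub k s t : cabs (zt k s - zt k t) =
  cabs (eta alpha k) ^+ 2 * cdist s t *
  (cabs (varpi alpha k (z_ s)) * cabs (varpi alpha k (z_ t)))^-1.
Proof.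
rewrite zeta_sub cabsM cabsV (cabsM (varpi _ _ _)) (cabsM (_ ^+ 2)); congr (_ * _ / _).
exact: cabsX.
Qed.

(** Together with [zeta_dist_upper]: the maps [zeta k] are bi-Lipschitz on the circle with constants
    independent of [k], so one estimate serves all factors of [peaks]. *)
Lemma zeta_dist_lower k s t : (1 - r) / 4 * cdist s t <= cabs (zt k s - zt k t).
Proof.
rewrite cabs_zeta_sub [leRHS]mulrAC ler_wpM2r ?cabs_ge0 //.
have h b := pfac_upper r1 alpha_r false k (cabs_circle b).
have l b := lt_le_trans (_ : 0 < 1 - r) (pfac_lower alpha_r false k (cabs_circle b)).
have {}l b : 0 < cabs (varpi alpha k (z_ b)) by apply: l; rewrite subr_gt0.
apply: ler_pM; rewrite ?invr_ge0 ?subr_ge0 ?(ltW r1) //.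
  exact: (eta_sq_lower r1 alpha_r).
rewrite lef_pV2 ?posrE ?mulr_gt0 //.
have -> : 4 = 2 * 2 :> R by ring.
by apply: ler_pM; rewrite ?cabs_ge0 //; exact: h.
Qed.

Lemma zeta_dist_upper k s t : cabs (zt k s - zt k t) <= cdist s t / (1 - r) ^+ 2.
Proof.
have r0 : 0 < 1 - r by rewrite subr_gt0.
rewrite cabs_zeta_sub.
have l b := pfac_lower alpha_r false k (cabs_circle b).
have lp b : 0 < cabs (varpi alpha k (z_ b)) := lt_le_trans r0 (l b).
apply: ler_pM; rewrite ?invr_ge0 ?mulr_ge0 ?sqr_ge0 ?cabs_ge0 //.
  rewrite -[leRHS]mul1r ler_wpM2r ?cabs_ge0 // (cabs_eta_sq r1 alpha_r).
  by have := sqr_ge0 (cabs (alpha k)); lra.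
rewrite lef_pV2 ?posrE ?mulr_gt0 ?exprn_gt0 // expr2.
by apply: ler_pM; rewrite ?(ltW r0) ?l.
Qed.

(** The indices start after [N], so that each factor uses one new pole and multiplication maps
    [inW N] into [inW (N + n)]. *)
Definition peaks N n (s : circle R) : R[i] := \prod_(0 <= j < n) peak (N + j).+1 s.

Lemma peaksS N n s : peaks N n.+1 s = peaks N n s * peak (N + n).+1 s.
Proof. by rewrite /peaks big_nat_recr. Qed.

Lemma inW_peaks N n g : inW N g -> inW (N + n)%N (fun s => peaks N n s * g s).
Proof.
move=> hg; elim: n => [|n IH].
  by rewrite addn0; apply: (inW_ext _ hg) => s; rewrite /peaks big_geq // mul1r.
rewrite addnS.
apply: (inW_ext _ (inW_add (inW_scale 2^-1 (inW_mono (leqnSn _) IH))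
  (inW_scale ((zt (N + n).+1 x0)^* / 2) (inW_zeta r1 alpha_r IH)))) => s.
by rewrite peaksS /peak /zt; ring.
Qed.

Lemma peaks_upper N n s q : (forall k, cabs (peak k s) ^+ 2 <= q) ->
  cabs (peaks N n s) ^+ 2 <= q ^+ n.
Proof.
move=> h; elim: n => [|n IH]; first by rewrite /peaks big_geq // cabs1 expr1n expr0.
by rewrite peaksS cabsM exprMn [q ^+ _]exprSr ler_pM ?sqr_ge0.
Qed.

Lemma peaks_lower N n s q : 0 <= q -> (forall k, q <= cabs (peak k s) ^+ 2) ->
  q ^+ n <= cabs (peaks N n s) ^+ 2.
Proof.
move=> q0 h; elim: n => [|n IH]; first by rewrite /peaks big_geq // cabs1 expr1n expr0.
by rewrite peaksS cabsM exprMn [q ^+ _]exprSr ler_pM ?exprn_ge0.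
Qed.

(** [1 / varpi] equals [(1 + alpha^* zeta) / eta^2]; likewise [z / varpi] equals
    [(alpha + zeta) / eta^2] in the lemma that follows. *)
Lemma inW_invvarpi M h : inW M h -> inW M.+1 (fun s => (varpi alpha M.+1 (z_ s))^-1 * h s).
Proof.
move=> hh; apply: (inW_ext _ (inW_add (inW_scale (eta alpha M.+1 ^- 2) (inW_mono (leqnSn _) hh))
  (inW_scale ((alpha M.+1)^* / eta alpha M.+1 ^+ 2) (inW_zeta r1 alpha_r hh)))) => s.
have := pfac_neq0 r1 alpha_r false M.+1 (cabs_circle s).
have := expf_neq0 2 (eta_neq0 r1 alpha_r M.+1); rewrite eta_sqE.
rewrite /zeta /pfac /varpi /varpis => h1 h2.
by field; rewrite h1 h2.
Qed.

Lemma inW_zvarpi M h : inW M h ->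
  inW M.+1 (fun s => z_ s / varpi alpha M.+1 (z_ s) * h s).
Proof.
move=> hh; apply: (inW_ext _ (inW_add (inW_scale (alpha M.+1 / eta alpha M.+1 ^+ 2) (inW_mono (leqnSn _) hh))
  (inW_scale (eta alpha M.+1 ^- 2) (inW_zeta r1 alpha_r hh)))) => s.
have := pfac_neq0 r1 alpha_r false M.+1 (cabs_circle s).
have := expf_neq0 2 (eta_neq0 r1 alpha_r M.+1); rewrite eta_sqE.
rewrite /zeta /pfac /varpi /varpis => h1 h2.
by field; rewrite h1 h2.
Qed.

End Peaks.

(** * The quadratic form on concentrated functions *)

Section Sufficiency.
Variables (R : realType) (mu : probability (borel_circle R) R).
Variables (alpha : nat -> R[i]) (r : R).
Hypotheses (r1 : r < 1) (alpha_r : forall n, cabs (alpha n) <= r).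
Variables (a : nat -> R[i]) (phi : nat -> R[i] -> R[i]).
Hypothesis (orf : orf_with alpha a mu phi).
Notation ip := (ip mu).
Notation rint := (rint mu).
Notation hrow := (hrow alpha a phi).
Notation dualt := (dualt alpha phi).
Notation bodd := (bodd alpha).
Notation orp := (orp phi).
Notation inW := (inW alpha).
Notation z_ := (@circle_val R).
Variable x0 : circle R.

Definition cball (d : R) : set (circle R) := [set s | cdist x0 s < d].

Lemma nice_cball d : rnice (\1_(cball d)).
Proof. exact: rnice_indic (measurable_open (open_cball _ _)). Qed.

Definition loc d i (s : circle R) : R[i] := ((\1_(cball d) : circle R -> R) s)%:C * orp i s.

Lemma nice_loc d i : cnice (loc d i).
Proof.
apply: cnice_mul; first exact: cnice_real (nice_cball d).
exact: (nice_orp r1 alpha_r orf).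
Qed.

(** By continuity a combination of zero norm vanishes at every point of the support in the ball.
    There are infinitely many of these, and a nonzero rational function has finitely many zeros. *)
Lemma loc_independent d N : limit_point (supp mu) x0 -> 0 < d ->
  forall t : nat -> R[i],
    rint (fun s => cabs (\sum_(0 <= i < N.+1) t i * loc d i s) ^+ 2) = 0 ->
    forall i, (i <= N)%N -> t i = 0.
Proof.
move=> hx d0 t; pose g s := \sum_(0 <= i < N.+1) t i * orp i s.
have gE s : \sum_(0 <= i < N.+1) t i * loc d i s = ((\1_(cball d) : circle R -> R) s)%:C * g s.
  by rewrite /g mulr_sumr; apply: eq_bigr => i _; rewrite /loc mulrCA.
have Wg : inW N g.
  apply: inW_sum => i; rewrite mem_index_iota ltnS => /andP[_ iN].
  exact: (inW_mono iN (inW_orp orf i)).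
have ng := inW_nice r1 alpha_r Wg.
set u := fun s => _ => u0.
have nu : rnice u.
  apply: rnice_cabs_sq; apply: cnice_sum => i _; apply: cnice_scale; exact: nice_loc.
have gz s : supp mu s -> cball d s -> g s = 0.
  move=> ss sd; apply/eqP/negPn/negP; rewrite -cabs_gt0 => gs0.
  have [C C0 hC] := inW_lip r1 alpha_r Wg.
  pose e := Num.min (d - cdist x0 s) (cabs (g s) / (2 * (C + 1))).
  have C1 : 0 < C + 1 by lra.
  have e0 : 0 < e by rewrite lt_min subr_gt0 sd divr_gt0 // mulr_gt0.
  pose U := [set t | cdist s t < e].
  have oU : open U by exact: open_cball.
  have mU : (0 < mu U)%E by apply: ss; rewrite // /U /= cdistxx.
  have nU : rnice (\1_U) by exact: rnice_indic (measurable_open oU).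
  have : (cabs (g s) / 2) ^+ 2 * fine (mu U) <= 0.
    rewrite -u0 -(rint_indic mu (measurable_open oU)) -(rintZ mu _ nU).
    apply: le_rint => //; first exact: rnice_mul (rnice_cst _) nU.
    move=> w; rewrite indicE; have [wU|nw] := boolP (w \in U); last first.
      by rewrite mulr0 /u sqr_ge0.
    rewrite mulr1 /u gE; move: wU; rewrite inE /U /= lt_min => /andP[w1 w2].
    have wd : cball d w by have := cdistD s x0 w; rewrite /cball /=; lra.
    rewrite indicE mem_set // mul1r ler_pXn2r ?nnegrE ?divr_ge0 ?cabs_ge0 //.
    have h1 := hC s w; have h2 := cabs_sub (g s) (g s - g w).
    have h3 : g s - (g s - g w) = g w by ring.
    have h4 : C * cdist s w <= (C + 1) * cdist s w by rewrite ler_wpM2r ?cabs_ge0 //; lra.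
    have h5 : (C + 1) * cdist s w <= cabs (g s) / 2.
      have -> : cabs (g s) / 2 = (C + 1) * (cabs (g s) / (2 * (C + 1))) by field; rewrite gt_eqF.
      by rewrite ler_wpM2l // ltW.
    rewrite h3 in h2; lra.
  apply/negP; rewrite -ltNge mulr_gt0 ?exprn_gt0 ?divr_gt0 //.
  apply: fine_gt0; rewrite mU /=; apply: le_lt_trans (probability_le1 mu _) (ltry _).
  exact: measurable_open.
have g0 s : g s = 0.
  apply: (inW_zero r1 alpha_r Wg) => n.
  have [l [sl ul hl]] := limit_point_seq n hx d0.
  by exists l; split => // w /hl[]; exact: gz.
move=> i iN; have : ip (orp i) g = t i.
  rewrite ip_sumr; [|exact: (nice_orp r1 alpha_r orf)|by move=> *; exact: (nice_orp r1 alpha_r orf)].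
  rewrite (bigD1_seq i) ?mem_index_iota ?iota_uniq //= (orp_orth orf) eqxx mulr1 big1 ?addr0 // => j ji.
  by rewrite (orp_orth orf) eq_sym (negbTE ji) mulr0.
move=> <-; have -> : g = fun=> 0 by apply/funext.
rewrite /ip; under eq_fun do rewrite mulr0.
by rewrite (cint_real mu (fun=> 0)) rint_cst.
Qed.

Variables (l1 l2 : circle R).
Let G s : R[i] := (z_ l2 - z_ s) * (z_ l1 - z_ s)^*.

Lemma geometric_small (q K : R) : 0 <= q -> q < 1 -> exists n, q ^+ n * K <= 1.
Proof.
move=> q0 q1.
have K0 : 0 < `|K| + 1 by rewrite ltr_wpDl.
have qn : `|q| < 1 by rewrite ger0_norm.
have Ki : 0 < (`|K| + 1)^-1 by rewrite invr_gt0.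
have /cvgrPdist_lt /(_ _ Ki)[n _ /(_ n (leqnn n))] := cvg_expr qn.
rewrite /= sub0r normrN ger0_norm ?exprn_ge0 // => h; exists n.
apply: le_trans (_ : q ^+ n * (`|K| + 1) <= 1).
  by rewrite ler_wpM2l ?exprn_ge0 //; have := ler_norm K; lra.
by rewrite -ler_pdivlMr // div1r ltW.
Qed.

Lemma gram_small_isolated :
  (forall e : R, 0 < e -> exists N, forall n k, (N <= n)%N -> (N <= k)%N ->
     cabs (ip (hrow (z_ l2) n) (hrow (z_ l1) k)) <= e) ->
  limit_point (supp mu) x0 -> x0 = l1 \/ x0 = l2.
Proof.
move=> hgram hx; apply: contrapT => /not_orP[n1 n2].
pose c := cabs (G x0).
have c0 : 0 < c.
  by rewrite /c cabsM cabsJ mulr_gt0 // -/(cdist _ _) cdist_neq0 // eq_sym; apply/eqP.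
have r0 : 0 < 1 - r by rewrite subr_gt0.
have c4 : c <= 4.
  rewrite /c cabsM cabsJ (_ : 4 = 2 * 2); last by ring.
  by apply: ler_pM; rewrite ?cabs_ge0 //; exact: cdist_le2.
(* [|G s - G x0|] is at most 4 times the distance to [x0], hence at most [c / 8] on this ball. *)
pose d := c / 32; have d0 : 0 < d by rewrite divr_gt0.
(* On this smaller ball every [zeta k] differs from its value at [x0] by at most half the difference
   guaranteed outside of [cball d]; this opens the gap [qI < qJ]. *)
pose dJ := (1 - r) / 8 * d * (1 - r) ^+ 2.
have dJ0 : 0 < dJ by rewrite !mulr_gt0 ?exprn_gt0 // divr_gt0.
pose qI := 1 - ((1 - r) / 4 * d) ^+ 2 / 4.
pose qJ := 1 - ((1 - r) / 8 * d) ^+ 2 / 4.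
have r00 := r_ge0 alpha_r.
have k1 : 0 < (1 - r) / 4 * d by rewrite mulr_gt0 // divr_gt0.
have k2 : (1 - r) / 4 * d <= 1.
  rewrite -[leRHS]mulr1; apply: ler_pM; rewrite ?(ltW d0) ?divr_ge0 ?(ltW r0) //; first by lra.
  by rewrite /d; lra.
have kk : (1 - r) / 8 * d = ((1 - r) / 4 * d) / 2 by field.
have qI0 : 0 < qI.
  have : ((1 - r) / 4 * d) ^+ 2 <= 1 by rewrite expr_le1 // ltW.
  by rewrite /qI; lra.
have qIJ : qI < qJ.
  rewrite /qI /qJ kk expr_div_n; have := exprn_gt0 2 k1; lra.
have outP k s : ~ cball d s -> cabs (peak alpha x0 k s) ^+ 2 <= qI.
  move=> /negP; rewrite -leNgt => ds; rewrite (cabs_peak r1 alpha_r) /qI.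
  have h := zeta_dist_lower r1 alpha_r k s x0.
  have : ((1 - r) / 4 * d) ^+ 2 <= cabs (zt alpha k s - zt alpha k x0) ^+ 2; last by lra.
  rewrite ler_pXn2r ?nnegrE ?cabs_ge0 ?(ltW k1) //; apply: le_trans h.
  by rewrite cdistC ler_wpM2l // divr_ge0 // ltW.
have inP k s : cball dJ s -> qJ <= cabs (peak alpha x0 k s) ^+ 2.
  move=> ds; rewrite (cabs_peak r1 alpha_r) /qJ.
  have h := zeta_dist_upper r1 alpha_r k s x0.
  have : cabs (zt alpha k s - zt alpha k x0) ^+ 2 <= ((1 - r) / 8 * d) ^+ 2; last by lra.
  rewrite ler_pXn2r ?nnegrE ?cabs_ge0 //; last by rewrite kk divr_ge0 // ltW.
  apply: le_trans h _; rewrite ler_pdivrMr ?exprn_gt0 // cdistC.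
  exact: ltW ds.
(* As [5 * 24 / 960 = 1 / 8], [form_bound] will give [c / 8 * I]; with the error [c / 2 * I] this
   stays below [c * I]. *)
have [N hN] := hgram (c / (960 / (1 - r))) (divr_gt0 c0 (divr_gt0 (ltr0n _ 960) r0)).
(* Uniform in the coefficients: [n] is chosen from [cJ], and only then [t], whose equations involve
   the [n] peaks. *)
have [cJ cJ0 hJ] := independent_lower_bound (nice_loc dJ) (loc_independent (N := N) hx dJ0).
have /boolp.choice[B hB] : forall i, exists B : R, forall s, cabs (orp i s) <= B.
  by move=> i; have [B _ h] := lip_bounded (inW_lip r1 alpha_r (inW_orp orf i)); exists B.
have B0 i : 0 <= B i := le_trans (cabs_ge0 _) (hB i x0).
pose P := \sum_(0 <= i < N.+1) B i.
have P0 : 0 <= P by apply: sumr_ge0.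
have qJ0 : 0 < qJ := lt_trans qI0 qIJ.
have q1 : qI / qJ < 1 by rewrite ltr_pdivrMr ?mul1r.
(* Makes the part of the integral outside of [cball d], bounded by
   [qI ^+ n * (P ^+ 2 / (1 - r) ^+ 2)], at most [c / 64] times the lower bound [qJ ^+ n / 4 * cJ] of
   [I]. *)
have [n hn] := geometric_small (P ^+ 2 / (1 - r) ^+ 2 * 256 / (c * cJ))
  (divr_ge0 (ltW qI0) (ltW qJ0)) q1.
pose M := (N + n).+1.
(* With [z / varpi M], both [f] and its product with the conjugate of [z] have poles of the allowed
   kind only; [bodd M] cancels in the hypotheses of [form_bound]. *)
pose mult s := z_ s / varpi alpha M (z_ s) * peaks alpha x0 N n s / bodd M s.
have nmult : cnice mult.
  apply: cnice_mul; last exact: lip_nice (lip_bodd_inv r1 alpha_r M).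
  apply: cnice_mul.
    by apply: cnice_mul; [exact: lip_nice (lip_val R)|exact: lip_nice (lip_invvarpi r1 alpha_r M)].
  have h1 : inW N (fun=> 1).
    apply: (inW_ext _ (inW_cbl alpha (leq0n N))) => s; exact: cbl0.
  apply: (inW_nice r1 alpha_r (n := (N + n)%N)).
  by apply: (inW_ext _ (inW_peaks r1 alpha_r x0 n h1)) => s; rewrite mulr1.
pose V k i := ip (dualt k) (fun s => mult s * orp i s).
have [t [t1 tV]] := kernel_vector N V.
pose g s := \sum_(0 <= i < N.+1) t i * orp i s.
pose f s := mult s * g s.
have Wg : inW N g.
  apply: inW_sum => i; rewrite mem_index_iota ltnS => /andP[_ iN].
  exact: (inW_mono iN (inW_orp orf i)).
have b0 s : bodd M s != 0 by exact: (bodd_neq0 r1 alpha_r).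
have Wf : inW M (fun s => bodd M s * f s).
  apply: (inW_ext _ (inW_zvarpi r1 alpha_r (inW_peaks r1 alpha_r x0 n Wg))) => s.
  by rewrite /f /mult -/M; field; rewrite b0 (pfac_neq0 r1 alpha_r false M (cabs_circle s)).
have Wfz : inW M (fun s => bodd M s * ((z_ s)^* * f s)).
  apply: (inW_ext _ (inW_invvarpi r1 alpha_r (inW_peaks r1 alpha_r x0 n Wg))) => s.
  rewrite /f /mult -/M cj_unit ?cabs_circle //; field.
  by rewrite b0 (pfac_neq0 r1 alpha_r false M (cabs_circle s)) unit_neq0 // cabs_circle.
have nf : cnice f by apply: cnice_mul nmult (inW_nice r1 alpha_r Wg).
have nfs := rnice_cabs_sq nf.
have hv k : (k < N)%N -> ip (dualt k) f = 0.
  move=> kN; rewrite -(tV k kN) -ip_sumr.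
  - congr (ip _ _); apply/funext => s; rewrite /f /g mulr_sumr.
    by apply: eq_bigr => i _; rewrite mulrCA.
  - apply: cnice_mul; last exact: cnice_cst.
    apply: cnice_mul; last exact: lip_nice (lip_bodd_inv r1 alpha_r k).
    apply: cnice_mul; first exact: lip_nice (lip_pfac _ _ _).
    by case: (odd k); [exact: (nice_orp r1 alpha_r orf)|exact: (inW_nice r1 alpha_r (inW_orq r1 alpha_r orf k))].
  - by move=> i _; apply: cnice_mul nmult (nice_orp r1 alpha_r orf i).
set I := rint (fun s => cabs (f s) ^+ 2).
have fb := form_bound r1 alpha_r orf Wf Wfz (cabs_circle l1) (cabs_circle l2)
  (ltW (divr_gt0 c0 (divr_gt0 (ltr0n _ 960) r0))) hN hv.
rewrite -/I in fb.
have mE s : cabs (mult s) ^+ 2 = cabs (peaks alpha x0 N n s) ^+ 2 / cabs (varpi alpha M (z_ s)) ^+ 2.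
  rewrite /mult !cabsM !cabsV (cabs_bodd r1 alpha_r) cabs_circle invr1 mulr1 mul1r exprMn exprVn mulrC //.
have gb s : cabs (g s) <= P.
  apply: le_trans (cabs_sum _ _ _) _; rewrite /P big_seq [leRHS]big_seq; apply: ler_sum => i iN.
  rewrite cabsM -[leRHS]mul1r; apply: ler_pM; rewrite ?cabs_ge0 //.
  rewrite -t1 (bigD1_seq i) ?iota_uniq //= lerDl.
  by apply: sumr_ge0 => j _; exact: cabs_ge0.
have vl s := pfac_lower alpha_r false M (cabs_circle s).
have vu s := pfac_upper r1 alpha_r false M (cabs_circle s).
have vp s : 0 < cabs (varpi alpha M (z_ s)) := lt_le_trans r0 (vl s).
pose X := rint (fun s => cabs (\sum_(0 <= i < N.+1) t i * loc dJ i s) ^+ 2).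
have XJ : cJ <= X := hJ t t1.
have locE s : \sum_(0 <= i < N.+1) t i * loc dJ i s = ((\1_(cball dJ) : circle R -> R) s)%:C * g s.
  by rewrite /g mulr_sumr; apply: eq_bigr => i _; rewrite /loc mulrCA.
have nX : rnice (fun s => cabs (\sum_(0 <= i < N.+1) t i * loc dJ i s) ^+ 2).
  by apply: rnice_cabs_sq; apply: cnice_sum => i _; apply: cnice_scale; exact: nice_loc.
have IX : qJ ^+ n / 4 * X <= I.
  rewrite -(rintZ mu _ nX); apply: le_rint => //; first exact: rnice_mul (rnice_cst _) nX.
  move=> s; rewrite locE indicE; have [|nJ] := boolP (s \in cball dJ); last first.
    by rewrite mul0r cabs0 expr0n mulr0 sqr_ge0.
  rewrite inE mul1r => sJ; rewrite /f cabsM exprMn ler_wpM2r ?sqr_ge0 // mE.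
  apply: ler_pM; rewrite ?exprn_ge0 ?invr_ge0 ?(ltW qJ0) //.
    by apply: peaks_lower; [exact: ltW | move=> k; exact: inP].
  rewrite lef_pV2 ?posrE ?exprn_gt0 // (_ : 4 = 2 ^+ 2); last by ring.
  by rewrite ler_pXn2r ?nnegrE ?cabs_ge0 //; exact: vu.
pose o : circle R -> R := \1_(~` cball d).
have no : rnice o.
  apply: rnice_indic; apply: measurableC; exact: measurable_open (open_cball _ _).
have nof : rnice (fun s => o s * cabs (f s) ^+ 2) by exact: rnice_mul.
pose Iout := rint (fun s => o s * cabs (f s) ^+ 2).
have Iout_le : Iout <= qI ^+ n * (P ^+ 2 / (1 - r) ^+ 2).
  rewrite -[leRHS](rint_cst mu); apply: le_rint => //; first exact: rnice_cst.
  move=> s; rewrite /o indicE; have [|_] := boolP (s \in ~` cball d); last first.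
    by rewrite mul0r mulr_ge0 ?divr_ge0 ?exprn_ge0 // ltW.
  rewrite inE mul1r => so; rewrite /f cabsM exprMn mE.
  rewrite [leRHS]mulrA [leRHS]mulrAC.
  apply: ler_pM; last by rewrite ler_pXn2r ?nnegrE ?cabs_ge0.
  - exact: divr_ge0 (sqr_ge0 _) (sqr_ge0 _).
  - exact: sqr_ge0.
  apply: ler_pM; rewrite ?invr_ge0 ?sqr_ge0 //.
    by apply: peaks_upper => k; exact: outP.
  rewrite lef_pV2 ?posrE ?exprn_gt0 // ler_pXn2r ?nnegrE ?cabs_ge0 ?(ltW r0) //.
  exact: vl.
have I0 : 0 < I.
  apply: lt_le_trans IX; rewrite mulr_gt0 ?divr_gt0 ?exprn_gt0 //.
  exact: lt_le_trans XJ.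
have IoutI : Iout <= c / 64 * I.
  apply: le_trans Iout_le _; apply: le_trans (_ : _ <= c / 64 * (qJ ^+ n / 4 * cJ)) _; last first.
    rewrite ler_wpM2l ?divr_ge0 ?(ltW c0) //; apply: le_trans IX.
    by rewrite ler_wpM2l // divr_ge0 // exprn_ge0 // ltW.
  have -> : c / 64 * (qJ ^+ n / 4 * cJ) = (c * cJ / 256 * qJ ^+ n) * 1 by field.
  have -> : qI ^+ n * (P ^+ 2 / (1 - r) ^+ 2) = (c * cJ / 256 * qJ ^+ n) *
     ((qI / qJ) ^+ n * (P ^+ 2 / (1 - r) ^+ 2 * 256 / (c * cJ))).
    by rewrite expr_div_n; field; rewrite (gt_eqF cJ0) (gt_eqF c0) (gt_eqF r0) expf_neq0 // gt_eqF.
  have qn0 : 0 <= qJ ^+ n by rewrite exprn_ge0 // ltW.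
  have cc0 : 0 <= c * cJ / 256 by rewrite divr_ge0 // ltW // mulr_gt0.
  by rewrite (ler_wpM2l (mulr_ge0 cc0 qn0)).
have lipG : lip G.
  have h (l : circle R) : lip (fun s => z_ l - z_ s).
    apply: lip_add (lip_cst _) _; under eq_fun do rewrite -mulN1r.
    exact: lip_scale (lip_val R).
  by apply: lip_mul (h l2) (lip_conj (h l1)).
have nsq : cnice (fun s => (cabs (f s) ^+ 2)%:C) by exact: cnice_real.
have nG := lip_nice lipG.
pose E := cint mu (fun s => (G s - G x0) * (cabs (f s) ^+ 2)%:C).
have split_int : cint mu (fun s => G s * (cabs (f s) ^+ 2)%:C) = G x0 * I%:C + E.
  rewrite -cint_real -(cintZ mu _ nsq) -cintD.
  - by congr (cint _ _); apply/funext => s; ring.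
  - exact: cnice_scale.
  - apply: cnice_mul => //; apply: cnice_sub => //; exact: cnice_cst.
have Gbound s : cabs (G s) <= 4.
  rewrite cabsM cabsJ (_ : 4 = 2 * 2); last by ring.
  by apply: ler_pM; rewrite ?cabs_ge0 //; exact: cdist_le2.
have Glip s : cabs (G s - G x0) <= 4 * cdist x0 s.
  have -> : G s - G x0 = (z_ x0 - z_ s) * (z_ l1 - z_ s)^* + (z_ l2 - z_ x0) * (z_ x0 - z_ s)^*.
    by rewrite /G !cjB; ring.
  apply: le_trans (cabsD _ _) _; rewrite !cabsM !cabsJ -!/(cdist _ _).
  have h1 := cdist_le2 l1 s; have h2 := cdist_le2 l2 x0.
  have h3 := cabs_ge0 (z_ x0 - z_ s).
  have := ler_wpM2l h3 h1; have := ler_wpM2r h3 h2; rewrite -/(cdist x0 s); lra.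
(* Twice [c / 8] from the ball, plus twice [8 * (c / 64)] from its complement, where [|G s - G x0|]
   is at most 8. *)
have Eb : cabs E <= c / 2 * I.
  have nb1 : rnice (fun s => c / 8 * cabs (f s) ^+ 2) by exact: rnice_mul (rnice_cst _) nfs.
  have nb2 : rnice (fun s => 8 * (o s * cabs (f s) ^+ 2)) by exact: rnice_mul (rnice_cst _) nof.
  have nE : cnice (fun s => (G s - G x0) * (cabs (f s) ^+ 2)%:C).
    apply: cnice_mul => //; apply: cnice_sub => //; exact: cnice_cst.
  have := cabs_cint mu nE (rnice_add nb1 nb2).
  rewrite (rintD mu nb1 nb2) (rintZ mu _ nfs) (rintZ mu _ nof) -/I -/Iout -/E => h.
  have h' : c / 2 * I = c / 8 * I * 2 + 16 * (c / 64 * I) by field.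
  suff /h hb : forall s, cabs ((G s - G x0) * (cabs (f s) ^+ 2)%:C) <=
      c / 8 * cabs (f s) ^+ 2 + 8 * (o s * cabs (f s) ^+ 2).
    apply: le_trans hb _; rewrite h' mulrDr mulrC lerD2l mulrA -natrM.
    by rewrite ler_wpM2l.
  move=> s; rewrite cabsM cabsR ger0_norm ?sqr_ge0 //.
  have f2 := sqr_ge0 (cabs (f s)).
  rewrite /o indicE; have [|] := boolP (s \in ~` cball d).
    rewrite inE => _; rewrite mul1r -mulrDl ler_wpM2r //.
    have := cabsD (G s) (- G x0); rewrite cabsN; have := Gbound s; have := Gbound x0; lra.
  move=> /negP; rewrite inE => /contrapT sd; rewrite mul0r mulr0 addr0 ler_wpM2r //.
  by apply: le_trans (Glip s) _; move: sd; rewrite /cball /= /d; lra.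
have lowI : c * I <= cabs (cint mu (fun s => G s * (cabs (f s) ^+ 2)%:C)) + c / 2 * I.
  have := cabs_sub (G x0 * I%:C) (- E); rewrite opprK -split_int cabsN cabsM cabsR.
  by rewrite (gtr0_norm I0) -/c; lra.
have e1 : 5 * (c / (960 / (1 - r))) * (24 / (1 - r) * I) = c / 8 * I.
  by field; rewrite gt_eqF.
rewrite e1 in fb.
have : 0 < c * I by rewrite mulr_gt0.
have {lowI fb} := le_trans lowI (lerD fb (lexx _)).
have -> : c / 8 * I + c / 2 * I = 5 / 8 * (c * I) by field.
move: (c * I) => y; lra.
Qed.

End Sufficiency.

Definition vanishes (R : realType) (u : nat -> R[i]) : Prop :=
  forall e : R, 0 < e -> exists N, forall n, (N <= n)%N -> cabs (u n) < e.

Lemma cvgn_vanishes (R : realType) (u : nat -> R[i]) :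
  ((u : nat -> R[i]^o) @ \oo --> (0 : R[i]^o)) <-> vanishes u.
Proof.
by rewrite cvgn_cabsP; split=> h e /h[N hN]; exists N => n /hN; rewrite subr0.
Qed.

(** * The conditions of the theorem *)

Section Equivalences.
Variables (R : realType) (mu : probability (borel_circle R) R).
Variables (alpha : nat -> R[i]) (r : R).
Hypotheses (r1 : r < 1) (alpha_r : forall n, cabs (alpha n) <= r).
Variables (a : nat -> R[i]) (phi : nat -> R[i] -> R[i]).
Hypothesis (orf : orf_with alpha a mu phi).
Notation ip := (ip mu).
Notation eta := (eta alpha).
Notation rho := (rho a).
Notation pfac := (pfac alpha).
Notation hrow := (hrow alpha a phi).
Notation kfun := (kfun alpha a).
Notation cond1 := (cond1 a).
Notation cond2 := (cond2 alpha a).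
Notation cond3 := (cond3 alpha a).
Notation z_ := (@circle_val R).

Let r0 : 0 < 1 - r. Proof. by rewrite subr_gt0. Qed.

Let eta_le1 n : cabs (eta n) ^+ 2 <= 1.
Proof.
by rewrite (cabs_eta_sq r1 alpha_r) gerDl oppr_le0 sqr_ge0.
Qed.

Let eta_gt0 n : 0 < cabs (eta n) ^+ 2.
Proof. exact: lt_le_trans r0 (eta_sq_lower r1 alpha_r n). Qed.

Lemma conds_necessary (l1 l2 : circle R) :
  limit_point (supp mu) `<=` [set l1; l2] ->
  [/\ vanishes cond1, vanishes (cond2 (z_ l1) (z_ l2)) & vanishes (cond3 (z_ l1) (z_ l2))].
Proof.
move=> /(gram_vanish r1 alpha_r orf) hg.
have [h1 h2] := (cabs_circle l1, cabs_circle l2).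
split=> e e0.
- have [N hN] := hg _ (mulr_gt0 e0 (exprn_gt0 2 r0)).
  exists N.+2 => -[|[|n]] //; rewrite !ltnS => Nn.
  have := hN n.+1 n.+3 (leqW Nn) (leqW (leqW (leqW Nn))).
  rewrite (cabs_gram_next2 r1 alpha_r orf) //.
  set c := _ / _; have hc : (1 - r) ^+ 2 <= c.
    rewrite /c -[leLHS]mulr1; apply: ler_pM; rewrite ?exprn_ge0 ?(ltW r0) ?ler01 //.
      by rewrite expr2; apply: ler_pM; rewrite ?(ltW r0) //; exact: pfac_lower.
    by rewrite invf_ge1 // eta_le1.
  move=> h; rewrite -(ltr_pM2r (exprn_gt0 2 r0)); apply: le_lt_trans h.
  by rewrite ler_wpM2l // cabs_ge0.
- have [N hN] := hg _ e0; exists N.+2 => -[|[|n]] //; rewrite !ltnS => Nn.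
  have := hN n.+1 n.+2 (leqW Nn) (leqW (leqW Nn)).
  by rewrite (cabs_gram_next r1 alpha_r orf).
- have [N hN] := hg _ e0; exists N.+1 => -[|n] //; rewrite !ltnS => Nn.
  have := hN n.+1 n.+1 (leqW Nn) (leqW Nn).
  rewrite (cabs_gram_diag r1 alpha_r orf) //; apply: le_lt_trans.
  by rewrite ler_pdivlMr // ler_piMr ?cabs_ge0.
Qed.

Lemma gram_small_upper (l1 l2 : R[i]) : cabs l1 = 1 -> cabs l2 = 1 ->
  vanishes cond1 -> vanishes (cond2 l1 l2) -> vanishes (cond3 l1 l2) ->
  forall e : R, 0 < e -> exists N, forall n k, (N <= n)%N -> (n <= k)%N ->
    cabs (ip (hrow l1 n) (hrow l2 k)) <= e.
Proof.
move=> h1 h2 c1 c2 c3 e e0.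
have er : 0 < e * ((1 - r) / 4) by rewrite mulr_gt0 // divr_gt0.
have [N1 hN1] := c1 _ er; have [N2 hN2] := c2 _ e0; have [N3 hN3] := c3 _ (mulr_gt0 e0 r0).
exists (maxn N1 (maxn N2 N3)).+1 => -[|n] k //; rewrite ltnS !geq_max => /and3P[n1 n2 n3].
rewrite leq_eqVlt => /orP[/eqP <-|].
  rewrite (cabs_gram_diag r1 alpha_r orf) // ler_pdivrMr //.
  apply: le_trans (ltW (hN3 _ (leqW n3))) _.
  by rewrite ler_pM2l //; exact: (eta_sq_lower r1 alpha_r).
rewrite leq_eqVlt => /orP[/eqP <-|].
  rewrite (cabs_gram_next r1 alpha_r orf) //; apply: ltW; apply: hN2.
  exact: leqW (leqW n2).
rewrite leq_eqVlt => /orP[/eqP <-|nk]; last first.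
  by rewrite (gram_far r1 alpha_r orf) // cabs0 ltW.
rewrite (cabs_gram_next2 r1 alpha_r orf) //.
set c := _ / _; have hc : c <= 4 / (1 - r).
  apply: ler_pM; rewrite ?mulr_ge0 ?cabs_ge0 ?invr_ge0 ?sqr_ge0 //.
    have -> : 4 = 2 * 2 :> R by ring.
    by apply: ler_pM; rewrite ?cabs_ge0 //; exact: (pfac_upper r1 alpha_r).
  by rewrite lef_pV2 ?posrE //; exact: (eta_sq_lower r1 alpha_r).
apply: le_trans (ler_wpM2l (cabs_ge0 _) hc) _.
have -> : e = (e * ((1 - r) / 4)) * (4 / (1 - r)) by field; rewrite gt_eqF.
rewrite ler_wpM2r ?divr_ge0 ?(ltW r0) //; apply: ltW; apply: hN1.
exact: leqW (leqW n1).
Qed.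

(** [gram_small_upper] covers [n <= k] only. The other half of the matrix for [l2, l1] consists of
    conjugates of entries for [l1, l2], so the conditions are used with both orders of the
    points. *)
Lemma conds_sufficient (l1 l2 : circle R) :
  vanishes cond1 -> vanishes (cond2 (z_ l1) (z_ l2)) -> vanishes (cond3 (z_ l1) (z_ l2)) ->
  limit_point (supp mu) `<=` [set l1; l2].
Proof.
move=> c1 c2 c3 x hx; apply: (gram_small_isolated r1 alpha_r orf _ hx) => e e0.
have [h1 h2] := (cabs_circle l1, cabs_circle l2).
have nh l n : cnice (hrow l n) by exact: (nice_hrow r1 alpha_r orf).
have cC l l' n k : cabs (ip (hrow l n) (hrow l' k)) = cabs (ip (hrow l' k) (hrow l n)).
  by rewrite -[LHS]cabsJ ipC.
have c2' : vanishes (cond2 (z_ l2) (z_ l1)).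
  move=> d /c2[N hN]; exists N.+1 => n Nn; rewrite (cond2_sym r1 alpha_r); first exact: hN (ltnW Nn).
  exact: leq_ltn_trans Nn.
have c3' : vanishes (cond3 (z_ l2) (z_ l1)).
  move=> d /c3[N hN]; exists N.+1 => -[|n] // Nn.
  suff -> : cabs (cond3 (z_ l2) (z_ l1) n.+1) = cabs (cond3 (z_ l1) (z_ l2) n.+1).
    exact: hN (ltnW Nn).
  have := cC (z_ l2) (z_ l1) n.+1 n.+1; rewrite !(cabs_gram_diag r1 alpha_r orf) //.
  by apply: mulIf; rewrite invr_eq0 gt_eqF.
have [N hN] := gram_small_upper h1 h2 c1 c2 c3 e0.
have [N' hN'] := gram_small_upper h2 h1 c1 c2' c3' e0.
exists (maxn N N') => n k; rewrite !geq_max => /andP[n1 n2] /andP[k1 k2].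
have [nk|kn] := leqP n k; first exact: hN'.
by rewrite cC hN // ltnW.
Qed.

Let num n l : R[i] := (a n)^* * a n.+1 * varpi alpha n l + varpis alpha n l.

Lemma zetat_sub n l : (0 < n)%N ->
  1 + (alpha n)^* * (- (a n)^* * a n.+1) != 0 /\
  zetat alpha n (- (a n)^* * a n.+1) - l =
    - num n l / (1 + (alpha n)^* * (- (a n)^* * a n.+1)).
Proof.
move=> n0; have h : 1 + (alpha n)^* * (- (a n)^* * a n.+1) != 0.
  have := varpi_neq0 r1 alpha_r n (z := (a n)^* * a n.+1).
  rewrite /varpi -mulrN -mulNr; apply.
  rewrite cabsM cabsJ -[1]mulr1; apply: ler_pM; rewrite ?cabs_ge0 //.
    exact: ltW (a_lt1 orf n0).
  exact: ltW (a_lt1 orf (ltn0Sn n)).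
split=> //; rewrite /zetat /num /varpi /varpis; by field.
Qed.

(** Since [|a n|^2 + rho n ^+ 2 = 1], the numerator is
    [(a n)^* kfun n l + rho n ^+ 2 varpis n l]. *)
Lemma cabs_zetat_sub_upper n l : (0 < n)%N -> cabs l = 1 ->
  cabs (zetat alpha n (- (a n)^* * a n.+1) - l) <=
  (cabs (kfun n l) + 2 * cabs (rho n) ^+ 2) / (1 - r).
Proof.
move=> n0 hl; have [h ->] := zetat_sub l n0.
have numE : num n l = (a n)^* * kfun n l + (rho n ^+ 2) * varpis alpha n l.
  rewrite rho_sq rmorphB /= -mulJC rmorph1 /num /Defs.kfun; ring.
rewrite cabsM cabsN cabsV; apply: ler_pM; rewrite ?cabs_ge0 ?invr_ge0 ?cabs_ge0 //.
  rewrite numE; apply: le_trans (cabsD _ _) _; apply: lerD.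
    by rewrite cabsM cabsJ -[leRHS]mul1r ler_wpM2r ?cabs_ge0 // ltW // (a_lt1 orf).
  rewrite cabsM mulrC cabsX ler_wpM2r ?exprn_ge0 ?cabs_ge0 //.
  exact: (pfac_upper r1 alpha_r true).
rewrite lef_pV2 ?posrE ?cabs_gt0 //.
apply: le_trans (_ : _ <= cabs 1 - cabs ((alpha n)^* * (- (a n)^* * a n.+1))) _; last first.
  by have := cabs_sub 1 (- ((alpha n)^* * (- (a n)^* * a n.+1))); rewrite opprK cabsN.
rewrite cabs1 lerD2l lerN2 !cabsM cabsN !cabsJ -[leRHS]mulr1.
apply: ler_pM; rewrite ?mulr_ge0 ?cabs_ge0 //.
rewrite -[1]mulr1; apply: ler_pM; rewrite ?cabs_ge0 //.
  exact: ltW (a_lt1 orf n0).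
exact: ltW (a_lt1 orf (ltn0Sn n)).
Qed.

(** For equal points the third sequence is a sum of squares, so its limit alone controls [kfun] and
    [rho]; this is why a single limit suffices in the first equivalence. *)
Lemma cond3_diagE l n : cond3 l l n.+1 = (cabs (kfun n.+1 l) ^+ 2
  + (cabs (eta n.+1) * cabs (rho n.+1) / cabs (eta n)) ^+ 2 * cabs (varpis alpha n l) ^+ 2
  + (cabs (eta n.+1) * cabs (rho n.+2) / cabs (eta n.+2)) ^+ 2 * cabs (varpi alpha n.+2 l) ^+ 2)%:C.
Proof.
have hr k : rho k.+1 = (cabs (rho k.+1))%:C by exact: (rho_real orf).
have he k := eta_real r1 alpha_r k.
have xE k m : eta n.+1 * rho k.+1 / eta m =
    (cabs (eta n.+1) * cabs (rho k.+1) / cabs (eta m))%:C.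
  by rewrite !rmorphM fmorphV /= -!he -hr.
rewrite cond3E /pfac [n.+1.-1]/= !xE -(mulrA (_ ^+ 2)) -(mulrA (_ ^+ 2)) !mulJC.
by rewrite -!rmorphXn -!rmorphM -!rmorphD.
Qed.

Lemma cond3_diag_lower l n : cabs l = 1 ->
  cabs (kfun n.+1 l) ^+ 2 <= cabs (cond3 l l n.+1) /\
  cabs (rho n.+1) ^+ 2 * (1 - r) ^+ 3 <= cabs (cond3 l l n.+1).
Proof.
move=> hl; rewrite cond3_diagE cabsR ger0_norm; last by apply: addr_ge0; [apply: addr_ge0; [exact: sqr_ge0|]|]; apply: mulr_ge0; exact: sqr_ge0.
have p1 : 0 <= cabs (kfun n.+1 l) ^+ 2 by exact: sqr_ge0.
have p2 : 0 <= (cabs (eta n.+1) * cabs (rho n.+2) / cabs (eta n.+2)) ^+ 2 * cabs (varpi alpha n.+2 l) ^+ 2.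
  by apply: mulr_ge0; exact: sqr_ge0.
have p3 : 0 <= (cabs (eta n.+1) * cabs (rho n.+1) / cabs (eta n)) ^+ 2 * cabs (varpis alpha n l) ^+ 2.
  by apply: mulr_ge0; exact: sqr_ge0.
split; first by lra.
apply: le_trans (_ : _ <= (cabs (eta n.+1) * cabs (rho n.+1) / cabs (eta n)) ^+ 2 * cabs (varpis alpha n l) ^+ 2) _; last by lra.
have -> : (cabs (eta n.+1) * cabs (rho n.+1) / cabs (eta n)) ^+ 2 * cabs (varpis alpha n l) ^+ 2
  = cabs (rho n.+1) ^+ 2 * (cabs (eta n.+1) ^+ 2 * cabs (varpis alpha n l) ^+ 2 / cabs (eta n) ^+ 2).
  by rewrite expr_div_n exprMn; ring.
rewrite ler_wpM2l ?sqr_ge0 // -[leLHS]mulr1.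
apply: ler_pM; rewrite ?exprn_ge0 ?(ltW r0) ?ler01 //; last by rewrite invf_ge1 // eta_le1.
rewrite exprS; apply: ler_pM; rewrite ?sqr_ge0 ?(ltW r0) //.
  exact: (eta_sq_lower r1 alpha_r).
by rewrite ler_pXn2r ?nnegrE ?cabs_ge0 ?(ltW r0) //; exact: (pfac_lower alpha_r true).
Qed.

Lemma cond3_zetat (l : R[i]) : cabs l = 1 -> vanishes (cond3 l l) ->
  vanishes (fun n => zetat alpha n (- (a n)^* * a n.+1) - l).
Proof.
move=> hl h e e0.
have e2 : 0 < e * (1 - r) / 4 by rewrite divr_gt0 // mulr_gt0.
(* The two bounds bring [kfun] and [rho ^+ 2] below a quarter of [e * (1 - r)]; with weights 1 and 2
   their sum stays under three quarters. *)
have d0 : 0 < Num.min ((e * (1 - r) / 4) ^+ 2) (e * (1 - r) / 4 * (1 - r) ^+ 3).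
  by rewrite lt_min exprn_gt0 //= mulr_gt0 // exprn_gt0.
have [N hN] := h _ d0; exists N.+1 => -[|n] //; rewrite ltnS => /leqW/hN.
rewrite lt_min => /andP[d1 d2].
have [l1 l2] := cond3_diag_lower n hl.
apply: le_lt_trans (cabs_zetat_sub_upper (ltn0Sn n) hl) _.
rewrite ltr_pdivrMr //.
have k1 : cabs (kfun n.+1 l) < e * (1 - r) / 4.
  rewrite -(@ltr_pXn2r _ 2) ?nnegrE ?cabs_ge0 ?(ltW e2) //; exact: le_lt_trans l1 d1.
have k2 : cabs (rho n.+1) ^+ 2 < e * (1 - r) / 4.
  rewrite -(ltr_pM2r (exprn_gt0 3 r0)); exact: le_lt_trans l2 d2.
have : 0 < e * (1 - r) by rewrite mulr_gt0.
move: k1 k2; move: (e * (1 - r)) => y; lra.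
Qed.

Let D : R := (1 - r)^-1.

Lemma D_ge1 : 1 <= D.
Proof. by rewrite /D invf_ge1 //; have := r_ge0 alpha_r; lra. Qed.

(** On the circle [varpis] and [varpi] have the same modulus, so a small numerator forces
    [|a n| |a n.+1|] close to 1. Then both [rho] are small, and so is [kfun n l], which equals [a n
    * num n l + rho n ^+ 2 * (a n.+1 * varpi n l)]. *)
Lemma zetat_controls l n : (0 < n)%N -> cabs l = 1 ->
  let e := cabs (zetat alpha n (- (a n)^* * a n.+1) - l) in
  [/\ cabs (rho n) ^+ 2 <= 4 * D * e, cabs (rho n.+1) ^+ 2 <= 4 * D * e &
      cabs (kfun n l) <= 10 * D * e].
Proof.
move=> n0 hl e; have [h E] := zetat_sub l n0.
have D1 := D_ge1; have e0 : 0 <= e by exact: cabs_ge0.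
have an := a_lt1 orf n0; have an1 := a_lt1 orf (ltn0Sn n).
have [an0 an10] := (cabs_ge0 (a n), cabs_ge0 (a n.+1)).
have w1 : cabs (a n) * cabs (a n.+1) <= 1.
  by rewrite -[1]mulr1; apply: ler_pM => //; exact: ltW.
have num_le : cabs (num n l) <= 2 * e.
  rewrite /e E cabsM cabsN cabsV mulrA ler_pdivlMr ?cabs_gt0 // mulrC ler_wpM2r ?cabs_ge0 //.
  apply: le_trans (cabsD _ _) _; rewrite cabs1 !cabsM cabsN !cabsJ.
  have : cabs (alpha n) * (cabs (a n) * cabs (a n.+1)) <= 1 * 1.
    by apply: ler_pM; rewrite ?mulr_ge0 //?cabs_ge0 // ltW // (alpha_lt1 r1 alpha_r).
  by lra.
have v0 : 1 - r <= cabs (varpi alpha n l) by exact: (pfac_lower alpha_r false).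
have ve : cabs (varpis alpha n l) = cabs (varpi alpha n l).
  exact: (cabs_pfac_neg alpha false n hl).
have low : cabs (varpi alpha n l) * (1 - cabs (a n) * cabs (a n.+1)) <= cabs (num n l).
  have := cabs_sub (varpis alpha n l) (- ((a n)^* * a n.+1 * varpi alpha n l)).
  rewrite opprK addrC /num [varpis _ _ _ + _]addrC cabsN !cabsM cabsJ ve => hh.
  by apply: le_trans hh; rewrite le_eqVlt; apply/orP; left; apply/eqP; ring.
have one_w : 1 - cabs (a n) * cabs (a n.+1) <= 2 * D * e.
  have -> : 2 * D * e = 2 * e / (1 - r) by rewrite /D; ring.
  rewrite ler_pdivlMr //; apply: le_trans num_le; apply: le_trans low.
  by rewrite [leRHS]mulrC ler_wpM2l // subr_ge0.
have rho_le k : (0 < k)%N -> cabs (a n) * cabs (a n.+1) <= cabs (a k) -> cabs (rho k) ^+ 2 <= 4 * D * e.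
  move=> k0 hk; rewrite (cabs_rho_sq orf k0).
  have hk0 := cabs_ge0 (a k); have hk1 := a_lt1 orf k0.
  have -> : 1 - cabs (a k) ^+ 2 = (1 - cabs (a k)) * (1 + cabs (a k)) by ring.
  have : (1 - cabs (a k)) * (1 + cabs (a k)) <= (1 - cabs (a k)) * 2.
    by rewrite ler_wpM2l; lra.
  by move: one_w; rewrite -!mulrA; move: (D * e) => y; lra.
have rn : cabs (rho n) ^+ 2 <= 4 * D * e.
  by apply: rho_le => //; rewrite -[leRHS]mulr1 ler_wpM2l // ltW.
split=> //; first by apply: rho_le => //; rewrite -[leRHS]mul1r ler_wpM2r // ltW.
have kE : kfun n l = a n * num n l + rho n ^+ 2 * (a n.+1 * varpi alpha n l).
  rewrite rho_sq rmorphB /= -mulJC rmorph1 /num /Defs.kfun; ring.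
rewrite kE; apply: le_trans (cabsD _ _) _.
have t1 : cabs (a n * num n l) <= 2 * (D * e).
  rewrite cabsM; apply: (@le_trans _ _ (1 * (2 * e))).
    by apply: ler_pM; rewrite ?cabs_ge0 // ltW.
  by rewrite mul1r ler_wpM2l // -[leLHS]mul1r ler_wpM2r.
have t2 : cabs (rho n ^+ 2 * (a n.+1 * varpi alpha n l)) <= (4 * D * e) * 2.
  rewrite cabsM cabsX; apply: ler_pM; rewrite ?sqr_ge0 ?cabs_ge0 //.
  rewrite cabsM -[2]mul1r; apply: ler_pM; rewrite ?cabs_ge0 ?(ltW an1) //.
  exact: (pfac_upper r1 alpha_r false).
have -> : 10 * D * e = 2 * (D * e) + 4 * D * e * 2 by ring.
exact: lerD.
Qed.

Lemma zetat_conds (l : R[i]) : cabs l = 1 ->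
  vanishes (fun n => zetat alpha n (- (a n)^* * a n.+1) - l) ->
  [/\ vanishes cond1, vanishes (cond2 l l) & vanishes (cond3 l l)].
Proof.
move=> hl hz.
have D1 := D_ge1; have D0 : 0 < D by lra.
pose e n := cabs (zetat alpha n (- (a n)^* * a n.+1) - l).
have e0 n : 0 <= e n by exact: cabs_ge0.
have hc n : (0 < n)%N -> [/\ cabs (rho n) ^+ 2 <= 4 * D * e n,
    cabs (rho n.+1) ^+ 2 <= 4 * D * e n & cabs (kfun n l) <= 10 * D * e n].
  by move=> n0; exact: (zetat_controls n0 hl).
have DD : D <= D ^+ 2 by rewrite expr2 -[leLHS]mulr1 ler_wpM2l // ltW.
(* The largest of the three estimates is the one for [cond3], with [40 + 16 + 16 = 72]. *)
have hK : 0 < 72 * D ^+ 2 by rewrite mulr_gt0 // exprn_gt0.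
have bnd (u : nat -> R[i]) : (forall n, (0 < n)%N -> cabs (u n.+1) <= 72 * D ^+ 2 * (e n.+1 + e n)) ->
    vanishes u.
  move=> hu d d0.
  have [N hN] := hz _ (divr_gt0 d0 (mulr_gt0 (ltr0n R 2) hK)).
  exists N.+2 => -[|[|n]] //; rewrite !ltnS => Nn.
  apply: le_lt_trans (hu n.+1 (ltn0Sn n)) _.
  have h1 := hN n.+2 (leqW (leqW Nn)); have h2 := hN n.+1 (leqW Nn).
  have : e n.+2 + e n.+1 < d / (2 * (72 * D ^+ 2)) + d / (2 * (72 * D ^+ 2)) by exact: ltrD.
  rewrite -(ltr_pM2l hK) => h3; apply: lt_le_trans h3 _.
  by rewrite le_eqVlt; apply/orP; left; apply/eqP; field; rewrite gt_eqF.
have De n : D * e n <= D ^+ 2 * e n by rewrite ler_wpM2r.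
have D2e n : 0 <= D ^+ 2 * e n by rewrite mulr_ge0 // sqr_ge0.
have kf4 n : (0 < n)%N -> cabs (kfun n l) <= 4.
  move=> n0; apply: le_trans (cabsD _ _) _; rewrite !cabsM.
  have := pfac_upper r1 alpha_r true n hl; have := pfac_upper r1 alpha_r false n hl.
  have := a_lt1 orf n0; have := a_lt1 orf (ltn0Sn n).
  rewrite /pfac => h1 h2 h3 h4.
  have := ler_pM (cabs_ge0 _) (cabs_ge0 _) (ltW h2) h4.
  have := ler_pM (cabs_ge0 _) (cabs_ge0 _) (ltW h1) h3; lra.
have etaD n : (cabs (eta n) ^+ 2)^-1 <= D.
  by rewrite lef_pV2 ?posrE //; exact: (eta_sq_lower r1 alpha_r).
split; apply: bnd => n n0; have [rn rn1 kn] := hc _ n0; have [rm rm1 km] := hc _ (ltn0Sn n).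
- rewrite /cond1 cabsM.
  have := sqr_ge0 (cabs (rho n.+1) - cabs (rho n.+2)).
  have -> : (cabs (rho n.+1) - cabs (rho n.+2)) ^+ 2 = cabs (rho n.+1) ^+ 2 + cabs (rho n.+2) ^+ 2
     - 2 * (cabs (rho n.+1) * cabs (rho n.+2)) by ring.
  move: rm rm1 (De n.+1) (D2e n) (D2e n.+1); rewrite !mulrDr -!mulrA.
  move: (D * e n.+1) (D ^+ 2 * e n.+1) (D ^+ 2 * e n) => y1 y2 y3; lra.
- rewrite cond2E cabsM [n.+1.-1]/=.
  have r_le : cabs (rho n.+1) <= 1 by exact: (cabs_rr orf n.+1).
  apply: le_trans (ler_wpM2r (cabs_ge0 _) r_le) _; rewrite mul1r.
  have part b m X : cabs X <= 10 * D * e m -> cabs (pfac b m l * X / eta m ^+ 2) <= 20 * (D ^+ 2 * e m).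
    move=> hX; rewrite cabsM cabsV cabsX.
    have -> : 20 * (D ^+ 2 * e m) = (2 * (10 * D * e m)) * D by ring.
    apply: ler_pM; rewrite ?cabs_ge0 ?invr_ge0 ?sqr_ge0 //.
    rewrite cabsM; apply: ler_pM; rewrite ?cabs_ge0 //; exact: (pfac_upper r1 alpha_r).
  apply: le_trans (cabsD _ _) _; rewrite cabsN.
  have := part false _ _ km; have := part true _ _ kn.
  move: (D2e n) (D2e n.+1); rewrite !mulrDr -!mulrA.
  move: (D ^+ 2 * e n.+1) (D ^+ 2 * e n) => y2 y3; lra.
- rewrite cond3_diagE cabsR ger0_norm; last by apply: addr_ge0; [apply: addr_ge0; [exact: sqr_ge0|]|]; apply: mulr_ge0; exact: sqr_ge0.
  have part X rh m b m' : cabs rh ^+ 2 <= 4 * D * e n.+1 -> X = cabs (pfac b m' l) ->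
     (cabs (eta n.+1) * cabs rh / cabs (eta m)) ^+ 2 * X ^+ 2 <= 16 * (D ^+ 2 * e n.+1).
    move=> hrh ->.
    have -> : 16 * (D ^+ 2 * e n.+1) = (1 * (4 * D * e n.+1) * D) * 2 ^+ 2 by ring.
    apply: ler_pM; rewrite ?sqr_ge0 //; last first.
      by rewrite ler_pXn2r ?nnegrE ?cabs_ge0 //; exact: (pfac_upper r1 alpha_r).
    rewrite expr_div_n exprMn; apply: ler_pM; rewrite ?invr_ge0 ?sqr_ge0 //.
      by apply: mulr_ge0; exact: sqr_ge0.
    by apply: ler_pM; rewrite ?sqr_ge0.
  have h1 := part _ _ n true n rm erefl; have h2 := part _ _ n.+2 false n.+2 rm1 erefl.
  have h3 : cabs (kfun n.+1 l) ^+ 2 <= 4 * (10 * D * e n.+1).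
    by rewrite expr2; apply: ler_pM; rewrite ?cabs_ge0 ?kf4.
  rewrite /pfac in h1 h2.
  apply: le_trans (lerD (lerD h3 h1) h2) _.
  move: (De n.+1) (D2e n) (D2e n.+1); rewrite !mulrDr -!mulrA.
  move: (D * e n.+1) (D ^+ 2 * e n.+1) (D ^+ 2 * e n) => y1 y2 y3; lra.
Qed.

(** Turns the inclusion of the accumulation points in a singleton into an equality. *)
Lemma limit_point_supp_nonempty : infinite_set (supp mu) ->
  exists x, limit_point (supp mu) x.
Proof.
move=> inf; apply: contrapT => no.
have [s _|l hl] := not_limit_point_finite (S := supp mu) (K := setT) closedT.
  by move=> hs; apply: no; exists s.
apply: inf; apply: sub_finite_set (finite_seq l) => s ss; exact: hl.
Qed.

End Equivalences.

Theorem theorem6p8 (R : realType) (alpha a : nat -> R[i])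
    (alpha0 : alpha 0%N = 0)
    (alpha_compact : compactly_in_disk alpha)
    (a_disk : forall n, (0 < n)%N -> `|a n| < 1)
    (mu : probability (borel_circle R) R)
    (mu_infinite : infinite_set (supp mu))
    (mu_a : schur_parameters alpha a mu)
    (lambda lambda1 lambda2 : circle R) :
  (limit_point (supp mu) = [set lambda] <->
   (fun n => zetat alpha n (- (a n)^* * a n.+1) : R[i]^o) @ \oo
     --> (circle_val lambda : R[i]^o))
  /\
  (limit_point (supp mu) `<=` [set lambda1; lambda2] <->
   [/\ (fun n => rho a n * rho a n.+1 : R[i]^o) @ \oo --> (0 : R[i]^o),
       (fun n => rho a n *
          (varpi alpha n (circle_val lambda1) / varpi alpha n (alpha n)
             * kfun alpha a n (circle_val lambda2)
           - varpis alpha n.-1 (circle_val lambda2)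
               / varpi alpha n.-1 (alpha n.-1)
             * kfun alpha a n.-1 (circle_val lambda1)) : R[i]^o) @ \oo
         --> (0 : R[i]^o) &
       (fun n =>
          (kfun alpha a n (circle_val lambda1))^* * kfun alpha a n (circle_val lambda2)
          + rho_minus alpha a n ^+ 2
            * (varpis alpha n.-1 (circle_val lambda1))^*
            * varpis alpha n.-1 (circle_val lambda2)
          + rho_plus alpha a n.+1 ^+ 2
            * (varpi alpha n.+1 (circle_val lambda1))^*
            * varpi alpha n.+1 (circle_val lambda2) : R[i]^o) @ \oo
         --> (0 : R[i]^o)]).
Proof.
have [phi orf] := mu_a; have [r0 r01 hr0] := alpha_compact.
(* The hypothesis bounds [alpha n] for [n > 0]; the maximum extends the bound to the index 0. *)
pose r := Num.max r0 0.
have r1 : r < 1 by rewrite gt_max r01 ltr01.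
have alpha_r n : cabs (alpha n) <= r.
  case: n => [|n]; first by rewrite alpha0 cabs0 le_max lexx orbT.
  by rewrite le_max -lecR -cabsE hr0.
split.
- have hl := cabs_circle lambda.
  rewrite cvgn_cabsP -/(vanishes (fun n => zetat alpha n (- (a n)^* * a n.+1) - circle_val lambda)).
  split=> [e|/(zetat_conds r1 alpha_r orf hl)[c1 c2 c3]].
    have sub : limit_point (supp mu) `<=` [set lambda; lambda] by rewrite e => s ->; left.
    have [_ _ c3] := conds_necessary r1 alpha_r orf sub.
    exact: (cond3_zetat r1 alpha_r orf hl c3).
  have hs := conds_sufficient r1 alpha_r orf c1 c2 c3.
  have sub s : limit_point (supp mu) s -> s = lambda by move/hs => [|].
  apply/seteqP; split=> s; first exact: sub.
  by move=> ->; have [x hx] := limit_point_supp_nonempty mu_infinite; rewrite -(sub x hx).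
- split=> [h|[/cvgn_vanishes c1 /cvgn_vanishes c2 /cvgn_vanishes c3]].
    have [c1 c2 c3] := conds_necessary r1 alpha_r orf h.
    by split; apply/cvgn_vanishes.
  exact: (conds_sufficient r1 alpha_r orf c1 c2 c3).
Qed.
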